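(* For each $n$ let $S_n$ be a $\sqrt n\times\sqrt n$ square, let $\mathcal P$ be a Poisson process of density $1$ in $S_n$, and for $r\ge 0$ let $G=G_{n,r}$ be the (two-dimensional Gilbert model) graph with vertex set $\mathcal P$ in which two distinct points are joined if and only if their Euclidean distance is at most $r$. Then $$\mathcal H(G\text{ is 2-connected})=\mathcal H(G\text{ has a Hamilton cycle})$$ with high probability, i.e. the probability that this equality holds tends to $1$ as $n\to\infty$.
   Context: For a fixed point set $\mathcal P$ and a monotone (increasing) graph property $P$, $\mathcal H(P)$ denotes the smallest $r$ for which the graph $G_{n,r}$ on this point set has property $P$. Thus $\mathcal H(P)$ is a random variable depending on $\mathcal P$; both sides of the equality are evaluated on the same realisation of $\mathcal P$. ''With high probability'' (whp) means with probability tending to $1$ as $n\to\infty$. *)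

(* Defs.v *)
From HB Require Import structures.
From mathcomp Require Import all_boot all_order all_algebra finmap.
From mathcomp Require Import all_classical all_reals all_analysis.
Set Implicit Arguments.
Unset Strict Implicit.
Unset Printing Implicit Defensive.
Import Order.TTheory GRing.Theory Num.Theory.
Import numFieldNormedType.Exports.
Local Open Scope classical_set_scope.
Local Open Scope ring_scope.

Definition graph_property := forall T : finType, rel T -> Prop.

Definition connected_off (T : finType) (e : rel T) (W : {set T}) : Prop :=
  forall x y : T, x \notin W -> y \notin W ->
    connect [rel u v | [&& u \notin W, v \notin W & e u v]] x y.

Definition k_connected (k : nat) : graph_property := fun T e =>
  (k < #|T|)%N /\ forall W : {set T}, (#|W| < k)%N -> connected_off e W.

(* At least three vertices are required, so that neither a single vertex nor
   an edge traversed back and forth counts as a cycle. *)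
Definition hamiltonian : graph_property := fun T e =>
  exists c : seq T, [/\ ucycle e c, (3 <= size c)%N & forall x : T, x \in c].

(* The norm of the library on R * R is the sup norm, hence this definition. *)
Definition euclidean_dist (R : realType) (x y : R * R) : R :=
  Num.sqrt ((x.1 - y.1) ^+ 2 + (x.2 - y.2) ^+ 2).

Definition gilbert (R : realType) (A : {fset R * R}) (r : R) : rel A :=
  [rel x y : A | (x != y) && (euclidean_dist (val x) (val y) <= r)].
Arguments gilbert {R} A r.

(* The vertex set is finite and gilbert A r is a step function of r, closed on
   the right, so for an increasing property this infimum is the smallest r.
   It is +oo when no r gives a graph with the property (e.g. when there are too
   few points). *)
Definition hitting_radius (R : realType) (Q : graph_property)
    (A : {fset R * R}) : \bar R :=
  ereal_inf [set r%:E | r in [set r : R | 0 <= r /\ Q _ (gilbert A r)]].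

Definition square (R : realType) (a : R) : set (R * R) :=
  `[0, a]%classic `*` `[0, a]%classic.

Definition area (R : realType) : set (R * R) -> \bar R :=
  (lebesgue_measure \x lebesgue_measure)%E.

Definition npoints (R : realType) (A : {fset R * R}) (B : set (R * R)) : nat :=
  #|` [fset x in A | x \in B]%fset |.

(* poisson_pmf of the library is not usable for null sets: at rate 0 its value
   is 1 for every k. Here poisson_weight 0 is the point mass at 0. *)
Definition poisson_weight (R : realType) (lam : R) (k : nat) : R :=
  expR (- lam) * lam ^+ k / k`!%:R.

(* A Poisson process of density rho in the bounded region S, as a random finite
   subset of S: the numbers of points in Borel subsets of S are Poisson random
   variables, and those in pairwise disjoint subsets are independent. *)
Definition poisson_process (R : realType) (d : measure_display)
    (Omega : measurableType d) (P : probability Omega R)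
    (rho : R) (S : set (R * R)) (X : Omega -> {fset R * R}) : Prop :=
  [/\ forall w : Omega, [set` X w] `<=` S,
      forall (B : set (R * R)) (k : nat), measurable B -> B `<=` S ->
        measurable [set w | npoints (X w) B = k],
      forall (B : set (R * R)) (k : nat), measurable B -> B `<=` S ->
        P [set w | npoints (X w) B = k]
          = (poisson_weight (rho * fine (area B)) k)%:E
    & forall (m : nat) (B : 'I_m -> set (R * R)) (k : 'I_m -> nat),
        (forall i, measurable (B i) /\ B i `<=` S) -> trivIset setT B ->
        P [set w | forall i, npoints (X w) (B i) = k i]
          = (\prod_(i < m) P [set w | npoints (X w) (B i) = k i])%E].

(* P n (E n) is only meaningful when E n is an event, hence the first part. *)
Definition whp (R : realType) (d : nat -> measure_display)
    (Omega : forall n, measurableType (d n))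
    (P : forall n, probability (Omega n) R) (E : forall n, set (Omega n))
    : Prop :=
  (forall n, measurable (E n)) /\ P n (E n) @[n --> \oo] --> 1%E.

(* Main.v *)
(* Cut the square into cells of side s, with s ^ 2 close to ln n / 8700, and call a cell
   full if it contains more than a suitable constant number of points. With high
   probability some point has no other point within distance 50 s, because the cells in
   that range number at most 8253, so neither property holds at a radius below 50 s.

   At radius r >= 50 s, call two cells linked if all their points are within distance
   50 s. Reflecting the square across its sides extends fullness to the whole plane
   lattice, which removes boundary cases. With high probability no large window contains
   9140 cells that are not full, counted with multiplicity: a cell in the interior occurs
   once, a cell near a side or a corner up to two or four times, but there are only few
   of these. A bounded set of cells closed under links to full cells has width at most
   35, for otherwise half discs at its left and right ends and caps at its top and bottom
   would give 9142 cells that are not full. So the full cells outside such small sets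
   form one sea, connected by links.

   The points in a cell of the sea form a clique. Gluing these cliques along the links
   gives a cycle with many spare edges inside each cell, in which the points of the other
   cells linked to the sea can be inserted. The remaining points fall into cliques which
   are far apart; 2-connectivity provides two disjoint edges leaving such a clique, hence
   a path through it with both ends at the sea, which is inserted in the same way. So the
   graph is Hamiltonian as soon as it is 2-connected. *)

From Stdlib Require Import ZArith Lia.
From HB Require Import structures.
Require Import Defs.
From mathcomp Require Import all_boot all_order all_algebra finmap.
From mathcomp Require Import ssrZ zify.
From mathcomp Require Import all_classical all_reals all_analysis.
From mathcomp Require Import lra ring.
Set Implicit Arguments.
Unset Strict Implicit.
Unset Printing Implicit Defensive.
Import Order.TTheory GRing.Theory Num.Theory.
Import numFieldNormedType.Exports.
Local Open Scope classical_set_scope.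
Local Open Scope ring_scope.

(** * Links in the lattice *)

(** All constants serve a gap between two counts. An isolated point is forced by prescribing at most
    8253 cells, a closed set with two cells 35 columns or rows apart needs 9142 cells that are not
    full, and with [s ^ 2] near [ln n / 8700] a cell is not full with probability about
    [n ^ (-1/8700)]. So the first pattern occurs and the second does not. The threshold 35 is
    forced: cells at most 34 apart in both coordinates are always linked, so smaller sets are
    cliques. The unit 50 makes the cells fine enough for the gap to survive rounding. Reflection
    halves the number of distinct cells at a side, but there are only about [sqrt n] positions there
    and [4570 / 8700] exceeds 1/2; at a corner the number of positions is bounded, so any positive
    exponent suffices. The sea is defined at scale [50 s] alone, so a single event serves all
    [r >= 50 s]. The radius matters only for leaving a far clique: below [1990 s] edges are short,
    and exits given by 2-connectivity cannot lead to another clique; above it the clique is joined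
    to a cell of the sea directly. *)

Section Plane.
Local Open Scope Z_scope.
#[local] Arguments Z.mul : simpl never.
#[local] Arguments Z.add : simpl never.
#[local] Arguments Z.sub : simpl never.

(* A pair of integers names a cell of a grid. The bound says that any two points of the
   cells [a] and [b] are within distance 50, in units of the side of the cells. *)
Definition link (a b : Z * Z) : bool :=
  (Z.abs (a.1 - b.1) + 1) ^ 2 + (Z.abs (a.2 - b.2) + 1) ^ 2 <=? 2500.

Definition near (D : Z) (a b : Z * Z) : Prop :=
  Z.abs (a.1 - b.1) <= D /\ Z.abs (a.2 - b.2) <= D.

Lemma linkP (a b : Z * Z) : reflect
  ((Z.abs (a.1 - b.1) + 1) * (Z.abs (a.1 - b.1) + 1)
   + (Z.abs (a.2 - b.2) + 1) * (Z.abs (a.2 - b.2) + 1) <= 2500) (link a b).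
Proof. by rewrite /link !Z.pow_2_r; exact: Z.leb_spec0. Qed.

Lemma link_rect (p q : Z) (a b : Z * Z) :
  Z.abs (a.1 - b.1) <= p -> Z.abs (a.2 - b.2) <= q ->
  (p + 1) * (p + 1) + (q + 1) * (q + 1) <= 2500 -> link a b.
Proof. by move=> h1 h2 h; apply/linkP; nia. Qed.

Lemma link_near (a b : Z * Z) : link a b -> near 48 a b.
Proof. by move/linkP=> h; split; nia. Qed.

(** 34 is the largest possible value: [2 * 35 ^ 2 = 2450], but [2 * 36 ^ 2 = 2592]. *)
Lemma near_link (a b : Z * Z) : near 34 a b -> link a b.
Proof. by case=> h1 h2; apply: (link_rect h1 h2). Qed.

Lemma link_refl (a : Z * Z) : link a a.
Proof. by apply: near_link; split; lia. Qed.

Lemma link_sym (a b : Z * Z) : link a b = link b a.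
Proof. by apply/linkP/linkP; lia. Qed.

Lemma near_sym (D : Z) (a b : Z * Z) : near D a b -> near D b a.
Proof. by case=> ? ?; split; lia. Qed.

Lemma near_trans (D1 D2 : Z) (b a c : Z * Z) :
  near D1 a b -> near D2 b c -> near (D1 + D2) a c.
Proof. by move=> [? ?] [? ?]; split; lia. Qed.

Lemma near_le (D1 D2 : Z) (a b : Z * Z) : D1 <= D2 -> near D1 a b -> near D2 a b.
Proof. by move=> ? [? ?]; split; lia. Qed.

Definition swap (a : Z * Z) : Z * Z := (a.2, a.1).

Lemma swapK : involutive swap. Proof. by case. Qed.

Lemma link_swap (a b : Z * Z) : link (swap a) (swap b) = link a b.
Proof. by apply/linkP/linkP; rewrite /swap /=; lia. Qed.

Lemma near_swap (D : Z) (a b : Z * Z) : near D (swap a) (swap b) <-> near D a b.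
Proof. by rewrite /near /swap /=; tauto. Qed.

Lemma exists_minimizer (A : Z * Z -> Prop) (f : Z * Z -> Z) (B : Z) (x : Z * Z) :
  A x -> (forall y, A y -> B <= f y) -> exists2 z, A z & forall y, A y -> f z <= f y.
Proof.
move=> Ax hB; have [n] : exists n : nat, f x <= B + Z.of_nat n.
  by exists (Z.to_nat (f x - B)); have := hB _ Ax; lia.
elim: n x Ax => [|n IH] x Ax hx.
  by exists x => // y Ay; have := hB _ Ay; lia.
case: (pselect (exists2 y, A y & f y < f x)) => [[y Ay hy]|no].
  by apply: (IH y Ay); lia.
exists x => // y Ay.
by have [//|h] := Z.le_gt_cases (f x) (f y); case: no; exists y.
Qed.

Definition zrange (a : Z) (n : nat) : seq Z := [seq a + Z.of_nat k | k <- iota 0 n].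

Lemma mem_zrange (a : Z) (n : nat) (i : Z) :
  i \in zrange a n -> a <= i < a + Z.of_nat n.
Proof. by case/mapP=> k; rewrite mem_iota => hk ->; lia. Qed.

Lemma zrange_uniq (a : Z) (n : nat) : uniq (zrange a n).
Proof. by rewrite map_inj_uniq ?iota_uniq // => i j; lia. Qed.

Definition zrect (a : Z) (n : nat) (b : Z) (p : nat) : seq (Z * Z) :=
  [seq (i, j) | i <- zrange a n, j <- zrange b p].

Lemma mem_zrect (a : Z) (n : nat) (b : Z) (p : nat) (z : Z * Z) :
  z \in zrect a n b p -> a <= z.1 < a + Z.of_nat n /\ b <= z.2 < b + Z.of_nat p.
Proof. by case/allpairsP=> -[i j] /= [hi hj ->]; split; exact: mem_zrange. Qed.

Lemma zrect_uniq (a : Z) (n : nat) (b : Z) (p : nat) : uniq (zrect a n b p).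
Proof. by apply: allpairs_uniq; rewrite ?zrange_uniq // => -[? ?] [? ?]. Qed.

Lemma size_zrect (a : Z) (n : nat) (b : Z) (p : nat) : size (zrect a n b p) = (n * p)%N.
Proof. by rewrite size_allpairs !size_map !size_iota. Qed.

(** The count is obtained by evaluation. Sizes are stated in [Z], whose numerals are binary. *)
Lemma half_disc : exists L : seq (Z * Z), [/\ uniq L, Z.of_nat (size L) = 3676
  & forall p : Z * Z, p \in L -> link (0, 0) p /\ 1 <= p.1].
Proof.
exists [seq p <- zrect 1 49 (-49) 99 | link (0, 0) p]; split.
- exact: filter_uniq (zrect_uniq _ _ _ _).
- by vm_compute.
- by move=> p; rewrite mem_filter => /andP[lp /mem_zrect[? ?]]; split=> //; lia.
Qed.

(** The last column 18 is the largest for which the cap or its mirror image always fits between two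
    extreme columns that differ by at least 35. *)
Lemma half_disc_cap : exists L : seq (Z * Z), [/\ uniq L, Z.of_nat (size L) = 895
  & forall p : Z * Z, p \in L -> [/\ link (0, 0) p, 0 <= p.1 <= 18 & 1 <= p.2]].
Proof.
exists [seq p <- zrect 0 19 1 49 | link (0, 0) p]; split.
- exact: filter_uniq (zrect_uniq _ _ _ _).
- by vm_compute.
- by move=> p; rewrite mem_filter => /andP[lp /mem_zrect[? ?]]; split=> //; lia.
Qed.

(** For signs [e1] and [e2] this is an isometry of the lattice, possibly reflecting the axes, which
    sends the origin to [c]. *)
Definition shoot (c : Z * Z) (e1 e2 : Z) (p : Z * Z) : Z * Z :=
  (c.1 + e1 * p.1, c.2 + e2 * p.2).

Lemma shoot_inj (c : Z * Z) (e1 e2 : Z) :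
  e1 = 1 \/ e1 = -1 -> e2 = 1 \/ e2 = -1 -> injective (shoot c e1 e2).
Proof.
move=> h1 h2 [p1 p2] [q1 q2] [] /= hp hq.
have -> : p1 = q1 by nia.
by have -> : p2 = q2 by nia.
Qed.

Lemma link_shoot (c : Z * Z) (e1 e2 : Z) (p : Z * Z) :
  e1 = 1 \/ e1 = -1 -> e2 = 1 \/ e2 = -1 ->
  link c (shoot c e1 e2 p) = link (0, 0) p.
Proof.
move=> h1 h2; rewrite /link /shoot /=.
have -> : Z.abs (c.1 - (c.1 + e1 * p.1)) = Z.abs (0 - p.1) by nia.
by have -> : Z.abs (c.2 - (c.2 + e2 * p.2)) = Z.abs (0 - p.2) by nia.
Qed.

(* Two half discs of 3676 cells and two caps of 895 cells amount to 9142 cells. *)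
Definition regular (full : Z * Z -> bool) : Prop :=
  forall (o : Z * Z) (L : seq (Z * Z)), uniq L ->
  (forall z, z \in L -> o.1 <= z.1 < o.1 + 101000 /\ o.2 <= z.2 < o.2 + 101000) ->
  (forall z, z \in L -> ~~ full z) -> Z.of_nat (size L) < 9140.

Definition link_closed (full : Z * Z -> bool) (A : Z * Z -> Prop) : Prop :=
  forall a b, A a -> full b -> link a b -> A b.

(** A cell beyond an extreme cell of [A] and linked to it would belong to [A] if it were full. The
    half discs lie outside the columns of [A], the caps within these columns but above or below [A],
    so the four pieces are disjoint. *)
Lemma link_closed_width (full : Z * Z -> bool) (A : Z * Z -> Prop) (c : Z * Z)
    (D : Z) :
  regular full -> link_closed full A -> (forall a, A a -> near D c a) -> D <= 50050 ->
  forall a b, A a -> A b -> b.1 - a.1 <= 34.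
Proof.
move=> reg clA bnd hD a b Aa Ab; apply/Z.nlt_ge => wide.
have [l Al lP] := @exists_minimizer A (fun z => z.1) (c.1 - D) a Aa
  (fun z Az => ltac:(have [] := bnd z Az; lia)).
have [r Ar rP] := @exists_minimizer A (fun z => - z.1) (- c.1 - D) a Aa
  (fun z Az => ltac:(have [] := bnd z Az; lia)).
have [u Au uP] := @exists_minimizer A (fun z => z.2) (c.2 - D) a Aa
  (fun z Az => ltac:(have [] := bnd z Az; lia)).
have [t At tP] := @exists_minimizer A (fun z => - z.2) (- c.2 - D) a Aa
  (fun z Az => ltac:(have [] := bnd z Az; lia)).
have lr : l.1 + 34 < r.1 by have := lP _ Aa; have := rP _ Ab; lia.
(* The vertical cap at a point of [A] fits on one of its two sides between the
   extreme columns of [A]. *)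
have side z : A z -> exists2 e, e = 1 \/ e = -1 & l.1 <= z.1 + e * 18 <= r.1.
  move=> Az; have := lP _ Az; have := rP _ Az => h1 h2.
  have [h|h] := Z.le_gt_cases (z.1 + 18) r.1.
    by exists 1; [left | lia].
  by exists (-1); [right | lia].
have [et het etP] := side _ At.
have [eu heu euP] := side _ Au.
have e1 : 1 = 1 \/ 1 = -1 by left.
have eN1 : -1 = 1 \/ -1 = -1 by right.
have [hd [hd_uniq hd_size hdP]] := half_disc.
have [cap [cap_uniq cap_size capP]] := half_disc_cap.
pose L1 := [seq shoot l (-1) 1 p | p <- hd].
pose L2 := [seq shoot r 1 1 p | p <- hd].
pose L3 := [seq shoot t et 1 p | p <- cap].
pose L4 := [seq shoot u eu (-1) p | p <- cap].
have L1P (z : Z * Z) : z \in L1 -> link l z /\ z.1 < l.1.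
  case/mapP=> -[i j] /hdP /= [lp hp] ->.
  by rewrite link_shoot //; (split; first exact: lp); rewrite /=; lia.
have L2P (z : Z * Z) : z \in L2 -> link r z /\ r.1 < z.1.
  case/mapP=> -[i j] /hdP /= [lp hp] ->.
  by rewrite link_shoot //; (split; first exact: lp); rewrite /=; lia.
have L3P (z : Z * Z) : z \in L3 -> link t z /\ l.1 <= z.1 <= r.1 /\ t.2 < z.2.
  case/mapP=> -[i j] /capP /= [lp hp hp'] ->.
  rewrite link_shoot //; (split; first exact: lp); rewrite /=; have := lP _ At; have := rP _ At.
  by case: het => het; rewrite het in etP *; lia.
have L4P (z : Z * Z) : z \in L4 -> link u z /\ l.1 <= z.1 <= r.1 /\ z.2 < u.2.
  case/mapP=> -[i j] /capP /= [lp hp hp'] ->.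
  rewrite link_shoot //; (split; first exact: lp); rewrite /=; have := lP _ Au; have := rP _ Au.
  by case: heu => heu; rewrite heu in euP *; lia.
have uL : uniq (L1 ++ L2 ++ L3 ++ L4).
  have uu x e f s : e = 1 \/ e = -1 -> f = 1 \/ f = -1 -> uniq s ->
      uniq [seq shoot x e f p | p <- s].
    by move=> he hf us; rewrite map_inj_uniq //; exact: shoot_inj.
  rewrite !cat_uniq !uu // !andTb andbT.
  apply/and3P; split; apply/hasPn => z; rewrite ?mem_cat.
  - move=> h; apply/negP => /L1P[_ h1].
    case/or3P: h => [/L2P[]|/L3P[]|/L4P[]] _; try case; lia.
  - move=> h; apply/negP => /L2P[_ h1].
    case/orP: h => [/L3P[]|/L4P[]] _; case; lia.
  - move=> /L4P[_ [_ h1]]; apply/negP => /L3P[_ [_ h2]].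
    by have := uP _ At; lia.
(* A cell linked to [A] is within [50050 + 48] of [c], hence inside this window, which extends at
   least 50499 from [c] in each direction. *)
have := reg (c.1 - 50499, c.2 - 50499) (L1 ++ L2 ++ L3 ++ L4) uL.
have inA (z : Z * Z) : z \in L1 ++ L2 ++ L3 ++ L4 -> (exists2 a', A a' & link a' z) /\ ~ A z.
  rewrite !mem_cat => /or4P[/L1P|/L2P|/L3P|/L4P] [h1 h2].
  - by split; [exists l | move=> /lP; lia].
  - by split; [exists r | move=> /rP; lia].
  - by split; [exists t | move=> /tP; lia].
  - by split; [exists u | move=> /uP; lia].
move=> small; suff : Z.of_nat (size (L1 ++ L2 ++ L3 ++ L4)) < 9140.
  by rewrite !size_cat !size_map; lia.
apply: small.
- move=> z /inA[[a' Aa' /link_near[h1 h2]] _] /=.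
  by have [h3 h4] := bnd _ Aa'; lia.
- move=> z /inA[[a' Aa' lz] nA]; apply/negP => fz.
  by apply: nA; apply: clA lz.
Qed.

Lemma regular_swap (full : Z * Z -> bool) :
  regular full -> regular (fun z => full (swap z)).
Proof.
move=> reg o L uL inL nf.
rewrite -(size_map swap); apply: (reg (swap o)).
- by rewrite map_inj_uniq //; exact: (inv_inj swapK).
- by move=> _ /mapP[z /inL h ->] /=; tauto.
- by move=> _ /mapP[z /nf h ->].
Qed.

Lemma link_closed_near (full : Z * Z -> bool) (A : Z * Z -> Prop) (c : Z * Z)
    (D : Z) :
  regular full -> link_closed full A -> (forall a, A a -> near D c a) ->
  D <= 50050 -> forall a b, A a -> A b -> near 34 a b.
Proof.
move=> reg clA bnd hD a b Aa Ab.
have w1 := link_closed_width reg clA bnd hD.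
have clA' : link_closed (fun z => full (swap z)) (fun z => A (swap z)).
  by move=> x y Ax fy lxy; apply: (clA (swap x)); rewrite // link_swap.
have bnd' z : A (swap z) -> near D (swap c) z.
  by move/bnd => h; apply/near_swap; rewrite swapK.
have w2 := link_closed_width (regular_swap reg) clA' bnd' hD.
have := w1 a b Aa Ab; have := w1 b a Ab Aa.
have := w2 (swap a) (swap b); have := w2 (swap b) (swap a).
rewrite !swapK /swap /= => /(_ Ab Aa) ? /(_ Aa Ab) ? ? ?.
by split; lia.
Qed.

(** * The sea and the far cells *)

Section Sea.
Variable full : Z * Z -> bool.

(** [A] may contain cells that are not full, such as [z] itself; closedness only concerns links from
    [A] to full cells. *)
Definition far (z : Z * Z) : Prop := exists2 A : Z * Z -> Prop,
  link_closed full A & A z /\ forall a, A a -> near 34 z a.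

Definition sea (z : Z * Z) : Prop := full z /\ ~ far z.

Lemma link_closedU (A B : Z * Z -> Prop) :
  link_closed full A -> link_closed full B -> link_closed full (fun z => A z \/ B z).
Proof.
move=> clA clB a b [Aa|Ba] fb lab; [left|right].
  exact: clA lab.
exact: clB lab.
Qed.

(** The starting cell is unconstrained: [full] and [P] are asked only of the cells reached later. *)
Inductive conn (P : Z * Z -> Prop) (a : Z * Z) : Z * Z -> Prop :=
| conn_refl : conn P a a
| conn_step b c : conn P a b -> full c -> P c -> link b c -> conn P a c.

Lemma conn_trans (P : Z * Z -> Prop) (b a c : Z * Z) :
  conn P a b -> conn P b c -> conn P a c.
Proof. by move=> hab; elim=> // x y _ IH fy Py lxy; exact: conn_step IH fy Py lxy. Qed.

Lemma conn_full (P : Z * Z -> Prop) (a b : Z * Z) :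
  full a -> P a -> conn P a b -> full b /\ P b.
Proof. by move=> fa Pa; elim. Qed.

Lemma conn_sym (P : Z * Z -> Prop) (a b : Z * Z) :
  full a -> P a -> conn P a b -> conn P b a.
Proof.
move=> fa Pa; elim=> [|x y hx IH fy Py lxy]; first exact: conn_refl.
have [fx Px] := conn_full fa Pa hx.
apply: conn_trans IH; apply: conn_step fx Px _; first exact: conn_refl.
by rewrite link_sym.
Qed.

Lemma conn_imp (P Q : Z * Z -> Prop) (a b : Z * Z) :
  (forall z, P z -> Q z) -> conn P a b -> conn Q a b.
Proof.
move=> PQ; elim=> [|x y _ IH fy /PQ Qy lxy]; first exact: conn_refl.
exact: conn_step IH fy Qy lxy.
Qed.

(** 22 is the largest side for which any two cells of blocks sharing a side are linked:
    [22 ^ 2 + 44 ^ 2 = 2420]. *)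
Definition in_block (x y : Z) (z : Z * Z) : Prop :=
  22 * x <= z.1 < 22 * x + 22 /\ 22 * y <= z.2 < 22 * y + 22.

Definition good (x y : Z) : Prop := exists2 z, full z & in_block x y z.

Lemma block_link (x y y' : Z) (z w : Z * Z) :
  in_block x y z -> in_block x y' w -> Z.abs (y - y') <= 1 -> link z w.
Proof. by move=> [? ?] [? ?] ?; apply: (@link_rect 21 43); lia. Qed.

Lemma column_conn (P : Z * Z -> Prop) (x y0 y1 : Z) :
  (forall y, y0 <= y < y1 -> good x y) ->
  (forall y z, y0 <= y < y1 -> in_block x y z -> P z) ->
  forall y y' z w, y0 <= y < y1 -> y0 <= y' < y1 -> full z -> in_block x y z ->
  full w -> in_block x y' w -> conn P z w.
Proof.
move=> gd PP.
have up (n : nat) y z w : y0 <= y -> y + Z.of_nat n < y1 -> full z ->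
    in_block x y z -> full w -> in_block x (y + Z.of_nat n) w -> conn P z w.
  elim: n w => [|n IH] w hy hn fz bz fw bw.
    apply: conn_step (conn_refl _ _) fw _ (block_link bz bw _); last lia.
    by apply: PP bw; lia.
  have [v fv bv] := gd (y + Z.of_nat n) ltac:(lia).
  apply: conn_step (IH v _ _ fz bz fv bv) fw _ (block_link bv bw _); try lia.
  by apply: PP bw; lia.
move=> y y' z w hy hy' fz bz fw bw.
have [h|h] := Z.le_gt_cases y y'.
  by apply: (up (Z.to_nat (y' - y)) y) => //; rewrite ?Z2Nat.id; try lia;
     have -> : y + (y' - y) = y' by lia.
apply: conn_sym => //; first exact: PP bw.
by apply: (up (Z.to_nat (y - y')) y') => //; rewrite ?Z2Nat.id; try lia;
   have -> : y' + (y - y') = y by lia.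
Qed.

Hypothesis reg : regular full.

(** The bound improves itself: [link_closed_near] turns any bound up to 50050 into 34. *)
Lemma far_of_closed (A : Z * Z -> Prop) (c : Z * Z) (D : Z) (z : Z * Z) :
  link_closed full A -> (forall a, A a -> near D c a) -> D <= 50050 -> A z -> far z.
Proof.
move=> clA bnd hD Az; exists A => //; split=> // a.
exact: (link_closed_near reg clA bnd hD).
Qed.

(** A small closed set containing [w] would also contain the full cell [z], which would then be
    far. *)
Lemma sea_link (z w : Z * Z) : sea z -> full w -> link z w -> sea w.
Proof.
move=> [fz nfz] fw lzw; split=> // -[A clA [Aw bnd]]; apply: nfz.
apply: (far_of_closed clA bnd) => //.
by apply: clA Aw fz _; rewrite link_sym.
Qed.

(** Each full cell linked to [z] is far and brings its own small closed set. Together with [z] these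
    sets form a closed set within [48 + 34 = 82] of [z]. *)
Lemma far_of_no_sea (z : Z * Z) : (forall w, link z w -> ~ sea w) -> far z.
Proof.
move=> nosea.
pose A w := w = z \/ exists v B, [/\ link z v, link_closed full B, B v,
  forall a, B a -> near 34 v a & B w].
apply: (@far_of_closed A z 82) => //; last by left.
  move=> a b [->|[v [B [lzv clB Bv bB Ba]]]] fb lab.
    have [B clB [Bb bB]] : far b.
      by apply: contrapT => nfb; apply: (nosea b lab); split.
    by right; exists b, B.
  by right; exists v, B; split=> //; exact: clB lab.
move=> a [->|[v [B [/link_near lzv _ _ bB /bB hva]]]]; first by split; lia.
by have := near_trans lzv hva.
Qed.

(** The union of the two closed sets is closed and within [50000 + 34] of [z], so the width bound
    applies to it. This is what keeps distinct far cliques very far apart. *)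
Lemma far_pair (z w : Z * Z) : far z -> far w -> near 50000 z w -> near 34 z w.
Proof.
move=> [A clA [Az bA]] [B clB [Bw bB]] zw.
apply: (link_closed_near (c := z) (D := 50034) reg (link_closedU clA clB)) => //.
- move=> a [/bA h|/bB h]; first by apply: near_le h; lia.
  exact: near_trans zw h.
- by left.
- by right.
Qed.

Lemma bad_blocks (x0 y0 H : Z) :
  (forall k, x0 <= k <= x0 + 54 ->
    exists x y, [/\ k <= x < k + 3, y0 <= y < y0 + H & ~ good x y]) ->
  forall n : nat, (n <= 19)%N -> exists L : seq (Z * Z), [/\ uniq L,
    Z.of_nat (size L) = 484 * Z.of_nat n & forall z, z \in L -> [/\ ~~ full z,
      22 * x0 <= z.1 < 22 * (x0 + 3 * Z.of_nat n) &
      22 * y0 <= z.2 < 22 * (y0 + H)]].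
Proof.
move=> bad; elim=> [|n IH] hn; first by exists [::].
have [L [uL sL LP]] := IH (ltnW hn).
have [x [y [hx hy nxy]]] := bad (x0 + 3 * Z.of_nat n) ltac:(lia).
exists (L ++ zrect (22 * x) 22 (22 * y) 22); split.
- rewrite cat_uniq uL zrect_uniq andbT andTb; apply/hasPn => -[i j].
  move=> /mem_zrect /= [hi hj]; apply/negP => /LP /= [_ h _]; lia.
- by rewrite size_cat size_zrect; lia.
- move=> [i j]; rewrite mem_cat => /orP[/LP /= [? ? ?]|/mem_zrect /= [hi hj]].
    by split=> //; lia.
  split; rewrite /=; try lia.
  by apply/negP => fij; apply: nxy; exists (i, j).
Qed.

(** Otherwise each of 19 disjoint strips of three columns has a block without full cells, and
    [19 * 484 = 9196] exceeds 9140. Three columns are 66 cells wide, so that no link, of extent at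
    most 48, jumps over the strip; [H <= 4500] keeps the blocks within a window of side 101000. *)
Lemma good_column (x0 y0 H : Z) : H <= 4500 ->
  exists2 k, x0 <= k <= x0 + 54 &
    forall x y, k <= x < k + 3 -> y0 <= y < y0 + H -> good x y.
Proof.
move=> hH; apply: contrapT => no.
have bad k : x0 <= k <= x0 + 54 ->
    exists x y, [/\ k <= x < k + 3, y0 <= y < y0 + H & ~ good x y].
  move=> hk; apply: contrapT => no'; apply: no; exists k => // x y hx hy.
  by apply: contrapT => ngood; apply: no'; exists x, y.
have [L [uL sL LP]] := bad_blocks bad (isT : (19 <= 19)%N).
suff : Z.of_nat (size L) < 9140 by lia.
apply: (reg (o := (22 * x0, 22 * y0))) => // -[i j] /LP /= [? ? ?] //.
by lia.
Qed.
End Sea.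

Lemma good_swap (full : Z * Z -> bool) (x y : Z) :
  good (fun z => full (swap z)) x y -> good full y x.
Proof. by move=> [z fz [? ?]]; exists (swap z). Qed.

Lemma conn_swap (full : Z * Z -> bool) (P : Z * Z -> Prop) (a b : Z * Z) :
  conn (fun z => full (swap z)) (fun z => P (swap z)) a b ->
  conn full P (swap a) (swap b).
Proof.
elim=> [|x y _ IH fy Py lxy]; first exact: conn_refl.
by apply: conn_step IH fy Py _; rewrite link_swap.
Qed.

(** * Connectedness of the sea *)

Section Hub.
Variable full : Z * Z -> bool.
Hypothesis reg : regular full.

Lemma good_row (x0 y0 H : Z) : H <= 4500 ->
  exists2 k, y0 <= k <= y0 + 54 &
    forall x y, k <= y < k + 3 -> x0 <= x < x0 + H -> good full x y.
Proof.
move=> hH; have [k hk gk] := good_column (regular_swap reg) y0 x0 hH.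
by exists k => // x y hy hx; apply: good_swap; exact: gk.
Qed.

Lemma row_conn (P : Z * Z -> Prop) (y x0 x1 : Z) :
  (forall x, x0 <= x < x1 -> good full x y) ->
  (forall x z, x0 <= x < x1 -> in_block x y z -> P z) ->
  forall x x' z w, x0 <= x < x1 -> x0 <= x' < x1 -> full z -> in_block x y z ->
  full w -> in_block x' y w -> conn full P z w.
Proof.
move=> gd PP x x' z w hx hx' fz [? ?] fw [? ?].
rewrite -(swapK z) -(swapK w); apply: conn_swap.
apply: (@column_conn _ _ y x0 x1 _ _ x x') => //; rewrite ?swapK //.
  by move=> t /gd[v fv [? ?]]; exists (swap v); rewrite ?swapK.
by move=> t v ht [? ?]; apply: (PP t).
Qed.

Section Window.
Variables x0 y0 H : Z.
(** A good strip needs [57 = 3 * 19] columns to choose from, and [22 * 2200 = 48400] is small enough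
    for [far_of_closed]. *)
Hypothesis hH : 57 <= H <= 2200.

Let win (z : Z * Z) : Prop :=
  22 * x0 <= z.1 < 22 * (x0 + H) /\ 22 * y0 <= z.2 < 22 * (y0 + H).

Let col (x : Z) : Prop :=
  x0 <= x < x0 + H /\ forall y, y0 <= y < y0 + H -> good full x y.
Let row (y : Z) : Prop :=
  y0 <= y < y0 + H /\ forall x, x0 <= x < x0 + H -> good full x y.

Let hub (z : Z * Z) : Prop := exists x y, [/\ x0 <= x < x0 + H,
  y0 <= y < y0 + H, in_block x y z & col x \/ row y].

Lemma win_block (x y : Z) (z : Z * Z) :
  x0 <= x < x0 + H -> y0 <= y < y0 + H -> in_block x y z -> win z.
Proof. by move=> ? ? [? ?]; split; lia. Qed.

Lemma exists_row : exists y, row y.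
Proof.
have [k hk gk] := @good_row x0 y0 H ltac:(lia).
exists k; split; [lia | move=> x hx; apply: gk => //; lia].
Qed.

Lemma exists_col : exists x, col x.
Proof.
have [k hk gk] := good_column reg x0 y0 (H := H) ltac:(lia).
exists k; split; [lia | move=> x hx; apply: gk => //; lia].
Qed.

(** Every good column crosses every good row, so two columns are joined through a row and two rows
    through a column. *)
Lemma hub_conn (z w : Z * Z) : full z -> full w -> hub z -> hub w ->
  conn full win z w.
Proof.
move=> fz fw [x [y [hx hy bz cz]]] [x' [y' [hx' hy' bw cw]]].
have alongc t s s' u v : col t -> y0 <= s < y0 + H -> y0 <= s' < y0 + H ->
    full u -> in_block t s u -> full v -> in_block t s' v -> conn full win u v.
  move=> [ht gt]; apply: column_conn => // r q hr; exact: win_block.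
have alongr t s s' u v : row t -> x0 <= s < x0 + H -> x0 <= s' < x0 + H ->
    full u -> in_block s t u -> full v -> in_block s' t v -> conn full win u v.
  move=> [ht gt]; apply: row_conn => // r q hr; exact: win_block.
case: cz cw => [cx|ry] [cx'|ry'].
- have [t rt] := exists_row; have [ht gt] := rt.
  have [u fu bu] := gt x hx; have [v fv bv] := gt x' hx'.
  apply: conn_trans (alongc _ _ _ _ _ cx hy ht fz bz fu bu) _.
  apply: conn_trans (alongr _ _ _ _ _ rt hx hx' fu bu fv bv) _.
  exact: alongc cx' ht hy' fv bv fw bw.
- have [u fu bu] := ry'.2 x hx.
  apply: conn_trans (alongc _ _ _ _ _ cx hy hy' fz bz fu bu) _.
  exact: alongr ry' hx hx' fu bu fw bw.
- have [u fu bu] := ry.2 x' hx'.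
  apply: conn_trans (alongr _ _ _ _ _ ry hx hx' fz bz fu bu) _.
  exact: alongc cx' hy hy' fu bu fw bw.
- have [t ct] := exists_col; have [ht gt] := ct.
  have [u fu bu] := gt y hy; have [v fv bv] := gt y' hy'.
  apply: conn_trans (alongr _ _ _ _ _ ry hx ht fz bz fu bu) _.
  apply: conn_trans (alongc _ _ _ _ _ ct hy hy' fu bu fv bv) _.
  exact: alongr ry' ht hx' fv bv fw bw.
Qed.

Lemma block_of (z : Z * Z) : in_block (z.1 / 22) (z.2 / 22) z.
Proof.
by split; have := Z.mod_pos_bound z.1 22; have := Z.div_mod z.1 22;
   have := Z.mod_pos_bound z.2 22; have := Z.div_mod z.2 22; lia.
Qed.

(* Links are shorter than three blocks, so a component of full cells which
   avoids four good strips of that width is trapped between them. *)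
Lemma sea_hub (z : Z * Z) : sea full z ->
  22 * (x0 + 57) <= z.1 < 22 * (x0 + H - 57) ->
  22 * (y0 + 57) <= z.2 < 22 * (y0 + H - 57) ->
  exists2 w, hub w & full w /\ conn full win z w.
Proof.
move=> [fz nfz] hz1 hz2; apply: contrapT => no.
have [l hl lP] := good_column reg x0 y0 (H := H) ltac:(lia).
have [r hr rP] := good_column reg (x0 + H - 57) y0 (H := H) ltac:(lia).
have [b hb bP] := @good_row x0 y0 H ltac:(lia).
have [t ht tP] := @good_row x0 (y0 + H - 57) H ltac:(lia).
have inner w : conn full win z w ->
    22 * (l + 3) <= w.1 < 22 * r /\ 22 * (b + 3) <= w.2 < 22 * t.
  elim=> [|u v zu IH fv Pv luv]; first by lia.
  have nhub : ~ hub v.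
    by move=> hv; apply: no; exists v => //; split=> //; exact: conn_step luv.
  have [bl1 bl2] := block_of v; have [lu1 lu2] := link_near luv.
  have [w1 w2] := Pv.
  have ncol : ~ col (v.1 / 22).
    by move=> c; apply: nhub; exists (v.1 / 22), (v.2 / 22); split=> //; try lia; left.
  have nrow : ~ row (v.2 / 22).
    by move=> c; apply: nhub; exists (v.1 / 22), (v.2 / 22); split=> //; try lia; right.
  (* The link from [u] to [v] has extent at most 48, so if [v] leaves the inner box it lands in one
     of the four strips, where it would belong to the hub. *)
  split; split; [apply/Z.nlt_ge|apply/Z.nle_gt|apply/Z.nlt_ge|apply/Z.nle_gt] => h.
  - by apply: ncol; split; [lia | move=> y hy; apply: lP => //; lia].
  - by apply: ncol; split; [lia | move=> y hy; apply: rP => //; lia].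
  - by apply: nrow; split; [lia | move=> x hx; apply: bP => //; lia].
  - by apply: nrow; split; [lia | move=> x hx; apply: tP => //; lia].
apply: nfz; apply: (@far_of_closed full reg (conn full win z) z 49000).
- move=> u v zu fv luv; have [? ?] := inner u zu; have [? ?] := link_near luv.
  by apply: (conn_step zu fv _ luv); split; lia.
- by move=> u /inner[? ?]; split; lia.
- by [].
- exact: conn_refl.
Qed.

Lemma sea_conn_window (z w : Z * Z) : sea full z -> sea full w ->
  22 * (x0 + 57) <= z.1 < 22 * (x0 + H - 57) ->
  22 * (y0 + 57) <= z.2 < 22 * (y0 + H - 57) ->
  22 * (x0 + 57) <= w.1 < 22 * (x0 + H - 57) ->
  22 * (y0 + 57) <= w.2 < 22 * (y0 + H - 57) ->
  conn full win z w.
Proof.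
move=> sz sw z1 z2 w1 w2.
have [u hu [fu zu]] := sea_hub sz z1 z2.
have [v hv [fv wv]] := sea_hub sw w1 w2.
apply: conn_trans zu (conn_trans (hub_conn fu fv hu hv) _).
by apply: conn_sym wv; [exact: sw.1 | split; lia].
Qed.
End Window.

Lemma sea_conn_near (z w : Z * Z) : sea full z -> sea full w -> near 5000 z w ->
  conn full (near 20000 z) z w.
Proof.
move=> sz sw [zw1 zw2].
have [b1 b2] := block_of z.
have := @sea_conn_window (z.1 / 22 - 287) (z.2 / 22 - 287) 576 ltac:(lia) z w sz sw.
move=> /(_ ltac:(lia) ltac:(lia) ltac:(lia) ltac:(lia)).
by apply: conn_imp => u [? ?]; split; lia.
Qed.

(** Four good blocks on top of each other contain a chain of linked full cells whose ends are at
    least 45 rows apart. A closed set containing the first contains them all, so it does not fit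
    within distance 34. *)
Lemma exists_sea (c : Z * Z) : exists2 z, sea full z & near 1300 c z.
Proof.
have [b1 b2] := block_of c.
have [x hx gx] := good_column reg (c.1 / 22) (c.2 / 22) (H := 4) ltac:(lia).
have [z fz bz] := gx x (c.2 / 22) ltac:(lia) ltac:(lia).
have [u fu bu] := gx x (c.2 / 22 + 1) ltac:(lia) ltac:(lia).
have [v fv bv] := gx x (c.2 / 22 + 2) ltac:(lia) ltac:(lia).
have [w fw bw] := gx x (c.2 / 22 + 3) ltac:(lia) ltac:(lia).
exists z; last by case: bz => ? ?; split; lia.
split=> // -[A clA [Az bA]].
have Au := clA _ _ Az fu (block_link bz bu ltac:(lia)).
have Av := clA _ _ Au fv (block_link bu bv ltac:(lia)).
have Aw := clA _ _ Av fw (block_link bv bw ltac:(lia)).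
by have := bA _ Aw; case: bz bw => ? ? [? ?] [? ?]; lia.
Qed.

Lemma sea_conn (z w : Z * Z) : sea full z -> sea full w ->
  conn full (fun=> True) z w.
Proof.
move=> sz sw.
have [n] : exists n : nat, near (Z.of_nat n) z w.
  exists (Z.to_nat (Z.abs (z.1 - w.1) + Z.abs (z.2 - w.2))).
  by split; lia.
elim/ltn_ind: n z sz => n IH z sz zw.
have [small|large] := Z.le_gt_cases (Z.of_nat n) 5000.
  by apply: conn_imp (sea_conn_near sz sw (near_le small zw)).
(* The target is 1320 closer to [w], and [exists_sea] misses it by at most 1300, so each hop gains
   at least 20. *)
pose toward (a b : Z) := if a + 1320 <? b then a + 1320
  else if b <? a - 1320 then a - 1320 else b.
have towardP a b : Z.abs (a - b) <= Z.of_nat n -> Z.abs (a - toward a b) <= 1320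
    /\ Z.abs (toward a b - b) <= Z.of_nat n - 1320.
  by rewrite /toward; case: Z.ltb_spec => ?; [|case: Z.ltb_spec => ?]; lia.
have [u su [u1 u2]] := exists_sea (toward z.1 w.1, toward z.2 w.2).
have [h1 h2] := zw; have [t1 t1'] := towardP _ _ h1; have [t2 t2'] := towardP _ _ h2.
rewrite /= in u1 u2.
have zu : near 5000 z u by split; lia.
apply: conn_trans (conn_imp _ (sea_conn_near sz su zu)) _ => //.
by apply: (IH (n - 20)%N) => //; [lia | split; lia].
Qed.
End Hub.

Lemma conn_sea (full : Z * Z -> bool) (P : Z * Z -> Prop) (z w : Z * Z) :
  regular full -> sea full z -> conn full P z w -> sea full w.
Proof.
move=> reg sz; elim=> // u v _ su fv _ luv; exact: (sea_link reg su fv luv).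
Qed.

(** Links, [near] and [full] are all invariant under this isometry, so the closed set can be
    transported along it; [h] is its inverse. *)
Lemma far_shoot (full : Z * Z -> bool) (c : Z * Z) (e1 e2 : Z) (z : Z * Z) :
  e1 = 1 \/ e1 = -1 -> e2 = 1 \/ e2 = -1 ->
  (forall w, full (shoot c e1 e2 w) = full w) ->
  far full z -> far full (shoot c e1 e2 z).
Proof.
move=> h1 h2 hf [A clA [Az bA]].
pose g := shoot c e1 e2.
pose h := shoot (- e1 * c.1, - e2 * c.2) e1 e2.
have hK : cancel g h.
  by case=> i j; rewrite /g /h /shoot /=; congr (_, _); case: h1 => E1; case: h2 => E2;
    rewrite ?E1 ?E2; lia.
have gK : cancel h g.
  by case=> i j; rewrite /g /h /shoot /=; congr (_, _); case: h1 => E1; case: h2 => E2;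
    rewrite ?E1 ?E2; lia.
have nearg D a b : near D (g a) (g b) <-> near D a b.
  by rewrite /near /g /shoot /=; case: h1 => E1; case: h2 => E2; rewrite ?E1 ?E2; split; lia.
have linkg a b : link (g a) (g b) = link a b.
  by rewrite /g /shoot; apply/linkP/linkP => /=; case: h1 => E1; case: h2 => E2;
    rewrite ?E1 ?E2; lia.
exists (fun w => A (h w)); last split.
- move=> a b Aa fb lab; apply: (clA _ _ Aa).
    by rewrite -hf [X in full X](gK b).
  by rewrite -linkg !gK.
- by rewrite (hK z).
- by move=> a /bA /nearg; rewrite gK.
Qed.

Lemma sea_shoot (full : Z * Z -> bool) (c : Z * Z) (e1 e2 : Z) (z : Z * Z) :
  e1 = 1 \/ e1 = -1 -> e2 = 1 \/ e2 = -1 ->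
  (forall w, full (shoot c e1 e2 w) = full w) ->
  sea full z -> sea full (shoot c e1 e2 z).
Proof.
move=> h1 h2 hf [fz nfz]; split; first by rewrite hf.
move=> fgz; apply: nfz.
pose h := shoot (- e1 * c.1, - e2 * c.2) e1 e2.
have gK w : shoot c e1 e2 (h w) = w.
  by case: w => i j; rewrite /h /shoot /=; congr (_, _); case: h1 => E1; case: h2 => E2;
    rewrite ?E1 ?E2; lia.
have hK w : h (shoot c e1 e2 w) = w.
  by case: w => i j; rewrite /h /shoot /=; congr (_, _); case: h1 => E1; case: h2 => E2;
    rewrite ?E1 ?E2; lia.
rewrite -(hK z); apply: far_shoot fgz => //.
by move=> w; rewrite -[in RHS](gK w) hf.
Qed.
End Plane.

(** * Absorbing paths into a cycle *)

Section Absorption.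
Local Open Scope set_scope.
Local Open Scope nat_scope.
Variables (V B : finType) (e : rel V) (lab : V -> option B).
Hypothesis e_sym : symmetric e.

Fixpoint runs (b : B) (x : V) (s : seq V) : nat :=
  if s is y :: s' then ((lab x == Some b) && (lab y == Some b)) + runs b y s' else 0.

(** A slot is a pair of cyclically consecutive vertices with the same label [b], that is, a place
    where a path can be inserted. The [rcons] accounts for the closing edge. *)
Definition slots (b : B) (c : seq V) : nat :=
  if c is x :: s then runs b x (rcons s x) else 0.

Lemma runs_cat (b : B) (x : V) (s1 s2 : seq V) :
  runs b x (s1 ++ s2) = runs b x s1 + runs b (last x s1) s2.
Proof. by elim: s1 x => //= y s IH x; rewrite IH addnA. Qed.

Lemma slots_cat (b : B) (s1 s2 : seq V) : slots b (s1 ++ s2) = slots b (s2 ++ s1).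
Proof.
case: s1 s2 => [|x s1] [|y s2] //=; rewrite ?cats0 //.
by rewrite -!cats1 -!catA !runs_cat /= !addn0; lia.
Qed.

Lemma slots_rot (b : B) (n : nat) (c : seq V) : slots b (rot n c) = slots b c.
Proof. by rewrite /rot slots_cat cat_take_drop. Qed.

(** After the rotation the slot is the closing edge, so that inserting a path becomes a
    concatenation. *)
Lemma slot_rotation (b : B) (c : seq V) : 0 < slots b c ->
  exists n x s, [/\ rot n c = x :: s, lab x = Some b & lab (last x s) = Some b].
Proof.
case: c => // x s /=.
suff gen y q : 0 < runs b y q -> exists q1 z q2,
    [/\ q = q1 ++ z :: q2, lab (last y q1) = Some b & lab z = Some b].
  case/gen=> q1 [z [q2 [eq lq lz]]].
  case/lastP: q2 eq => [|q2 w].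
    rewrite cats1 => /eqP; rewrite eqseq_rcons => /andP[/eqP ? /eqP ?]; subst.
    by exists 0, z, q1; rewrite rot0.
  rewrite -rcons_cons -rcons_cat => /eqP.
  rewrite eqseq_rcons => /andP[/eqP ? /eqP ?]; subst.
  exists (size (w :: q1)), z, (q2 ++ (w :: q1)).
  by rewrite -cat_cons rot_size_cat last_cat.
elim: q y => //= z q IH y.
case: (boolP (lab y == Some b)) => [/eqP ly|_]; last first.
  by move=> /IH[q1 [w [q2 [-> lq lw]]]]; exists (z :: q1), w, q2.
case: (boolP (lab z == Some b)) => [/eqP lz _|_].
  by exists [::], z, q.
by move=> /IH[q1 [w [q2 [-> lq lw]]]]; exists (z :: q1), w, q2.
Qed.

(** The insertion destroys one slot of label [b] and keeps all others, and the runs inside the path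
    become slots. Both ends of the path must be adjacent to all vertices of label [b], since it is
    not known which of them form the slot. *)
Lemma absorb (c : seq V) (b : B) (h : V) (t : seq V) :
  ucycle e c -> 0 < slots b c -> uniq (c ++ h :: t) -> path e h t ->
  (forall v, lab v = Some b -> e v h && e v (last h t)) ->
  exists c', [/\ ucycle e c', perm_eq c' (c ++ h :: t)
    & forall b', slots b' c + runs b' h t <= slots b' c' + (b' == b)].
Proof.
move=> /andP[cc _] sc uq pt adj.
have [n [x [s [rc lx ls]]]] := slot_rotation sc.
have pm : perm_eq ((x :: s) ++ h :: t) (c ++ h :: t).
  by rewrite perm_cat2r -rc perm_rot.
exists ((x :: s) ++ h :: t); split=> //.
  apply/andP; split; last by rewrite (perm_uniq pm).
  move: cc; rewrite -(rot_cycle n) rc /= !rcons_path cat_path last_cat /=.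
  by move=> /andP[-> _]; rewrite pt (andP (adj _ ls)).1 e_sym (andP (adj _ lx)).2.
move=> b'; rewrite -(slots_rot b' n c) rc /= -!cats1 -catA !runs_cat /= ?runs_cat /=.
rewrite lx ls !addn0; have [->|nb] := eqVneq b' b; first by rewrite eqxx /=; lia.
have -> : (Some b == Some b') = false.
  by apply/negbTE; apply: contra nb => /eqP[->].
lia.
Qed.

Lemma absorb_items (l : seq (B * (V * seq V))) (c : seq V) :
  ucycle e c ->
  (forall b, count (fun i => i.1 == b) l <= slots b c) ->
  uniq (c ++ flatten [seq i.2.1 :: i.2.2 | i <- l]) ->
  (forall i, i \in l -> path e i.2.1 i.2.2 /\
     forall v, lab v = Some i.1 -> e v i.2.1 && e v (last i.2.1 i.2.2)) ->
  exists2 c', ucycle e c' & perm_eq c' (c ++ flatten [seq i.2.1 :: i.2.2 | i <- l]).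
Proof.
elim: l c => [|[b [h t]] l IH] c cc cnt uq il; first by exists c; rewrite //= cats0.
have [pt adj] := il _ (mem_head _ _).
have sc : 0 < slots b c by apply: leq_trans (cnt b); rewrite /= eqxx.
have uq1 : uniq (c ++ h :: t).
  by move: uq; rewrite /= -cat_cons catA cat_uniq => /andP[].
have [c1 [cc1 pm1 sl1]] := absorb cc sc uq1 pt adj.
have pm2 : perm_eq (c1 ++ flatten [seq i.2.1 :: i.2.2 | i <- l])
    (c ++ flatten [seq i.2.1 :: i.2.2 | i <- (b, (h, t)) :: l]).
  by rewrite /= -cat_cons catA perm_cat2r.
have [c2 cc2 pm3] : exists2 c', ucycle e c'
    & perm_eq c' (c1 ++ flatten [seq i.2.1 :: i.2.2 | i <- l]).
  apply: IH => //.
  - move=> b'; have := sl1 b'; have := cnt b' => /=.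
    by rewrite eq_sym; lia.
  - by rewrite (perm_uniq pm2).
  - by move=> i hi; apply: il; rewrite inE hi orbT.
by exists c2 => //; exact: perm_trans pm3 pm2.
Qed.

Definition core (b : B) : {set V} := [set v | lab v == Some b].

Lemma runs_const (b : B) (x : V) (s : seq V) :
  lab x = Some b -> (forall y, y \in s -> lab y = Some b) -> runs b x s = size s.
Proof.
move=> + ls; elim: s x ls => //= y s IH x ls lx.
rewrite lx (ls y) ?mem_head // eqxx /= IH ?ls ?mem_head //.
by move=> z zs; apply: ls; rewrite inE zs orbT.
Qed.

Lemma clique_path (h : V) (t : seq V) :
  uniq (h :: t) -> {in h :: t &, forall u v, u != v -> e u v} -> path e h t.
Proof.
elim: t h => //= y t IH h /andP[hn /andP[yt ut]] cl.
rewrite cl ?inE ?eqxx ?orbT //=; last first.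
  by apply: contra hn => /eqP ->; rewrite mem_head.
apply: IH => /=; first by rewrite yt.
by move=> u v ut' vt'; apply: cl; rewrite inE ?ut' ?vt' orbT.
Qed.

Variables (lk : rel B) (S : {set B}) (D : nat).
Hypothesis lk_refl : reflexive lk.
Hypothesis lk_e : forall u v a b, lab u = Some a -> lab v = Some b -> lk a b ->
  u != v -> e u v.
Hypothesis lk_deg : forall b, #|[set b' | lk b b']| <= D.
Hypothesis D_gt0 : 0 < D.
Hypothesis core_big : forall b, b \in S -> D.+1 < #|core b|.
Hypothesis lab_S : forall v b, lab v = Some b -> b \in S.
Hypothesis S_conn : forall I : {set B}, I != finset.set0 -> I \proper S ->
  exists a b, [/\ a \in I, b \in S :\: I & lk a b].

Lemma core_list (b : B) : b \in S -> exists h t, [/\ uniq (h :: t),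
  (h :: t) =i core b, path e h t, t != [::] & lab h = Some b].
Proof.
move=> /core_big; rewrite cardE; case E: (enum (core b)) => [|h t] // ht.
have mem : (h :: t) =i core b by move=> v; rewrite -E mem_enum.
have uq : uniq (h :: t) by rewrite -E enum_uniq.
have lb v : v \in h :: t -> lab v = Some b by rewrite mem inE => /eqP.
exists h, t; split=> //.
- apply: clique_path => // u v /lb lu /lb lv uv; exact: (lk_e lu lv).
- by case: t ht {E mem uq lb}.
- by apply: lb; rewrite mem_head.
Qed.

(** The cliques are added one at a time, each along a link. A clique loses one slot whenever another
    one is attached to it, so [inv] bounds its loss by the number of linked cells already present.
    The cell itself counts among these, which pays for a path having one edge less than vertices. *)
Lemma sea_cycle (b0 : B) : b0 \in S -> exists c, [/\ ucycle e c,
  (forall v, (v \in c) = (lab v != None))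
  & forall b, b \in S -> #|core b| <= slots b c + D].
Proof.
move=> b0S.
pose inv (I : {set B}) := exists c, [/\ ucycle e c,
  forall v, (v \in c) = (if lab v is Some b then b \in I else false)
  & forall b, b \in I -> #|core b| <= slots b c + #|[set b' in I | lk b b']|].
have start : inv [set b0].
  have [h [t [uq mem pt tn lh]]] := core_list b0S.
  have lb v : v \in h :: t -> lab v = Some b0 by rewrite mem inE => /eqP.
  exists (h :: t); split.
  - rewrite /ucycle uq andbT /= rcons_path pt /=.
    have lt : last h t \in t by case: t tn {uq mem pt lb} => //= y t _; rewrite mem_last.
    apply: (@lk_e _ _ b0 b0) => //; first by apply: lb; rewrite inE lt orbT.
    by move: uq => /= /andP[hn _]; apply: contra hn => /eqP <-.
  - move=> v; rewrite mem inE; case: (lab v) => [b|] //.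
    by rewrite inE; apply/eqP/eqP => [[]|->].
  - move=> b; rewrite inE => /eqP ->; rewrite -(eq_card mem) (card_uniqP uq) /=.
    rewrite runs_const ?size_rcons //; first by rewrite leq_addr.
    by move=> y; rewrite mem_rcons; exact: lb.
have step (I : {set B}) : I != finset.set0 -> I \proper S -> inv I ->
    exists2 b, b \in S :\: I & inv (b |: I).
  move=> I0 IS [c [cc mc sc]].
  have [a [b [aI bSI lab_ab]]] := S_conn I0 IS.
  exists b => //; have /finset.setDP[bS bI] := bSI.
  have aS : a \in S by apply: (fintype.subsetP (proper_sub IS)).
  have [h [t [uq mem pt tn lh]]] := core_list bS.
  have lb v : v \in h :: t -> lab v = Some b by rewrite mem inE => /eqP.
  (* Without a slot the invariant would give [#|core a| <= D], against [core_big]. *)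
  have sa : 0 < slots a c.
    have le_I : #|[set b' in I | lk a b']| <= #|[set b' | lk a b']|.
      by apply: subset_leq_card; apply/fintype.subsetP => x; rewrite !inE => /andP[].
    rewrite lt0n; apply: contraTN (core_big aS) => /eqP s0.
    rewrite -leqNgt (leq_trans (sc _ aI)) // s0 add0n.
    by rewrite (leq_trans le_I) // (leq_trans (lk_deg a)).
  have uqc : uniq (c ++ h :: t).
    rewrite cat_uniq uq (andP cc).2 andbT andTb; apply/hasPn => v /lb lv.
    by rewrite /= mc lv.
  have adj v : lab v = Some a -> e v h && e v (last h t).
    move=> lv; have nin w : w \in h :: t -> v != w.
      move=> /lb lw; apply/eqP => vw; move: lv; rewrite vw lw => -[ba].
      by rewrite ba aI in bI.
    rewrite (lk_e lv lh lab_ab) ?(lk_e lv (lb _ (mem_last _ _)) lab_ab) //.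
    - by apply: nin; rewrite mem_last.
    - by apply: nin; rewrite mem_head.
  have [c' [cc' pm sl]] := absorb cc sa uqc pt adj.
  exists c'; split=> //.
  - move=> v; rewrite (perm_mem pm) mem_cat mc mem inE.
    by case: (lab v) => [b'|] //; rewrite !inE orbC.
  - move=> b' /finset.setU1P[->|b'I].
      have := sl b; rewrite runs_const //; last first.
        by move=> y yt; apply: lb; rewrite inE yt orbT.
      have -> : (b == a) = false by apply: contraNF bI => /eqP ->.
      rewrite -(eq_card mem) (card_uniqP uq) /= addn0 => sb.
      have : 0 < #|[set b'0 in b |: I | lk b b'0]|.
        by apply/card_gt0P; exists b; rewrite !inE eqxx lk_refl.
      move=> pos; rewrite -addn1; apply: leq_add pos.
      by apply: leq_trans sb; rewrite leq_addl.
    have := sl b'; have := sc _ b'I.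
    (* The cell [a] loses a slot, but [b] is a new cell linked to it, so both changes cancel in the
       invariant. *)
    have [b'a|nb'a] := eqVneq b' a.
      subst b'; have -> : [set b' in b |: I | lk a b'] = b |: [set b' in I | lk a b'].
        by apply/finset.setP => x; rewrite !inE; case: eqP => //= ->; rewrite lab_ab.
      rewrite finset.cardsU1 !inE (negPf bI) /= => h1 h2.
      rewrite (leq_trans h1) // addnA leq_add2r.
      by apply: leq_trans h2; rewrite leq_addr.
    have : #|[set b'0 in I | lk b' b'0]| <= #|[set b'0 in b |: I | lk b' b'0]|.
      by apply: subset_leq_card; apply/fintype.subsetP => x; rewrite !inE => /andP[-> ->];
        rewrite orbT.
    rewrite addn0 => h1 h2 h3.
    apply: (leq_trans h2 (leq_add _ h1)).
    by apply: leq_trans h3; rewrite leq_addr.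
have all_S n (I : {set B}) : #|S :\: I| <= n -> I != finset.set0 -> I \subset S -> inv I -> inv S.
  elim: n I => [|n IH] I hn I0 IS iI.
    have -> // : S = I; apply/eqP; rewrite finset.eqEsubset IS andbT -finset.setD_eq0.
    by rewrite -cards_eq0 -leqn0.
  have [-> //|nIS] := eqVneq S I.
  have pI : I \proper S by rewrite finset.properEneq IS eq_sym nIS.
  have [b bSI ib] := step I I0 pI iI.
  have /finset.setDP[bS bI] := bSI.
  apply: (IH (b |: I)) => //.
  - have : #|S :\: (b |: I)| < #|S :\: I|.
      apply: proper_card; apply/properP; split.
        by apply/fintype.subsetP => x; rewrite !inE negb_or -andbA => /and3P[_ -> ->].
      by exists b => //; rewrite !inE eqxx.
    by move=> h; rewrite -ltnS; exact: leq_trans h hn.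
  - by apply/finset.set0Pn; exists b; rewrite !inE eqxx.
  - by rewrite finset.subUset finset.sub1set bS.
have [c [cc mc sc]] : inv S.
  apply: (all_S #|S :\: [set b0]|) start => //.
  - by apply/finset.set0Pn; exists b0; rewrite inE.
  - by rewrite finset.sub1set.
exists c; split=> //.
  move=> v; rewrite mc; case E: (lab v) => [b|] //; exact: lab_S E.
move=> b bS; apply: leq_trans (sc b bS) _; rewrite leq_add2l.
apply: leq_trans (lk_deg b).
by apply: subset_leq_card; apply/fintype.subsetP => x; rewrite !inE => /andP[].
Qed.

(* An item [(b, (x, p))] stands for a path [x :: p] of unlabelled vertices, which is
   inserted in the cycle between two consecutive vertices of label [b]. *)
Lemma hamiltonian_absorption (l : seq (B * (V * seq V))) :
  S != finset.set0 ->
  (forall b, b \in S -> count (fun i => i.1 == b) l + D <= #|core b|) ->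
  (forall i, i \in l -> i.1 \in S) ->
  (forall i, i \in l -> path e i.2.1 i.2.2 /\
     forall v, lab v = Some i.1 -> e v i.2.1 && e v (last i.2.1 i.2.2)) ->
  uniq (flatten [seq i.2.1 :: i.2.2 | i <- l]) ->
  (forall v, (v \in flatten [seq i.2.1 :: i.2.2 | i <- l]) = (lab v == None)) ->
  hamiltonian e.
Proof.
move=> /finset.set0Pn[b0 b0S] cnt lS il uq mem.
have [c [cc mc sc]] := sea_cycle b0S.
have [||//|c' cc' pm] := absorb_items (l := l) cc.
- move=> b; have [bS|bS] := boolP (b \in S).
    by rewrite -(leq_add2r D); exact: leq_trans (cnt b bS) (sc b bS).
  suff -> : count (fun i => i.1 == b) l = 0 by [].
  apply/eqP; rewrite -leqn0 leqNgt -has_count; apply/hasPn => i /lS iS.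
  by apply: contra bS => /eqP <-.
- rewrite cat_uniq uq (andP cc).2 andbT andTb; apply/hasPn => v.
  by rewrite mem mc => ->.
have memc' v : v \in c'.
  by rewrite (perm_mem pm) mem_cat mc mem; case: (lab v).
exists c'; split=> //.
have h : #|core b0| <= #|c'|.
  by apply: subset_leq_card; apply/fintype.subsetP => v _.
apply: leq_trans (leq_trans h (card_size c')).
by apply: leq_trans (core_big b0S); rewrite !ltnS.
Qed.
End Absorption.

(** * Cliques away from the sea *)

Section TwoEdges.
Local Open Scope set_scope.
Local Open Scope nat_scope.
Variables (V : finType) (e : rel V).
Hypothesis conn2 : k_connected 2 e.

Lemma exit_edge (F W : {set V}) (a b : V) : #|W| < 2 ->
  a \in F -> a \notin W -> b \notin F -> b \notin W ->
  exists u v, [/\ u \in F, u \notin W, v \notin F, v \notin W & e u v].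
Proof.
move=> hW aF aW bF bW; have /connectP[p pp eb] := conn2.2 W hW a b aW bW.
elim: p a aF {aW} pp eb => [|v p IH] a aF /=.
  by move=> _ ba; rewrite ba aF in bF.
move=> /andP[/and3P[aW vW eav] pp] eb.
by have [vF|vF] := boolP (v \in F); [exact: IH pp eb | exists a, v].
Qed.

(** Deleting the outer end of a first exit edge gives a second one with another outer end. If both
    start at the same [x], deleting [x] gives a third, which is paired with one of the first two
    whose outer end differs from its own. *)
Lemma two_exit_edges (F : {set V}) : F != finset.set0 -> 1 < #|~: F| ->
  exists x1 x2 y1 y2, [/\ x1 \in F, x2 \in F, y1 \notin F & y2 \notin F] /\
    [/\ e x1 y1, e x2 y2, y1 != y2 & x1 = x2 -> F = [set x1]].
Proof.
move=> /finset.set0Pn[a aF] cF.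
have outside (W : {set V}) : #|W| < 2 -> exists2 b, b \notin F & b \notin W.
  move=> hW; have /fintype.subsetPn[b] : ~~ (~: F \subset W).
    by apply/negP => /subset_leq_card h; have := leq_trans cF h; rewrite leqNgt hW.
  by rewrite inE => bF bW; exists b.
have edge (W : {set V}) c : #|W| < 2 -> c \in F -> c \notin W ->
    exists u v, [/\ u \in F, u \notin W, v \notin F, v \notin W & e u v].
  by move=> hW cF' cW; have [b bF bW] := outside W hW; exact: (exit_edge hW cF' cW bF bW).
have neF u v : u \in F -> v \notin F -> u \notin [set v].
  by move=> uF vF; rewrite inE; apply: contra vF => /eqP <-.
have c0 : #|finset.set0 : {set V}| < 2 by rewrite cards0.
have [x [y [xF _ yF _ exy]]] := edge finset.set0 a c0 aF (negbT (finset.in_set0 _)).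
have [u [v [uF _ vF vy euv]]] := edge [set y] x ltac:(by rewrite cards1) xF (neF _ _ xF yF).
rewrite inE in vy.
have [ux|ux] := eqVneq x u; last first.
  exists x, u, y, v; do 2!split=> //; first by rewrite eq_sym.
  by move=> xu; rewrite xu eqxx in ux.
subst u; have [F1|/fintype.subsetPn[c cF' cx]] := boolP (F \subset [set x]).
  exists x, x, y, v; do 2!split=> //; first by rewrite eq_sym.
  by move=> _; apply/eqP; rewrite finset.eqEsubset F1 finset.sub1set.
have [u [w [uF' ux wF _ euw]]] := edge [set x] c ltac:(by rewrite cards1) cF' cx.
rewrite inE in ux.
have [wy|wy] := eqVneq w y; [exists x, u, v, w | exists x, u, y, w].
  do 2!split=> //; first by rewrite wy.
  by move=> xu; rewrite xu eqxx in ux.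
do 2!split=> //; first by rewrite eq_sym.
by move=> xu; rewrite xu eqxx in ux.
Qed.
End TwoEdges.

Lemma count_le1 (T : eqType) (P : pred T) (s : seq T) : uniq s ->
  {in s &, forall x y, P x -> P y -> x = y} -> (count P s <= 1)%N.
Proof.
move=> us inj; rewrite -size_filter.
have := seq.filter_uniq P us.
case E : (seq.filter P s) => [|x [|y r]] //=.
have [] : x \in seq.filter P s /\ y \in seq.filter P s by rewrite E !inE !eqxx orbT.
rewrite !mem_filter => /andP[Px xs] /andP[Py ys].
by rewrite (inj x y xs ys Px Py) inE eqxx.
Qed.

Section Board.
Local Open Scope set_scope.
Variables (V B : finType) (e : rel V) (cell : V -> B) (io : B -> Z * Z).
Variables (S : {set B}) (D : nat).

Let lk (a b : B) : bool := link (io a) (io b).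
Let nr (k : Z) (a b : B) : Prop := near k (io a) (io b).
(** Vertices that cannot be placed directly beside a sea vertex; they turn out to form the cliques
    [F x]. *)
Let fv (x : V) : bool := [forall c in S, ~~ lk (cell x) c].
Let F (x : V) : {set V} := [set y | fv y && `[< nr 34 (cell x) (cell y) >]].

Hypothesis e_sym : symmetric e.
Hypothesis link_e : forall u v, u != v -> lk (cell u) (cell v) -> e u v.
Hypothesis lk_deg : forall b, (#|[set b' | lk b b']%SET| <= D)%N.
Hypothesis full_S : forall b, b \in S -> (2 * D + 5 < #|[set v | cell v == b]%SET|)%N.
Hypothesis far_near : forall b b', {in S, forall c, ~~ lk b c} ->
  {in S, forall c, ~~ lk b' c} -> nr 50000 b b' -> nr 34 b b'.
Hypothesis S_near : forall b b', b \in S -> b' \in S -> nr 5000 b b' ->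
  exists p, [/\ path lk b p, last b p = b' &
    forall c, c \in b :: p -> c \in S /\ nr 20000 b c].
Hypothesis S_dense : forall b, exists2 c, c \in S & nr 1300 b c.
(** The alternatives stand for a small and a large radius: either all edges are short, or all pairs
    at moderate distance are joined. *)
Hypothesis e_local : (forall u v, e u v -> nr 2000 (cell u) (cell v)) \/
  (forall u v, u != v -> nr 1400 (cell u) (cell v) -> e u v).
Hypothesis conn2 : k_connected 2 e.

Lemma lk_sym' : symmetric lk. Proof. by move=> a b; rewrite /lk link_sym. Qed.

Lemma fvP (x : V) : reflect {in S, forall c, ~~ lk (cell x) c} (fv x).
Proof. exact: forall_inP. Qed.

Lemma fvNS (x : V) : fv x -> cell x \notin S.
Proof. by move/fvP=> h; apply/negP => /h; rewrite /lk link_refl. Qed.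

Lemma fvPn (x : V) : ~~ fv x -> exists2 c, c \in S & lk (cell x) c.
Proof. by case/forall_inPn => c cS; rewrite negbK; exists c. Qed.

(** By [far_near] no distance between far vertices lies strictly between 34 and 50000. Hence the
    sets [F x] are the classes of an equivalence relation. *)
Lemma F_far (x y : V) : fv x -> (y \in F x) = fv y && `[< nr 50000 (cell x) (cell y) >].
Proof.
move=> fx; rewrite inE; apply: andb_id2l => fy; apply: asbool_equiv_eq; split.
  exact: near_le.
by apply: far_near; exact/fvP.
Qed.

Lemma F_refl (x : V) : fv x -> x \in F x.
Proof. by move=> fx; rewrite inE fx; apply/asboolP; split; lia. Qed.

Lemma F_clique (x u v : V) : fv x -> u \in F x -> v \in F x -> u != v -> e u v.
Proof.
move=> fx; rewrite !inE => /andP[fu /asboolP xu] /andP[fv' /asboolP xv] uv.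
apply: link_e uv _; apply: near_link; apply: far_near; try exact/fvP.
by apply: near_le (near_trans (near_sym xu) xv).
Qed.

(* Two disjoint edges leading from a far clique to vertices close to the sea. *)
Lemma far_exits (x : V) : fv x -> exists x1 x2 y1 y2,
  [/\ x1 \in F x, x2 \in F x, ~~ fv y1 & ~~ fv y2] /\
  [/\ e x1 y1, e x2 y2, y1 != y2, x1 = x2 -> F x = [set x1]%SET &
      nr 2034 (cell x) (cell y1) /\ nr 2034 (cell x) (cell y2)].
Proof.
move=> fx; have xF := F_refl fx.
have nearF u : u \in F x -> nr 34 (cell x) (cell u).
  by rewrite inE => /andP[_ /asboolP].
have [q qS xq] := S_dense (cell x).
have [y1 [y2 [y1q y2q y12]]] : exists y1 y2, [/\ cell y1 = q, cell y2 = q & y1 != y2].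
  have : (1 < #|[set v | cell v == q]%SET|)%N.
    by apply: leq_trans (full_S qS); rewrite addnS ltnS addnS.
  by case/card_gt1P=> y1 [y2 []]; rewrite !inE => /eqP ? /eqP ? ?; exists y1, y2.
have nfv y : cell y = q -> ~~ fv y.
  by move=> yq; apply: contraL qS => /fvNS; rewrite yq.
(* With short edges, an exit edge ends within [34 + 2000] of [x]; a far vertex so close would belong
   to [F x], so the outer end is not far. *)
case: e_local => [loc|glob].
  have F0 : F x != finset.set0 by apply/finset.set0Pn; exists x.
  have Fc : (1 < #|~: F x|)%N.
    apply/card_gt1P; exists y1, y2; split=> //; rewrite !inE negb_and.
      by rewrite (nfv _ y1q).
    by rewrite (nfv _ y2q).
  have [x1 [x2 [z1 [z2 [[x1F x2F z1F z2F] [e1 e2 z12 x12]]]]]] := two_exit_edges conn2 F0 Fc.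
  have far_out u z : u \in F x -> z \notin F x -> e u z ->
      ~~ fv z /\ nr 2034 (cell x) (cell z).
    move=> uF zF euz; have xz : nr 2034 (cell x) (cell z).
      exact: near_trans (nearF _ uF) (loc _ _ euz).
    split=> //; apply: contra zF => fz; rewrite F_far // fz /=.
    by apply/asboolP; exact: near_le xz.
  have [n1 r1] := far_out _ _ x1F z1F e1; have [n2 r2] := far_out _ _ x2F z2F e2.
  by exists x1, x2, z1, z2.
(* For a large radius, all of [F x] is within [34 + 1300 = 1334] of the sea cell [q], hence adjacent
   to every vertex in it. *)
have e_q u y : u \in F x -> cell y = q -> e u y.
  move=> uF yq; apply: glob.
    by apply: contraNneq (nfv _ yq) => <-; move: uF; rewrite inE => /andP[].
  rewrite yq; have h : nr 1334 (cell u) q := near_trans (near_sym (nearF _ uF)) xq.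
  exact: near_le h.
have xq' : nr 2034 (cell x) q by exact: near_le xq.
have [F1|/fintype.subsetPn[x2 x2F x2x]] := boolP (F x \subset [set x]%SET).
  exists x, x, y1, y2; split; first by split=> //; exact: nfv.
  split=> //; rewrite ?y1q ?y2q //; try exact: e_q.
  by move=> _; apply/eqP; rewrite finset.eqEsubset F1 finset.sub1set.
rewrite inE in x2x; exists x, x2, y1, y2; split; first by split=> //; exact: nfv.
split=> //; rewrite ?y1q ?y2q //; try exact: e_q.
by move=> xx2; rewrite xx2 eqxx in x2x.
Qed.

Lemma path_through (A : {set V}) (x1 x2 : V) : x1 \in A -> x2 \in A ->
  (x1 = x2 -> A = [set x1]%SET) -> {in A &, forall u v, u != v -> e u v} ->
  exists m, [/\ uniq (x1 :: m), (x1 :: m) =i A, path e x1 m & last x1 m = x2].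
Proof.
move=> x1A x2A x12 cl.
suff [m [um mm lm]] : exists m, [/\ uniq (x1 :: m), (x1 :: m) =i A & last x1 m = x2].
  exists m; split=> //; apply: clique_path => // u v; rewrite !mm; exact: cl.
have [eq12|n12] := eqVneq x1 x2.
  exists [::]; split=> //= v.
  by rewrite (x12 eq12) !inE.
exists (rcons (enum (A :\: [set x1; x2])) x2); split; last by rewrite last_rcons.
  rewrite /= mem_rcons inE mem_enum !inE (negPf n12) eqxx /= rcons_uniq enum_uniq.
  by rewrite mem_enum !inE eqxx orbT.
move=> v; rewrite inE mem_rcons inE mem_enum !inE.
have [->|v1] := eqVneq v x1; first by rewrite x1A.
by have [->|v2] := eqVneq v x2; rewrite ?x2A.
Qed.

(** One vertex is taken from each cell of the walk except the last, so that the path ends next to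
    the whole last cell, as an insertion there requires. *)
Lemma thread (w : B -> V) (y : V) (c : B) (p : seq B) :
  path lk c p -> uniq (c :: p) -> lk (cell y) c ->
  (forall b, b \in belast c p -> cell (w b) = b /\ w b != y) ->
  path e y [seq w b | b <- belast c p] /\
  forall v, cell v = last c p -> v != y -> e (last y [seq w b | b <- belast c p]) v.
Proof.
elim: p y c => [|c' p IH] y c /=.
  by move=> _ _ yc _; split=> // v vc vy; apply: link_e; rewrite ?vc // eq_sym.
move=> /andP[cc' pp] /andP[cn un] yc wP.
have [wc wy] := wP c (mem_head _ _).
have [|b bp|p1 p2] := IH (w c) c' pp un.
- by rewrite wc.
- have [wb _] := wP b ltac:(by rewrite inE bp orbT); split=> //.
  apply: contraNneq cn => wbc; rewrite -wc -wbc wb.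
  exact: mem_belast bp.
split.
  by rewrite p1 andbT; apply: link_e; rewrite ?wc // eq_sym.
move=> v vl vy; apply: p2 => //; apply: contraNneq cn => vw.
by rewrite -wc -vw vl mem_last.
Qed.

(** The route runs from [y1] through the whole clique to [y2] and then through the sea, from the
    cell beside [y2] back to the cell [q] beside [y1]. So both ends are adjacent to all free
    vertices of the same cell. A sea cell meets the route at most in [y1], [y2] and one vertex of
    the walk. *)
Lemma far_route (x : V) : fv x -> exists q h t,
  [/\ q \in S, nr 2100 (cell x) q, path e h t & uniq (h :: t)] /\
  [/\ {subset F x <= h :: t},
      forall v, v \in h :: t -> nr 24000 (cell x) (cell v),
      forall v, cell v = q -> v \notin h :: t -> e v h && e v (last h t) &
      forall b, b \in S -> (#|[set v in h :: t | cell v == b]%SET| <= 3)%N].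
Proof.
move=> fx.
have [x1 [x2 [y1 [y2 [[x1F x2F ny1 ny2] [e1 e2 y12 x12 [xy1 xy2]]]]]]] := far_exits fx.
have [q1 q1S yq1] := fvPn ny1; have [q2 q2S yq2] := fvPn ny2.
have xq1 : nr 2082 (cell x) q1 := near_trans xy1 (link_near yq1).
have xq2 : nr 2082 (cell x) q2 := near_trans xy2 (link_near yq2).
have [p0 [pp0 lp0 p0S]] : exists p, [/\ path lk q2 p, last q2 p = q1 &
    forall c, c \in q2 :: p -> c \in S /\ nr 20000 q2 c].
  by apply: S_near => //; apply: near_le (near_trans (near_sym xq2) xq1).
have [p [pp lp pS up]] : exists p, [/\ path lk q2 p, last q2 p = q1,
    forall c, c \in q2 :: p -> c \in S /\ nr 20000 q2 c & uniq (q2 :: p)].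
  case/shortenP: pp0 lp0 => p pp up sp lp; exists p; split=> // c.
  rewrite inE => /orP[/eqP ->|/sp cp]; apply: p0S; first by rewrite mem_head.
  by rewrite inE cp orbT.
have wP b : exists v, b \in S -> cell v = b /\ v \notin [:: y1; y2].
  have [bS|] := boolP (b \in S); last by exists x.
  suff : ~~ ([set v | cell v == b]%SET \subset [set y1; y2]%SET).
    case/fintype.subsetPn=> v; rewrite !inE => /eqP vb nv.
    by exists v; rewrite !inE.
  apply/negP => /subset_leq_card; apply/negP; rewrite -ltnNge.
  rewrite finset.cards2; apply: leq_ltn_trans (_ : _ <= 2)%N _; first by case: eqP.
  by apply: leq_trans (full_S bS); rewrite addnS ltnS addnS.
have {wP} [w wP] := choice wP.
have inS c : c \in q2 :: p -> c \in S by move/pS => [].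
have beS b : b \in belast q2 p -> b \in q2 :: p by exact: mem_belast.
have wB b : b \in belast q2 p -> [/\ cell (w b) = b, w b != y1 & w b != y2].
  move=> /beS/inS bS; have [wb] := wP b bS.
  by rewrite !inE negb_or => /andP[].
have F_e : {in F x &, forall u v, u != v -> e u v} by move=> u v; exact: F_clique.
have [m [um mF pm lm]] := path_through x1F x2F x12 F_e.
have [pW lW] := thread pp up yq2 (fun b hb => let: And3 wb _ w2 := wB b hb in conj wb w2).
set W := [seq w b | b <- belast q2 p] in pW lW.
have fF u : u \in x1 :: m -> fv u by rewrite mF inE => /andP[].
have WP u : u \in W -> exists b, [/\ u = w b, b \in belast q2 p & cell u = b].
  by case/mapP=> b bp ->; exists b; split=> //; case: (wB b bp).
have nfW u : u \in W -> ~~ fv u.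
  move=> /WP[b [_ /beS/inS bS ub]]; apply: contraL bS => /fvNS; by rewrite ub.
have uW : uniq W.
  rewrite map_inj_in_uniq; last first.
    by move=> b b' /wB[cb _ _] /wB[cb' _ _] eqw; rewrite -cb eqw cb'.
  by have := up; rewrite (lastI q2 p) rcons_uniq => /andP[].
have y1W : y1 \notin W by apply/mapP => -[b /wB[_ h _] yw]; rewrite yw eqxx in h.
have y2W : y2 \notin W by apply/mapP => -[b /wB[_ _ h] yw]; rewrite yw eqxx in h.
have notF u : ~~ fv u -> u \notin x1 :: m by apply: contra; exact: fF.
exists q1, y1, (x1 :: m ++ y2 :: W); split; [split|split] => //.
- exact: near_le xq1.
- by rewrite /= cat_path e_sym e1 pm /= lm e2.
- rewrite -cat_cons cons_uniq cat_uniq um mem_cat negb_or notF //= inE negb_or y12 y1W.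
  rewrite uW y2W /= !andbT negb_or notF //=; apply/hasPn => u /nfW; exact: notF.
- by move=> u; rewrite -mF => uF; rewrite inE -cat_cons mem_cat uF orbT.
- move=> u; rewrite inE -cat_cons mem_cat [in u \in y2 :: _]inE.
  case/or4P => [/eqP ->|uF|/eqP ->|/WP[b [_ /beS/pS[_ h] ub]]].
  + exact: near_le xy1.
  + by move: uF; rewrite mF inE => /andP[_ /asboolP]; exact: near_le.
  + exact: near_le xy2.
  + by rewrite ub; apply: near_le (near_trans xq2 h).
- move=> v vq; rewrite inE negb_or -cat_cons mem_cat inE !negb_or.
  move=> /and4P[vy1 _ vy2 _]; rewrite /= last_cat /= e_sym (@link_e y1 v) 1?eq_sym //=.
    by rewrite e_sym; apply: lW; rewrite ?lp.
  by rewrite vq.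
- move=> b bS.
  have sub : [set v in y1 :: x1 :: m ++ y2 :: W | cell v == b]%SET
      \subset [set y1; y2; w b]%SET.
    apply/fintype.subsetP => v; rewrite inE => /andP[+ /eqP vb].
    rewrite inE -cat_cons mem_cat [in v \in y2 :: _]inE !inE.
    case/or4P => [->|/fF/fvNS|->|/WP[b' [ub' _ cb']]] //; rewrite ?orbT //.
      by rewrite vb bS.
    by rewrite -vb cb' -ub' eqxx orbT.
  apply: leq_trans (subset_leq_card sub) _; apply: leq_trans (finset.leq_card_setU _ _).1 _.
  by rewrite finset.cards1 finset.cards2; case: eqP.
Qed.

Lemma F_eq (x y : V) : fv x -> y \in F x -> F y = F x.
Proof.
move=> fx yF; have /andP[fy /asboolP xy] : fv y && `[< nr 34 (cell x) (cell y) >].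
  by move: yF; rewrite inE.
apply/finset.setP => z; rewrite !F_far //; apply: andb_id2l => fz.
apply: asbool_equiv_eq; split=> h.
  have yz : nr 34 (cell y) (cell z) by apply: far_near h; exact/fvP.
  by apply: near_le (near_trans xy yz).
have xz : nr 34 (cell x) (cell z) by apply: far_near h; exact/fvP.
by apply: near_le (near_trans (near_sym xy) xz).
Qed.

(** The value of [pick] depends only on the set [F x], so all vertices of a far clique get the same
    representative. *)
Let rep (x : V) : V := odflt x [pick y in F x].

Lemma rep_in (x : V) : fv x -> rep x \in F x.
Proof.
move=> fx; rewrite /rep; case: pickP => [y //|none].
by have := none x; rewrite F_refl.
Qed.

Lemma rep_eq (x y : V) : fv x -> y \in F x -> rep y = rep x.
Proof.
move=> fx yF; rewrite /rep (F_eq fx yF); case: pickP => [z //|none].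
by have := none x; rewrite F_refl.
Qed.

Let reps : seq V := [seq x <- enum V | fv x && (rep x == x)].

Lemma reps_uniq : uniq reps.
Proof. by apply: seq.filter_uniq; exact: enum_uniq. Qed.

Lemma repsP (x : V) : x \in reps -> fv x.
Proof. by rewrite mem_filter => /andP[/andP[]]. Qed.

Lemma rep_reps (x : V) : fv x -> rep x \in reps.
Proof.
move=> fx; rewrite mem_filter mem_enum (rep_eq fx (rep_in fx)) eqxx !andbT.
by have := rep_in fx; rewrite inE => /andP[].
Qed.

Lemma reps_apart (x y : V) : x \in reps -> y \in reps ->
  nr 50000 (cell x) (cell y) -> x = y.
Proof.
rewrite !mem_filter => /andP[/andP[fx /eqP rx] _] /andP[/andP[fy /eqP ry] _] xy.
have yF : y \in F x by rewrite F_far // fy; exact/asboolP.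
by rewrite -rx -ry (rep_eq fx yF).
Qed.

Hypothesis S_conn : forall I : {set B}, I != finset.set0 -> I \proper S ->
  exists a b, [/\ a \in I, b \in S :\: I & lk a b].

Lemma board_hamiltonian : hamiltonian e.
Proof.
have /choice[sp spP] (x : V) : exists i : B * (V * seq V), fv x ->
  [/\ i.1 \in S, nr 2100 (cell x) i.1, path e i.2.1 i.2.2
    & uniq (i.2.1 :: i.2.2)] /\
  [/\ {subset F x <= i.2.1 :: i.2.2},
      forall v, v \in i.2.1 :: i.2.2 -> nr 24000 (cell x) (cell v),
      forall v, cell v = i.1 -> v \notin i.2.1 :: i.2.2 ->
        e v i.2.1 && e v (last i.2.1 i.2.2) &
      forall b, b \in S ->
        (#|[set v in i.2.1 :: i.2.2 | cell v == b]%SET| <= 3)%N].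
  have [fx|nfx] := boolP (fv x).
    by have [q [h [t ?]]] := far_route fx; exists (q, (h, t)).
  by exists (cell x, (x, [::])).
have /choice[qn qnP] (b : B) : exists c : B, forall v, cell v = b -> ~~ fv v ->
    c \in S /\ lk b c.
  have [[v vb nfv]|none] := pselect (exists2 v, cell v = b & ~~ fv v).
    by have [c cS bc] := fvPn nfv; exists c => u ub _; rewrite -vb.
  by exists b => v vb nfv; case: none; exists v.
pose it x := (sp x).2.1 :: (sp x).2.2.
pose U := flatten [seq it x | x <- reps].
have memU v : reflect (exists2 x, x \in reps & v \in it x) (v \in U).
  exact: flatten_mapP.
(* A route stays within 24000 of its representative, and different representatives are not within
   50000 of each other, so two routes never visit the same cell. *)
have same x y v w : x \in reps -> y \in reps -> v \in it x -> w \in it y ->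
    cell v = cell w -> x = y.
  move=> xr yr vx wy vw; apply: reps_apart => //.
  have [_ [_ /(_ v vx) xv _ _]] := spP x (repsP xr).
  have [_ [_ /(_ w wy) yw _ _]] := spP y (repsP yr).
  by rewrite vw in xv; apply: near_le (near_trans xv (near_sym yw)).
pose lab v := if v \in U then None else if cell v \in S then Some (cell v) else None.
have labP v b : lab v = Some b -> [/\ v \notin U, cell v = b & b \in S].
  by rewrite /lab; case: ifP => // vU; case: ifP => // vS [<-]; split; rewrite ?vU.
(* The vertices outside the sea but linked to it, cell by cell. Those of one cell form a clique and
   are inserted as a single path in the sea cell [qn b]. *)
pose grp b := enum [set v | [&& cell v == b, v \notin U & ~~ fv v]]%SET.
have grpP b v : (v \in grp b) = [&& cell v == b, v \notin U & ~~ fv v].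
  by rewrite mem_enum inE.
pose mk b := if grp b is h :: t then Some (qn b, (h, t)) else None.
pose ls := [seq b <- enum B | b \notin S].
have lsP b : (b \in ls) = (b \notin S) by rewrite mem_filter mem_enum andbT.
pose l1 := [seq sp x | x <- reps].
pose l2 := pmap mk ls.
have flat1 : flatten [seq i.2.1 :: i.2.2 | i <- l1] = U by rewrite -map_comp.
have flat2 : flatten [seq i.2.1 :: i.2.2 | i <- l2] = flatten [seq grp b | b <- ls].
  rewrite /l2; elim: (ls) => //= b s IH; rewrite /mk.
  by case: (grp b) => [|h t] //=; rewrite IH.
have il2 i : i \in l2 -> exists b, [/\ b \notin S, i.1 = qn b & grp b = i.2.1 :: i.2.2].
  rewrite mem_pmap => /mapP[b]; rewrite lsP /mk => bS.
  by case E : (grp b) => [|h t] // [->]; exists b.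
have qnS b v : v \in grp b -> qn b \in S /\ lk b (qn b).
  by rewrite grpP => /and3P[/eqP vb _ nf]; exact: qnP vb nf.
have coreE b : b \in S -> core lab b = ([set v | cell v == b] :\: [set v in U])%SET.
  move=> bS; apply/finset.setP => v; rewrite !inE /lab.
  case: ifP => //= vU; case: ifP => [vS|vS] /=; first by apply/eqP/eqP => [[]|->].
  by symmetry; apply: contraFF vS => /eqP ->.
have U_b b : b \in S -> (#|[set v | cell v == b]%SET :&: [set v in U]%SET| <= 3)%N.
  move=> bS; have [->|/finset.set0Pn[v]] :=
    eqVneq ([set v | cell v == b]%SET :&: [set v in U]%SET) finset.set0.
    by rewrite cards0.
  rewrite !inE => /andP[/eqP vb /memU[x xr vx]].
  have [_ [_ _ _ /(_ b bS)]] := spP x (repsP xr); apply: leq_trans.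
  apply: subset_leq_card; apply/fintype.subsetP => w.
  rewrite !finset.in_setI !finset.in_set => /andP[/eqP wb /memU[y yr wy]].
  apply/andP; split; last exact/eqP.
  by rewrite (same x y v w) // vb.
have core_b b : b \in S -> (2 * D + 2 < #|core lab b|)%N.
  move=> bS; rewrite coreE // finset.cardsD.
  apply: leq_trans (leq_sub2l _ (U_b b bS)).
  by rewrite ltn_subRL addnC -addnA; exact: full_S.
have D_gt0 : (0 < D)%N.
  have /card_gt0P[v _] : (0 < #|V|)%N by apply: leq_trans conn2.1.
  apply: leq_trans (lk_deg (cell v)); apply/card_gt0P; exists (cell v).
  by rewrite inE /lk link_refl.
have count1 b : (count (fun i => i.1 == b) l1 <= 1)%N.
  rewrite count_map; apply: count_le1; first exact: reps_uniq.
  move=> x y xr yr /= /eqP xb /eqP yb; apply: reps_apart => //.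
  have [[_ + _ _] _] := spP x (repsP xr); have [[_ + _ _] _] := spP y (repsP yr).
  by rewrite xb yb => yq xq; apply: near_le (near_trans xq (near_sym yq)).
have count2 b : (count (fun i => i.1 == b) l2 <= D)%N.
  apply: leq_trans (lk_deg b).
  have -> : #|[set b' | lk b b']%SET| = count (lk b) (enum B).
    by rewrite finset.cardsE cardE {1}/enum_mem size_filter -enumT; apply: eq_count.
  apply: (@leq_trans (count (lk b) ls)); last first.
    by rewrite count_filter; apply: sub_count => c /andP[].
  have : {subset l2 <= pmap mk ls} by [].
  rewrite /l2; elim: (ls) => //= c s IH _.
  rewrite /mk; case E : (grp c) => [|h t] /=.
    by apply: leq_trans (IH _) _ => //; rewrite leq_addl.
  apply: leq_add; last exact: IH.
  case: eqP => //= <-; have [_] := qnS c h ltac:(by rewrite E mem_head).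
  by rewrite lk_sym' => ->.
have uniqU : uniq U.
  have := reps_uniq; have : {subset reps <= reps} by [].
  rewrite /U; elim: {1 3 4}(reps) => // x s IH sub; rewrite cons_uniq => /andP[xs us].
  change (uniq (it x ++ flatten [seq it z | z <- s])).
  have [[_ _ _ ux] _] := spP x (repsP (sub x (mem_head _ _))).
  rewrite cat_uniq; apply/and3P; split; first exact: ux.
    apply/hasPn => v /flatten_mapP[y ys vy]; apply: contra xs => vx.
    rewrite (same x y v v) //; first exact: sub (mem_head _ _).
    by apply: sub; rewrite inE ys orbT.
  by apply: IH => // z zs; apply: sub; rewrite inE zs orbT.
have uniqG : uniq (flatten [seq grp b | b <- ls]).
  have : uniq ls by apply: seq.filter_uniq; exact: enum_uniq.
  elim: (ls) => //= b s IH /andP[bs us].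
  rewrite cat_uniq enum_uniq IH // andbT /=.
  apply/hasPn => v /flatten_mapP[c cs]; rewrite grpP => /and3P[/eqP vc _ _].
  by apply: contra bs; rewrite grpP => /and3P[/eqP <- _ _]; rewrite vc.
have memG v : (v \in flatten [seq grp b | b <- ls]) =
    [&& cell v \notin S, v \notin U & ~~ fv v].
  apply/flatten_mapP/idP => [[b]|/and3P[vS vU nf]].
    by rewrite lsP grpP => bS /and3P[/eqP vb -> ->]; rewrite vb bS.
  by exists (cell v); rewrite ?lsP // grpP eqxx vU.
have S0 : S != finset.set0.
  have /card_gt0P[v _] : (0 < #|V|)%N by apply: leq_trans conn2.1.
  by have [c cS _] := S_dense (cell v); apply/finset.set0Pn; exists c.
apply: (@hamiltonian_absorption V B e lab e_sym lk S D _ _ _ _ _ _ _ (l1 ++ l2)) => //.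
- by move=> b; rewrite /lk link_refl.
- move=> u v a b /labP[_ ua _] /labP[_ vb _] ab uv; apply: link_e => //.
  by rewrite ua vb.
- move=> b /core_b; apply: leq_trans.
  by rewrite ltnS addn2 ltnS (leq_trans (leq_pmull D _) (leqnSn _)).
- by move=> v b /labP[].
- move=> b bS; rewrite count_cat; have := count1 b; have := count2 b; have := core_b b bS.
  move=> h h2 h1; apply: leq_trans (ltnW h).
  apply: (@leq_trans (1 + D + D)); first by rewrite leq_add2r leq_add.
  by rewrite add1n addSn addnn -mul2n addn2 leqnSn.
- move=> i; rewrite mem_cat => /orP[/mapP[x xr ->]|/il2[b [bS -> gb]]].
    by have [[]] := spP x (repsP xr).
  by have [] := qnS b i.2.1 ltac:(by rewrite gb mem_head).
- move=> i; rewrite mem_cat => /orP[/mapP[x xr ->]|/il2[b [bS -> gb]]].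
    have [[_ _ px _] [_ _ adj _]] := spP x (repsP xr); split=> // v /labP[vU vq _].
    by apply: adj => //; apply: contra vU => vx; apply/memU; exists x.
  have gm u : u \in i.2.1 :: i.2.2 -> cell u = b.
    by rewrite -gb grpP => /and3P[/eqP].
  have ug : uniq (i.2.1 :: i.2.2) by rewrite -gb enum_uniq.
  have [_ bq] := qnS b i.2.1 ltac:(by rewrite gb mem_head).
  split.
    apply: clique_path => // u v /gm ub /gm vb uv; apply: link_e => //.
    by rewrite ub vb /lk link_refl.
  move=> v /labP[_ vq vS].
  have vn u : u \in i.2.1 :: i.2.2 -> e v u.
    move=> /gm ub; apply: link_e; last by rewrite vq ub lk_sym'.
    by apply: contraNneq bS => vu; rewrite -ub -vu vq.
  by rewrite !vn ?mem_head ?mem_last.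
- rewrite map_cat flatten_cat flat1 flat2 cat_uniq uniqU uniqG andbT /=.
  by apply/hasPn => v; rewrite memG => /and3P[].
- move=> v; rewrite map_cat flatten_cat flat1 flat2 mem_cat memG /lab.
  case: ifP => //= vU; case: ifP => //= vS; apply: contraFT vU; rewrite negbK => fx.
  apply/memU; exists (rep v); first exact: rep_reps.
  have [_ [sub _ _ _]] := spP (rep v) (repsP (rep_reps fx)); apply: sub.
  by rewrite (F_eq fx (rep_in fx)) F_refl.
Qed.

End Board.

(** * Reflection across the sides of the square *)

Section Fold.
Local Open Scope Z_scope.
#[local] Arguments Z.mul : simpl never.
#[local] Arguments Z.add : simpl never.
#[local] Arguments Z.sub : simpl never.

(** A triangle wave of period [2 * m]. The mirrors lie between cells, so the cells -1 and 0 both go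
    to 0. *)
Definition fold (m i : Z) : Z :=
  if i mod (2 * m) <? m then i mod (2 * m) else 2 * m - 1 - i mod (2 * m).

Lemma fold_bound (m i : Z) : 0 < m -> 0 <= fold m i < m.
Proof.
by move=> m0; have := Z.mod_pos_bound i (2 * m); rewrite /fold; case: Z.ltb_spec; lia.
Qed.

Lemma fold_id (m i : Z) : 0 <= i < m -> fold m i = i.
Proof. by move=> hi; rewrite /fold Z.mod_small; [case: Z.ltb_spec; lia | lia]. Qed.

Lemma foldE (m q t : Z) : 0 <= t < 2 * m ->
  fold m (2 * m * q + t) = if t <? m then t else 2 * m - 1 - t.
Proof.
by move=> ht; rewrite /fold; have <- // := Z.mod_unique_pos (2 * m * q + t) (2 * m) q t ht.
Qed.

(** The copy of the square that contains [i] is a translate or a mirror image of the original, and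
    the map undoing this is a symmetry of the whole tiling. *)
Lemma fold_reflection (m i : Z) : 0 < m -> exists s t,
  [/\ s = 1 \/ s = -1, s * i + t = fold m i & forall j, fold m (s * j + t) = fold m j].
Proof.
move=> m0; have m20 : 2 * m <> 0 by lia.
have di j := Z.div_mod j (2 * m) m20.
have bi j : 0 <= j mod (2 * m) < 2 * m by apply: Z.mod_pos_bound; lia.
pose q := i / (2 * m).
have [h|h] := Z.lt_ge_cases (i mod (2 * m)) m.
  exists 1, (- (2 * m * q)); split; first by left.
    by rewrite {2}(di i) foldE //; case: Z.ltb_spec => ?; rewrite /q; have := di i; lia.
  move=> j; have -> : 1 * j + - (2 * m * q) = 2 * m * (j / (2 * m) - q) + j mod (2 * m).
    by have := di j; lia.
  by rewrite foldE // [in RHS](di j) foldE.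
exists (-1), (2 * m * q + 2 * m - 1); split; first by right.
  by rewrite {2}(di i) foldE //; case: Z.ltb_spec => ?; rewrite /q; have := di i; lia.
move=> j; have -> : -1 * j + (2 * m * q + 2 * m - 1)
    = 2 * m * (q - j / (2 * m)) + (2 * m - 1 - j mod (2 * m)) by have := di j; lia.
rewrite foldE; last by have := bi j; lia.
rewrite [in RHS](di j) foldE //.
by case: Z.ltb_spec => ?; case: Z.ltb_spec => ?; lia.
Qed.

Lemma fold_contraction (m i j : Z) : 0 < m -> Z.abs (fold m i - fold m j) <= Z.abs (i - j).
Proof.
move=> m0.
have step k : Z.abs (fold m (k + 1) - fold m k) <= 1.
  have dk := Z.div_mod k (2 * m) ltac:(lia).
  have bk := Z.mod_pos_bound k (2 * m) ltac:(lia).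
  have [h|h] := Z.lt_ge_cases (k mod (2 * m) + 1) (2 * m).
    have -> : k + 1 = 2 * m * (k / (2 * m)) + (k mod (2 * m) + 1) by lia.
    rewrite foldE; last lia.
    by rewrite /fold; case: Z.ltb_spec => ?; case: Z.ltb_spec => ?; lia.
  have -> : k + 1 = 2 * m * (k / (2 * m) + 1) + 0 by lia.
  rewrite foldE; last lia.
  by rewrite /fold; case: Z.ltb_spec => ?; case: Z.ltb_spec => ?; lia.
have up (n : nat) k : Z.abs (fold m (k + Z.of_nat n) - fold m k) <= Z.of_nat n.
  elim: n => [|n IH]; first by rewrite Z.add_0_r; lia.
  have := step (k + Z.of_nat n).
  have -> : k + Z.of_nat n.+1 = k + Z.of_nat n + 1 by lia.
  by lia.
have [h|h] := Z.le_gt_cases i j.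
  have := up (Z.to_nat (j - i)) i; rewrite Z2Nat.id; last lia.
  have -> : i + (j - i) = j by lia.
  by lia.
have := up (Z.to_nat (i - j)) j; rewrite Z2Nat.id; last lia.
have -> : j + (i - j) = i by lia.
by lia.
Qed.

Lemma link_contraction (a b a' b' : Z * Z) :
  Z.abs (a'.1 - b'.1) <= Z.abs (a.1 - b.1) ->
  Z.abs (a'.2 - b'.2) <= Z.abs (a.2 - b.2) -> link a b -> link a' b'.
Proof. by move=> h1 h2 /linkP h; apply/linkP; nia. Qed.

Section Corner.
Variable m' : nat.
Let m : Z := Z.of_nat m'.+1.

Definition corner (b : 'I_m'.+1 * 'I_m'.+1) : Z * Z :=
  (Z.of_nat b.1, Z.of_nat b.2).

Definition fold_cell (z : Z * Z) : 'I_m'.+1 * 'I_m'.+1 :=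
  (inord (Z.to_nat (fold m z.1)), inord (Z.to_nat (fold m z.2))).

Lemma m_gt0 : 0 < m. Proof. by rewrite /m; lia. Qed.

Lemma corner_fold (z : Z * Z) : corner (fold_cell z) = (fold m z.1, fold m z.2).
Proof.
have h i : Z.of_nat (inord (Z.to_nat (fold m i)) : 'I_m'.+1) = fold m i.
  have [h0 h1] := fold_bound i m_gt0; have hm : m = Z.of_nat m'.+1 by [].
  move: (fold m i) h0 h1 => k h0 h1; rewrite inordK; first by rewrite Z2Nat.id.
  by apply/ssrnat.ltP; lia.
by rewrite /corner /= !h.
Qed.

Lemma fold_corner (b : 'I_m'.+1 * 'I_m'.+1) : fold_cell (corner b) = b.
Proof.
case: b => i j; rewrite /fold_cell /corner /=.
have h (k : 'I_m'.+1) : inord (Z.to_nat (fold m (Z.of_nat k))) = k.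
  by rewrite fold_id ?Nat2Z.id ?inord_val //; have := ltn_ord k; rewrite /m; lia.
by rewrite !h.
Qed.

Lemma near_fold (D : Z) (z w : Z * Z) :
  near D z w -> near D (corner (fold_cell z)) (corner (fold_cell w)).
Proof.
rewrite !corner_fold => -[h1 h2]; split=> /=.
  by have := @fold_contraction m z.1 w.1 m_gt0; lia.
by have := @fold_contraction m z.2 w.2 m_gt0; lia.
Qed.

Lemma link_fold (z w : Z * Z) :
  link z w -> link (corner (fold_cell z)) (corner (fold_cell w)).
Proof.
by rewrite !corner_fold; apply: link_contraction => /=; apply: fold_contraction; exact: m_gt0.
Qed.

Lemma fold_cell_shoot (z : Z * Z) : exists c e1 e2, [/\ e1 = 1 \/ e1 = -1,
  e2 = 1 \/ e2 = -1, shoot c e1 e2 z = corner (fold_cell z)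
  & forall w, fold_cell (shoot c e1 e2 w) = fold_cell w].
Proof.
have [s1 [t1 [h1 f1 g1]]] := fold_reflection z.1 m_gt0.
have [s2 [t2 [h2 f2 g2]]] := fold_reflection z.2 m_gt0.
exists (t1, t2), s1, s2; split=> //.
  by rewrite corner_fold /shoot /= -f1 -f2 ![_ + s1 * _]Z.add_comm ![_ + s2 * _]Z.add_comm.
by move=> w; rewrite /fold_cell /shoot /= !(Z.add_comm t1) !(Z.add_comm t2) g1 g2.
Qed.

End Corner.

(** The bound is independent of the board: a link extends at most 48 in each direction, hence stays
    in a square of side 97. *)
Lemma link_degree : exists D : nat, forall (m' : nat) (b : 'I_m'.+1 * 'I_m'.+1),
  (#|[set c : 'I_m'.+1 * 'I_m'.+1 | link (corner b) (corner c)]%SET| <= D)%N.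
Proof.
exists #|{: 'I_97 * 'I_97}| => m' b.
pose f (c : 'I_m'.+1 * 'I_m'.+1) : 'I_97 * 'I_97 :=
  (inord (c.1 + 48 - b.1), inord (c.2 + 48 - b.2)).
rewrite -(@card_in_imset _ _ f); first exact: max_card.
move=> c c'; rewrite !inE => /link_near[/= h1 h2] /link_near[/= k1 k2] [].
move=> /(congr1 val) /=; rewrite !inordK; try lia.
move=> q1 /(congr1 val) /=; rewrite !inordK; try lia.
move=> q2; case: c c' h1 h2 k1 k2 q1 q2 => [i j] [i' j'] /= h1 h2 k1 k2 q1 q2.
by congr (_, _); apply: val_inj => /=; lia.
Qed.

Section FoldHamiltonian.
Variables (m' : nat) (V : finType) (e : rel V) (cell : V -> 'I_m'.+1 * 'I_m'.+1).
Variables (D M : nat).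

Let full (z : Z * Z) : bool := (M <= #|[set v | cell v == fold_cell m' z]%SET|)%N.
Let S : {set 'I_m'.+1 * 'I_m'.+1} := [set b | `[< sea full (corner b) >]]%SET.

Hypothesis reg : regular full.

Lemma mem_sea (b : 'I_m'.+1 * 'I_m'.+1) : reflect (sea full (corner b)) (b \in S).
Proof. by rewrite inE; exact: asboolP. Qed.

(** The isometry carrying [z] to the board preserves [full], hence the sea. *)
Lemma sea_fold (z : Z * Z) : sea full z -> fold_cell m' z \in S.
Proof.
have [c [e1 [e2 [h1 h2 zE hf]]]] := fold_cell_shoot m' z.
by move=> sz; apply/mem_sea; rewrite -zE; apply: sea_shoot => // w; rewrite /full hf.
Qed.

Lemma conn_path (P : Z * Z -> Prop) (Q : 'I_m'.+1 * 'I_m'.+1 -> Prop) (z w : Z * Z) :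
  (forall u, P u -> Q (fold_cell m' u)) -> P z -> sea full z -> conn full P z w ->
  exists p, [/\ path (fun b c => link (corner b) (corner c)) (fold_cell m' z) p,
    last (fold_cell m' z) p = fold_cell m' w &
    forall b, b \in fold_cell m' z :: p -> b \in S /\ Q b].
Proof.
move=> PQ Pz sz zw; have := conn_sea reg sz zw.
elim: zw => [_|u v zu IH fv Pv luv sv].
  exists [::]; split=> // b; rewrite inE => /eqP ->.
  by split; [exact: sea_fold | exact: PQ].
have [p [pp lp pS]] := IH (conn_sea reg sz zu).
exists (rcons p (fold_cell m' v)); split.
- by rewrite rcons_path pp lp link_fold.
- by rewrite last_rcons.
- move=> b; rewrite -rcons_cons mem_rcons inE => /orP[/eqP ->|/pS //].
  by split; [exact: sea_fold | exact: PQ].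
Qed.

(** A sea cell anywhere in the plane that is linked to [b] folds to a sea cell of the board still
    linked to [b]. *)
Lemma no_sea_far (b : 'I_m'.+1 * 'I_m'.+1) :
  {in S, forall c, ~~ link (corner b) (corner c)} -> far full (corner b).
Proof.
move=> no; apply: far_of_no_sea => // w bw sw.
have := no _ (sea_fold sw); rewrite -{1}(fold_corner b).
by rewrite link_fold.
Qed.

Hypothesis e_sym : symmetric e.
Hypothesis link_e : forall u v, u != v -> link (corner (cell u)) (corner (cell v)) ->
  e u v.
Hypothesis lk_deg : forall b : 'I_m'.+1 * 'I_m'.+1,
  (#|[set c : 'I_m'.+1 * 'I_m'.+1 | link (corner b) (corner c)]%SET| <= D)%N.
Hypothesis M_big : (2 * D + 5 < M)%N.
Hypothesis e_local :
  (forall u v, e u v -> near 2000 (corner (cell u)) (corner (cell v))) \/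
  (forall u v, u != v -> near 1400 (corner (cell u)) (corner (cell v)) -> e u v).
Hypothesis conn2 : k_connected 2 e.

Lemma fold_hamiltonian : hamiltonian e.
Proof.
apply: (@board_hamiltonian V _ e cell (@corner m') S D) => //.
- move=> b /mem_sea[+ _]; rewrite /full fold_corner; exact: leq_trans.
- by move=> b b' /no_sea_far fb /no_sea_far fb'; exact: (far_pair reg fb fb').
- move=> b b' /mem_sea sb /mem_sea sb' bb'.
  have := @conn_path (near 20000 (corner b)) (fun c => near 20000 (corner b) (corner c))
    _ _ _ _ sb (sea_conn_near reg sb sb' bb').
  rewrite !fold_corner; apply.
    by move=> u /(near_fold m'); rewrite fold_corner.
  by split; lia.
- move=> b; have [z sz bz] := exists_sea reg (corner b).
  exists (fold_cell m' z); first exact: sea_fold.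
  by have := near_fold m' bz; rewrite fold_corner.
- move=> J /finset.set0Pn[a aI] /fintype.properP[IS [b bS bI]].
  have /mem_sea sa := fintype.subsetP IS _ aI; have /mem_sea sb := bS.
  have [p []] := @conn_path (fun=> True) (fun=> True) _ _ (fun _ => id) I sa
    (sea_conn reg sa sb).
  rewrite !fold_corner; elim: p a aI {IS sa} => [|c p IH] a aI /=.
    by move=> _ ab; rewrite -ab aI in bI.
  move=> /andP[ac pp] lp pS; have [cI|cI] := boolP (c \in J).
    by apply: (IH c) => // d dp; apply: pS; rewrite inE dp orbT.
  exists a, c; split=> //; rewrite finset.in_setD cI.
  by have [] := pS c ltac:(by rewrite !inE eqxx orbT).
Qed.
End FoldHamiltonian.
End Fold.

(** * Gilbert graphs on a grid *)

Section Geometry.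
Variable R : realType.

Lemma euclidean_dist_le (x y : R * R) (r : R) : 0 <= r ->
  (euclidean_dist x y <= r) = ((x.1 - y.1) ^+ 2 + (x.2 - y.2) ^+ 2 <= r ^+ 2).
Proof.
by move=> r0; rewrite -(ler_sqrt _ (sqr_ge0 r)) sqrtr_sqr ger0_norm.
Qed.

Lemma euclidean_dist_sym (x y : R * R) : euclidean_dist x y = euclidean_dist y x.
Proof. by rewrite /euclidean_dist -[_ ^+ 2]sqrrN opprB -[(x.2 - _) ^+ 2]sqrrN opprB. Qed.

Lemma gilbert_sym (A : {fset R * R}) (r : R) : symmetric (gilbert A r).
Proof. by move=> x y; rewrite /gilbert /= eq_sym euclidean_dist_sym. Qed.

Lemma npoints_card (A : {fset R * R}) (B : set (R * R)) (P : pred A) :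
  (forall v : A, P v = (val v \in B)) -> #|P| = npoints A B.
Proof.
move=> PB; rewrite /npoints -card_finset.
have -> : [fset x in A | x \in B]%fset = [fset val x | x in [fset x in P]]%fset.
  apply/fsetP => x; rewrite !inE; apply/andP/imfsetP => [[xA xB]|[v /= + ->]].
    by exists [` xA]%fset; rewrite //= !inE -[_ \in P]/(P _) PB.
  by rewrite !inE -[_ \in P]/(P v) PB => vB; split; [exact: fsvalP | exact: set_mem].
by apply/esym/eqP/card_in_imfsetP => u v _ _; exact: val_inj.
Qed.

Section Grid.
Variables (m' : nat) (s : R).
Hypothesis s_gt0 : 0 < s.

(** The minimum puts the upper end of the closed interval into the last cell. *)
Definition grid (x : R) : 'I_m'.+1 := inord (minn m' (Num.truncn (x / s))).

Lemma gridE (x : R) : grid x = minn m' (Num.truncn (x / s)) :> nat.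
Proof. by rewrite /grid inordK // ltnS geq_minl. Qed.

Lemma grid_bounds (x : R) : 0 <= x <= m'.+1%:R * s ->
  (grid x)%:R * s <= x <= (grid x).+1%:R * s.
Proof.
move=> /andP[x0 xm]; have xs0 : 0 <= x / s by rewrite divr_ge0 // ltW.
have /andP[lo hi] := truncn_itv xs0.
rewrite gridE /minn; case: ltnP => h.
  rewrite xm andbT -ler_pdivlMr //; apply: le_trans lo.
  by rewrite ler_nat ltnW.
by apply/andP; split; [rewrite -ler_pdivlMr | rewrite -ler_pdivrMr // ltW].
Qed.

Lemma grid_close (x y : R) (k : nat) :
  0 <= x <= m'.+1%:R * s -> 0 <= y <= m'.+1%:R * s ->
  Z.le (Z.abs (Z.sub (Z.of_nat (grid x)) (Z.of_nat (grid y)))) (Z.of_nat k) ->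
  `|x - y| <= k.+1%:R * s.
Proof.
move=> /grid_bounds hx /grid_bounds hy.
move: (nat_of_ord (grid x)) (nat_of_ord (grid y)) hx hy => i j /andP[x1 x2] /andP[y1 y2] h.
have ij : (i <= j + k)%N by lia.
have ji : (j <= i + k)%N by lia.
have : i%:R * s <= (j + k)%:R * s by rewrite ler_wpM2r ?ler_nat // ltW.
have : j%:R * s <= (i + k)%:R * s by rewrite ler_wpM2r ?ler_nat // ltW.
rewrite !natrD !mulrDl => h1 h2.
move: x2 y2; rewrite -!natr1 !mulrDl !mul1r => x2 y2.
by rewrite ler_norml; apply/andP; split; lra.
Qed.

Lemma grid_apart (x y : R) (k : nat) :
  0 <= x <= m'.+1%:R * s -> 0 <= y <= m'.+1%:R * s ->
  Z.lt (Z.of_nat k) (Z.abs (Z.sub (Z.of_nat (grid x)) (Z.of_nat (grid y)))) ->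
  k%:R * s <= `|x - y|.
Proof.
move=> /grid_bounds hx /grid_bounds hy.
move: (nat_of_ord (grid x)) (nat_of_ord (grid y)) hx hy => i j /andP[x1 x2] /andP[y1 y2] h.
have [ij|ji] : (j + k.+1 <= i)%N \/ (i + k.+1 <= j)%N by lia.
  have : (j + k.+1)%:R * s <= i%:R * s by rewrite ler_wpM2r ?ler_nat // ltW.
  rewrite natrD -natr1 !mulrDl mul1r => h1.
  move: y2; rewrite -natr1 mulrDl mul1r => y2.
  by rewrite ler_normr; apply/orP; left; lra.
have : (i + k.+1)%:R * s <= j%:R * s by rewrite ler_wpM2r ?ler_nat // ltW.
rewrite natrD -natr1 !mulrDl mul1r => h1.
move: x2; rewrite -natr1 mulrDl mul1r => x2.
by rewrite ler_normr; apply/orP; right; lra.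
Qed.

Definition grid_cell (x : R * R) : 'I_m'.+1 * 'I_m'.+1 := (grid x.1, grid x.2).

Definition cell_set (b : 'I_m'.+1 * 'I_m'.+1) : set (R * R) :=
  [set x | square (m'.+1%:R * s) x /\ grid_cell x = b].

Lemma squareP (a : R) (x : R * R) :
  square a x -> 0 <= x.1 <= a /\ 0 <= x.2 <= a.
Proof. by move=> []; rewrite /= !in_itv. Qed.

Lemma dist_close (x y : R * R) (k1 k2 c : nat) :
  square (m'.+1%:R * s) x -> square (m'.+1%:R * s) y ->
  Z.le (Z.abs (Z.sub (Z.of_nat (grid x.1)) (Z.of_nat (grid y.1)))) (Z.of_nat k1) ->
  Z.le (Z.abs (Z.sub (Z.of_nat (grid x.2)) (Z.of_nat (grid y.2)))) (Z.of_nat k2) ->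
  ((k1.+1)%:R ^+ 2 + (k2.+1)%:R ^+ 2 <= c%:R ^+ 2 :> R) ->
  euclidean_dist x y <= c%:R * s.
Proof.
move=> /squareP[x1 x2] /squareP[y1 y2] h1 h2 hc.
have := grid_close x1 y1 h1; have := grid_close x2 y2 h2 => d2 d1.
have cs0 : 0 <= c%:R * s by rewrite mulr_ge0 // ltW.
rewrite euclidean_dist_le // exprMn.
have sq (u : R) (k : nat) : `|u| <= k.+1%:R * s -> u ^+ 2 <= k.+1%:R ^+ 2 * s ^+ 2.
  by move=> h; rewrite -exprMn -[u ^+ 2]real_normK ?num_real // lerXn2r // ?nnegrE ?mulr_ge0 // ltW.
apply: (le_trans (lerD (sq _ _ d1) (sq _ _ d2))).
by rewrite -mulrDl ler_wpM2r // sqr_ge0.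
Qed.

Lemma dist_link (x y : R * R) :
  square (m'.+1%:R * s) x -> square (m'.+1%:R * s) y ->
  link (corner (grid_cell x)) (corner (grid_cell y)) -> euclidean_dist x y <= 50%:R * s.
Proof.
move=> sx sy /linkP /= l.
apply: (@dist_close x y (Z.to_nat (Z.abs (Z.sub (Z.of_nat (grid x.1)) (Z.of_nat (grid y.1)))))
  (Z.to_nat (Z.abs (Z.sub (Z.of_nat (grid x.2)) (Z.of_nat (grid y.2))))) 50 sx sy).
- by lia.
- by lia.
- by rewrite -!natrX -natrD ler_nat; nia.
Qed.

Lemma dist_near (x y : R * R) :
  square (m'.+1%:R * s) x -> square (m'.+1%:R * s) y ->
  near 1400 (corner (grid_cell x)) (corner (grid_cell y)) ->
  euclidean_dist x y <= 1990%:R * s.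
Proof.
move=> sx sy [/= n1 n2].
by apply: (@dist_close x y 1400 1400 1990 sx sy); [lia | lia | lra].
Qed.

Lemma near_dist (x y : R * R) :
  square (m'.+1%:R * s) x -> square (m'.+1%:R * s) y ->
  euclidean_dist x y <= 1990%:R * s ->
  near 2000 (corner (grid_cell x)) (corner (grid_cell y)).
Proof.
have cs0 (c : nat) : 0 <= c%:R * s by rewrite mulr_ge0 // ltW.
move=> /squareP[x1 x2] /squareP[y1 y2]; rewrite euclidean_dist_le //.
move=> d; have gap (u v : R) : 0 <= u <= m'.+1%:R * s -> 0 <= v <= m'.+1%:R * s ->
    (u - v) ^+ 2 <= (1990%:R * s) ^+ 2 ->
    Z.le (Z.abs (Z.sub (Z.of_nat (grid u)) (Z.of_nat (grid v)))) (Z.of_nat 2000).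
  move=> hu hv le; apply/Z.nlt_ge => lt; have := grid_apart hu hv (k := 2000) lt.
  move=> far; have : (2000%:R * s) ^+ 2 <= (1990%:R * s) ^+ 2.
    apply: le_trans le; rewrite -[(u - v) ^+ 2]real_normK ?num_real //.
    by rewrite lerXn2r // nnegrE.
  rewrite ler_pXn2r ?nnegrE //.
  by rewrite ler_pM2r // ler_nat.
split=> /=; apply: gap => //.
- by apply: le_trans d; rewrite lerDl sqr_ge0.
- by apply: le_trans d; rewrite lerDr sqr_ge0.
Qed.

Lemma gilbert_hamiltonian (A : {fset R * R}) (r : R) (D M : nat) :
  [set` A] `<=` square (m'.+1%:R * s) -> 50%:R * s <= r ->
  (forall b : 'I_m'.+1 * 'I_m'.+1,
    (#|[set c : 'I_m'.+1 * 'I_m'.+1 | link (corner b) (corner c)]%SET| <= D)%N) ->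
  (2 * D + 5 < M)%N ->
  regular (fun z => (M <= npoints A (cell_set (fold_cell m' z)))%N) ->
  k_connected 2 (gilbert A r) -> hamiltonian (gilbert A r).
Proof.
move=> AS rs lkD MD reg conn2.
have inS (u : A) : square (m'.+1%:R * s) (val u) by apply: AS; exact: (valP u).
apply: (@fold_hamiltonian m' A (gilbert A r) (fun u => grid_cell (val u)) D M) => //.
- rewrite (_ : (fun z => _) = fun z => (M <= npoints A (cell_set (fold_cell m' z)))%N) //.
  apply/funext => z; congr (_ <= _)%N; rewrite finset.cardsE; apply: npoints_card => v.
  rewrite -[LHS]/(grid_cell (val v) == fold_cell m' z).
  apply/idP/idP => [/eqP gv|]; first by apply: mem_set; split; [exact: inS | exact: gv].
  by rewrite inE => -[_ ->].
- exact: gilbert_sym.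
- by move=> u v uv /dist_link l; rewrite /gilbert /= uv (le_trans _ rs) // l.
(* 1990 lies between [1401 * sqrt 2] and 2000: cells within 1400 have all their points within
   [1990 s], and points within [1990 s] have cells within 2000. *)
- have [small|large] := ltP r (1990%:R * s); [left|right].
    move=> u v /andP[_ d]; apply: near_dist => //.
    by rewrite (le_trans d) // ltW.
  move=> u v uv n; rewrite /gilbert /= uv (le_trans _ large) //.
  exact: (dist_near (inS u) (inS v) n).
Qed.
End Grid.
End Geometry.

(** * Irregular configurations *)

Section FiniteProbability.
Context d (Omega : measurableType d) (R : realType) (P : probability Omega R).

Definition pr (E : set Omega) : R := fine (P E).

Lemma prE (E : set Omega) : measurable E -> P E = (pr E)%:E.
Proof. by move=> mE; rewrite /pr fineK // fin_num_measure. Qed.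

Lemma pr_le (E F : set Omega) : measurable E -> measurable F -> E `<=` F -> pr E <= pr F.
Proof. by move=> mE mF EF; rewrite -lee_fin -!prE // le_measure ?inE. Qed.

Lemma prT : pr setT = 1.
Proof. by rewrite /pr probability_setT. Qed.

Lemma pr0 : pr set0 = 0.
Proof. by rewrite /pr measure0. Qed.

Lemma pr_setC (E : set Omega) : measurable E -> pr (~` E) = 1 - pr E.
Proof.
by move=> mE; apply: EFin_inj; rewrite -prE ?probability_setC ?prE //; exact: measurableC.
Qed.

Lemma prU_le (E F : set Omega) : measurable E -> measurable F ->
  pr (E `|` F) <= pr E + pr F.
Proof.
move=> mE mF; rewrite -lee_fin EFinD -!prE ?measureU2 //; exact: measurableU.
Qed.

Lemma prU (E F : set Omega) : measurable E -> measurable F -> E `&` F = set0 ->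
  pr (E `|` F) = pr E + pr F.
Proof.
move=> mE mF EF; apply: EFin_inj; rewrite EFinD -!prE ?measureU //.
exact: measurableU.
Qed.

Lemma pr_bigcup_le (I : eqType) (r : seq I) (F : I -> set Omega) :
  (forall i, i \in r -> measurable (F i)) ->
  measurable [set w | exists2 i, i \in r & F i w] /\
  pr [set w | exists2 i, i \in r & F i w] <= \sum_(i <- r) pr (F i).
Proof.
elim: r => [|i r IH] mF.
  rewrite big_nil (_ : [set w | _] = set0) ?pr0; first by split.
  by apply/seteqP; split=> // w [].
have [|mr le] := IH; first by move=> j jr; apply: mF; rewrite inE jr orbT.
have mi : measurable (F i) by apply: mF; rewrite mem_head.
rewrite (_ : [set w | _] = F i `|` [set w | exists2 j, j \in r & F j w]).
  split; first exact: measurableU.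
  by rewrite big_cons (le_trans (prU_le mi mr)) // lerD2l.
apply/seteqP; split=> w /=.
  by case=> j; rewrite inE => /orP[/eqP ->|jr] Fj; [left | right; exists j].
by case=> [Fi|[j jr Fj]]; [exists i; rewrite ?mem_head | exists j; rewrite // inE jr orbT].
Qed.

(* Independence of a finite family passes to complements; [G] carries the events
   not yet complemented. *)
Lemma pr_compl_indep (I : finType) (E : I -> set Omega) (p : I -> R) :
  (forall i, measurable (E i)) ->
  (forall J : {set I}, pr [set w | forall i, i \in J -> E i w] = \prod_(i in J) p i) ->
  pr [set w | forall i, ~ E i w] = \prod_(i : I) (1 - p i).
Proof.
move=> mE ind.
have mJ (J : {set I}) : measurable [set w | forall i, i \in J -> E i w].
  rewrite (_ : [set w | _] = \bigcap_(i in [set i | i \in J]) E i) //.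
  by apply: fin_bigcap_measurable => // i _; exact: mE.
have gen (s : seq I) (J : {set I}) : uniq s -> (forall i, i \in s -> i \notin J) ->
    let G := [set w | (forall i, i \in J -> E i w) /\ (forall i, i \in s -> ~ E i w)] in
    measurable G /\ pr G = \prod_(i in J) p i * \prod_(i <- s) (1 - p i).
  elim: s J => [|i s IH] J /= us sJ.
    rewrite big_nil mulr1 -ind (_ : [set w | _] = [set w | forall i, i \in J -> E i w]).
      by split.
    by apply/seteqP; split=> w /= => [[]|h].
  have /andP[nis us'] := us.
  have iJ : i \notin J by apply: sJ; rewrite mem_head.
  have [|m1 p1] := IH J us'; first by move=> j js; apply: sJ; rewrite inE js orbT.
  have [|m2 p2] := IH (i |: J)%SET us'.
    move=> j js; rewrite !inE negb_or sJ ?inE ?js ?orbT // andbT.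
    by apply: contraNneq nis => <-.
  set G1 := [set w | _] in m1 p1; set G2 := [set w | _] in m2 p2.
  set G := [set w | _].
  have G1E : G1 = G `|` G2.
    apply/seteqP; split=> w.
      move=> [wJ ws]; have [Ei|nEi] := pselect (E i w).
        by right; split=> // j; rewrite !inE => /orP[/eqP ->//|]; exact: wJ.
      by left; split=> // j; rewrite inE => /orP[/eqP ->//|]; exact: ws.
    move=> [[wJ ws]|[wJ ws]]; split=> //.
    - by move=> j js; apply: ws; rewrite inE js orbT.
    - by move=> j jJ; apply: wJ; rewrite !inE jJ orbT.
  have GG2 : G `&` G2 = set0.
    apply/seteqP; split=> // w [[_ ws] [wJ _]]; apply: (ws i); rewrite ?mem_head //.
    by apply: wJ; rewrite !inE eqxx.
  have GE : G = G1 `\` G2.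
    rewrite G1E; apply/seteqP; split=> w.
      by move=> Gw; split; [left | move=> G2w; have : (G `&` G2) w by []; rewrite GG2].
    by case=> -[].
  have mG : measurable G by rewrite GE; exact: measurableD.
  split=> //; have := prU mG m2 GG2; rewrite -G1E p1 p2 big_cons.
  rewrite (@finset.big_setU1 _ _ _ _ i J) //= => h.
  by apply: (@addIr _ (p i * \prod_(i in J) p i * \prod_(j <- s) (1 - p j))); rewrite -h; ring.
have [| |_] := gen (enum I) finset.set0; first exact: enum_uniq.
  by move=> i _; rewrite inE.
rewrite big_pred0; last by move=> i; rewrite inE.
rewrite mul1r big_enum => <-; congr pr; apply/seteqP; split=> w /=.
  by move=> h; split=> i; rewrite ?inE.
by move=> [_ h] i; apply: h; rewrite mem_enum.
Qed.
End FiniteProbability.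

(** * Poisson counts of the cells *)

Section CellMeasure.
Variables (R : realType) (m' : nat) (s : R).
Hypothesis s_gt0 : 0 < s.

Let side (i : 'I_m'.+1) : interval R :=
  Interval (BLeft (i%:R * s)) (BSide (i < m')%N (i.+1%:R * s)).

Lemma grid_itv (x : R) (i : 'I_m'.+1) :
  (0 <= x <= m'.+1%:R * s /\ grid m' s x = i) <-> x \in side i.
Proof.
have i_le : (i <= m')%N by rewrite -ltnS.
rewrite in_itv /=; split.
  move=> [hx gi]; apply/andP; have := grid_bounds s_gt0 hx; rewrite gi => /andP[-> hi]; split=> //.
  have [im|im] := ltnP i m'; rewrite /= ?hi //.
  have x0 : 0 <= x / s by rewrite divr_ge0 ?(ltW s_gt0) //; case/andP: hx.
  rewrite -ltr_pdivrMr // -truncn_le_nat.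
  have := gridE m' s x; rewrite gi /minn.
  by case: ltnP => h ieq; [rewrite ieq ltnn in im | rewrite ieq].
move=> /andP[lo hi].
have x0 : 0 <= x by apply: le_trans lo; rewrite mulr_ge0 // ltW.
have xm : x <= m'.+1%:R * s.
  have h : x <= i.+1%:R * s by move: hi; case: (i < m')%N => //= /ltW.
  by rewrite (le_trans h) // ler_wpM2r ?ler_nat // ltW.
split; first by rewrite x0.
apply: val_inj; rewrite /= gridE.
have xs0 : 0 <= x / s by rewrite divr_ge0 // ltW.
move: lo hi; rewrite -ler_pdivlMr // -truncn_ge_nat //.
have [im|im] := ltnP i m'; rewrite /= => lo.
  rewrite -ltr_pdivrMr // -truncn_le_nat => hi.
  have -> : Num.truncn (x / s) = i by apply/eqP; rewrite eqn_leq hi lo.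
  by rewrite /minn ltnNge i_le.
move=> _; have im' : i = m' :> nat by apply/eqP; rewrite eqn_leq i_le im.
by rewrite im' in lo *; apply/minn_idPl.
Qed.

Lemma cell_setE (b : 'I_m'.+1 * 'I_m'.+1) :
  cell_set s b = [set` side b.1] `*` [set` side b.2].
Proof.
apply/seteqP; split=> x /=.
  move=> [/squareP[x1 x2] <-]; split=> /=; apply/grid_itv; by split.
move=> [/grid_itv[x1 g1] /grid_itv[x2 g2]]; split.
  by split=> /=; rewrite in_itv.
by case: b g1 g2 => i j /= <- <-.
Qed.

Lemma measurable_cell_set (b : 'I_m'.+1 * 'I_m'.+1) : measurable (cell_set s b).
Proof. by rewrite cell_setE; apply: measurableX; exact: measurable_itv. Qed.

Lemma cell_set_square (b : 'I_m'.+1 * 'I_m'.+1) : cell_set s b `<=` square (m'.+1%:R * s).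
Proof. by move=> x []. Qed.

Lemma area_cell_set (b : 'I_m'.+1 * 'I_m'.+1) : area (cell_set s b) = (s ^+ 2)%:E.
Proof.
have len i : lebesgue_measure [set` side i] = s%:E.
  rewrite lebesgue_measure_itv /= lte_fin ltr_pM2r // ltr_nat ltnSn -EFinD.
  by rewrite -mulrBl -natrB // subSnn mul1r.
rewrite cell_setE /area product_measure1E; try exact: measurable_itv.
transitivity (s%:E * s%:E)%E; first by congr (_ * _)%E; exact: len.
by rewrite -EFinM -expr2.
Qed.

Lemma cell_set_disjoint (b c : 'I_m'.+1 * 'I_m'.+1) : b != c ->
  cell_set s b `&` cell_set s c = set0.
Proof.
move=> bc; apply/seteqP; split=> // x [[_ xb] [_ xc]].
by rewrite -xb -xc eqxx in bc.
Qed.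
End CellMeasure.

Section CellCounts.
Context (R : realType) d (Omega : measurableType d) (P : probability Omega R).
Variables (m' : nat) (s : R) (X : Omega -> {fset R * R}).
Hypothesis s_gt0 : 0 < s.
Hypothesis hX : poisson_process P 1 (square (m'.+1%:R * s)) X.

Let count_in (b : 'I_m'.+1 * 'I_m'.+1) (w : Omega) : nat := npoints (X w) (cell_set s b).
Let w_ (k : nat) : R := poisson_weight (s ^+ 2) k.

Lemma poisson_weight_ge0 (lam : R) (k : nat) : 0 <= lam -> 0 <= poisson_weight lam k.
Proof. by move=> l0; rewrite /poisson_weight divr_ge0 ?mulr_ge0 ?expR_ge0 ?exprn_ge0. Qed.

Lemma measurable_count (b : 'I_m'.+1 * 'I_m'.+1) (k : nat) :
  measurable [set w | count_in b w = k].
Proof.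
case: hX => _ mX _ _; apply: mX; first exact: measurable_cell_set.
exact: cell_set_square.
Qed.

Lemma pr_counts (n : nat) (c : 'I_n -> 'I_m'.+1 * 'I_m'.+1) (k : 'I_n -> nat) :
  injective c ->
  measurable [set w | forall i, count_in (c i) w = k i] /\
  pr P [set w | forall i, count_in (c i) w = k i] = \prod_(i < n) w_ (k i).
Proof.
move=> c_inj; have [_ _ law ind] := hX.
split.
  rewrite (_ : [set w | _] = \bigcap_(i in [set: 'I_n]) [set w | count_in (c i) w = k i]).
    by apply: fin_bigcap_measurable => // i _; exact: measurable_count.
  by apply/seteqP; split=> w /= h i; [move=> _; exact: h | exact: h].
rewrite /pr (ind n (fun i => cell_set s (c i)) k).
- rewrite (eq_bigr (fun i => (w_ (k i))%:E)); first by rewrite prodEFin.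
  move=> i _; rewrite law ?area_cell_set // ?mul1r //; first exact: measurable_cell_set.
  exact: cell_set_square.
- by move=> i; split; [exact: measurable_cell_set | exact: cell_set_square].
- apply/trivIsetP => i j _ _ ij; apply: cell_set_disjoint.
  by apply: contra ij => /eqP/c_inj ->.
Qed.

Lemma pr_counts_set (Z : {set 'I_m'.+1 * 'I_m'.+1}) (k : 'I_m'.+1 * 'I_m'.+1 -> nat) :
  measurable [set w | forall b, b \in Z -> count_in b w = k b] /\
  pr P [set w | forall b, b \in Z -> count_in b w = k b] = \prod_(b in Z) w_ (k b).
Proof.
rewrite big_enum_val /= (_ : [set w | _] =
    [set w | forall i : 'I_#|Z|, count_in (enum_val i) w = k (enum_val i)]).
  exact: (@pr_counts _ (fun i => enum_val i) (fun i => k (enum_val i)) enum_val_inj).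
apply/seteqP; split=> w /= h.
  by move=> i; apply: h; exact: enum_valP.
by move=> b bZ; rewrite -(enum_rankK_in bZ bZ).
Qed.

(** A union bound over all vectors of counts below [M]; by independence the sum of their
    probabilities factors over the cells. *)
Lemma pr_few (Z : {set 'I_m'.+1 * 'I_m'.+1}) (M : nat) :
  measurable [set w | forall b, b \in Z -> (count_in b w < M)%N] /\
  pr P [set w | forall b, b \in Z -> (count_in b w < M)%N]
    <= (\sum_(k < M) w_ k) ^+ #|Z|.
Proof.
pose c (i : 'I_#|Z|) := enum_val i.
pose F (k : {ffun 'I_#|Z| -> 'I_M}) := [set w | forall i, count_in (c i) w = k i].
have FP (k : {ffun 'I_#|Z| -> 'I_M}) :=
  @pr_counts _ c (fun i => k i : nat) enum_val_inj.
have [mU leU] := @pr_bigcup_le _ _ _ P _ (index_enum _) F (fun k _ => (FP k).1).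
have -> : [set w | forall b, b \in Z -> (count_in b w < M)%N]
    = [set w | exists2 k, k \in index_enum _ & F k w].
  apply/seteqP; split=> w /=.
    move=> h; have hM i : (count_in (c i) w < M)%N by apply: h; exact: enum_valP.
    exists [ffun i => Ordinal (hM i)]; first by rewrite mem_index_enum.
    by move=> i; rewrite ffunE.
  move=> [k _ Fk] b bZ; rewrite -(enum_rankK_in bZ bZ) Fk.
  exact: ltn_ord.
split=> //; apply: le_trans leU _.
rewrite (eq_bigr (fun k : {ffun 'I_#|Z| -> 'I_M} => \prod_(i < #|Z|) w_ (k i))); last first.
  by move=> k _; exact: (FP k).2.
by rewrite -(bigA_distr_bigA (fun=> fun k : 'I_M => w_ k)) /= prodr_const card_ord.
Qed.
End CellCounts.

(** * Irregular windows, seen on one copy of the square *)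

Section Irregular.
Local Open Scope Z_scope.
#[local] Arguments Z.mul : simpl never.
#[local] Arguments Z.add : simpl never.
#[local] Arguments Z.sub : simpl never.

Definition edge (m k : Z) : bool := (k <? 101000) || (m - 101000 <=? k).

Lemma fold_tile (m i : Z) : 0 < m ->
  fold m i = i mod m \/ fold m i = m - 1 - i mod m.
Proof.
move=> m0; rewrite (_ : fold m i = fold m (m * (i / m) + i mod m)); last first.
  by congr fold; have := Z.div_mod i m; lia.
have := Z.mod_pos_bound i m m0; move: (i / m) (i mod m) => q t ht.
have [[u ->]|[u ->]] := Z.Even_or_Odd q.
  rewrite (_ : m * (2 * u) + t = 2 * m * u + t); last lia.
  by rewrite foldE; [case: Z.ltb_spec; lia | lia].
rewrite (_ : m * (2 * u + 1) + t = 2 * m * u + (m + t)); last lia.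
by rewrite foldE; [case: Z.ltb_spec; lia | lia].
Qed.

Lemma fold_inj_tile (m i j : Z) : 0 < m -> i / m = j / m -> fold m i = fold m j -> i = j.
Proof.
move=> m0 ij.
have E k : fold m k = fold m (m * (k / m) + k mod m).
  by congr fold; have := Z.div_mod k m; lia.
rewrite (E i) (E j) -ij => h.
have := Z.div_mod i m; have := Z.div_mod j m; rewrite -ij.
have := Z.mod_pos_bound i m m0; have := Z.mod_pos_bound j m m0.
move: h; move: (i / m) (i mod m) (j mod m) => q t u + hu ht.
have [[v ->]|[v ->]] := Z.Even_or_Odd q.
  rewrite !(_ : forall x, m * (2 * v) + x = 2 * m * v + x); try lia.
  by rewrite !foldE; try lia; case: Z.ltb_spec; case: Z.ltb_spec; lia.
have e x : m * (2 * v + 1) + x = 2 * m * v + (m + x) by lia.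
by rewrite !e !foldE; try lia; case: Z.ltb_spec; case: Z.ltb_spec; lia.
Qed.

Lemma tile_edge (m i j : Z) : 0 < m -> i / m <> j / m -> Z.abs (i - j) < 101000 ->
  edge m (fold m i).
Proof.
move=> m0 ij near_ij; rewrite /edge; apply/orP.
have := Z.mod_pos_bound i m m0; have := Z.mod_pos_bound j m m0 => hj hi.
have di := Z.div_mod i m ltac:(lia); have dj := Z.div_mod j m ltac:(lia).
have side : i mod m < 101000 \/ m - 101000 <= i mod m.
  have [lt|gt] : i / m + 1 <= j / m \/ j / m + 1 <= i / m by lia.
    by right; nia.
  by left; nia.
have [-> | ->] := fold_tile i m0.
  by case: side => h; [left; apply/Z.ltb_lt | right; apply/Z.leb_le]; lia.
by case: side => h; [right; apply/Z.leb_le | left; apply/Z.ltb_lt]; lia.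
Qed.

(* A window meets up to four reflected copies of the square, but in each direction only
   one of them unless it is close to a side. Hence, of 9140 = 4 * 2285 cells that are not
   full, one copy contains all, half or a quarter. *)
Definition edge_weight (m k : Z) : nat := if edge m k then 1%N else 2%N.

(** As [101000 <= m], the window meets at most two copies in this direction. If one of them holds
    all of [L], then [c = 2]. Otherwise a copy with at least [k] cells is kept and [c = 1]: all its
    cells are near the common border. *)
Lemma tile_split (f : Z * Z -> Z) (m o : Z) (L : seq (Z * Z)) (k : nat) :
  101000 <= m -> uniq L -> (forall z, z \in L -> o <= f z < o + 101000) ->
  (2 * k <= size L)%N ->
  exists L' (c : nat), [/\ uniq L', {subset L' <= L},
    forall z z', z \in L' -> z' \in L' -> f z / m = f z' / m,
    (c * k <= size L')%N & (0 < c)%N /\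
    forall z, z \in L' -> (edge_weight m (fold m (f z)) <= c)%N].
Proof.
move=> hm uL inL szL.
pose p z := f z / m =? o / m.
have dm i := Z.div_mod i m ltac:(lia).
have bm i := Z.mod_pos_bound i m ltac:(lia).
have tile z : z \in L -> ~~ p z -> f z / m = o / m + 1.
  rewrite /p => /inL zL; case: Z.eqb_spec => // h _.
  by have := dm o; have := dm (f z); have := bm o; have := bm (f z); nia.
have w2 z : (edge_weight m (fold m (f z)) <= 2)%N by rewrite /edge_weight; case: edge.
pose La := seq.filter p L; pose Lb := seq.filter (predC p) L.
have sizeLab : (size La + size Lb = size L)%N by rewrite !size_filter count_predC.
have LaP z : z \in La -> z \in L /\ f z / m = o / m.
  by rewrite mem_filter => /andP[/Z.eqb_spec].
have LbP z : z \in Lb -> z \in L /\ f z / m = o / m + 1.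
  by rewrite mem_filter => /andP[/= pz zL]; split=> //; exact: tile.
have sameA z z' : z \in La -> z' \in La -> f z / m = f z' / m.
  by move=> /LaP[_ ->] /LaP[_ ->].
have sameB z z' : z \in Lb -> z' \in Lb -> f z / m = f z' / m.
  by move=> /LbP[_ ->] /LbP[_ ->].
have uA : uniq La by exact: seq.filter_uniq.
have uB : uniq Lb by exact: seq.filter_uniq.
have [A0|[a aA]] : La = [::] \/ exists a, a \in La.
- by case: (La) => [|a l]; [left | right; exists a; rewrite mem_head].
- exists Lb, 2%N; split=> //; first by move=> z /LbP[].
  by move: sizeLab; rewrite A0 /= add0n => ->.
have [B0|[b bB]] : Lb = [::] \/ exists b, b \in Lb.
- by case: (Lb) => [|b l]; [left | right; exists b; rewrite mem_head].
- exists La, 2%N; split=> //; first by move=> z /LaP[].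
  by move: sizeLab; rewrite B0 /= addn0 => ->.
have edge1 z z' : z \in L -> z' \in L -> f z / m <> f z' / m ->
    (edge_weight m (fold m (f z)) <= 1)%N.
  move=> /inL hz /inL hz' ne.
  by rewrite /edge_weight (@tile_edge m (f z) (f z')) //; lia.
have [aL qa] := LaP _ aA; have [bL qb] := LbP _ bB.
have [hA|hA] := leqP k (size La).
  exists La, 1%N; split=> //; rewrite ?mul1n //; first by move=> z /LaP[].
  split=> // z /LaP[zL qz]; by apply: (edge1 z b) => //; lia.
exists Lb, 1%N; split=> //; first by move=> z /LbP[].
  rewrite mul1n -(leq_add2l k) addnn -mul2n (leq_trans szL) //.
  by rewrite -sizeLab leq_add2r ltnW.
split=> // z /LbP[zL qz]; by apply: (edge1 z a) => //; lia.
Qed.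

Lemma window_near (org z w : Z * Z) :
  org.1 <= z.1 < org.1 + 101000 /\ org.2 <= z.2 < org.2 + 101000 ->
  org.1 <= w.1 < org.1 + 101000 /\ org.2 <= w.2 < org.2 + 101000 ->
  near 101000 z w.
Proof. by move=> [? ?] [? ?]; split; lia. Qed.

(** After [tile_split] in both coordinates the remaining cells lie in a single copy of the square,
    where folding is injective, so their images are distinct. *)
Lemma irregular_bad (m' : nat) (few : 'I_m'.+1 * 'I_m'.+1 -> bool) :
  101000 <= Z.of_nat m'.+1 -> ~ regular (fun z => ~~ few (fold_cell m' z)) ->
  exists (c0 : 'I_m'.+1 * 'I_m'.+1) (A : {set 'I_m'.+1 * 'I_m'.+1}),
  [/\ forall b, b \in A -> near 101000 (corner c0) (corner b),
      forall b, b \in A -> few b &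
      (edge_weight (Z.of_nat m'.+1) (Z.of_nat c0.1)
       * (edge_weight (Z.of_nat m'.+1) (Z.of_nat c0.2) * Z.to_nat 2285) <= #|A|)%N].
Proof.
move=> hm; set m := Z.of_nat m'.+1 => nreg.
have [org [L [uL inL nf sL]]] : exists (o : Z * Z) (L : seq (Z * Z)), [/\ uniq L,
    forall z, z \in L -> o.1 <= z.1 < o.1 + 101000 /\ o.2 <= z.2 < o.2 + 101000,
    forall z, z \in L -> few (fold_cell m' z) & 9140 <= Z.of_nat (size L)].
  apply: contrapT => no; apply: nreg => o L uL inL nf.
  apply/Z.nle_gt => sL; apply: no; exists o, L; split=> // z /nf.
  by rewrite negbK.
have [| |L1 [c1 [u1 s1 t1 k1 [c1_gt0 w1]]]] :=
    @tile_split (fun z => z.1) m org.1 L (2 * Z.to_nat 2285)%N hm uL.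
- by move=> z /inL[].
- by lia.
have [| |L2 [c2 [u2 s2 t2 k2 [c2_gt0 w2]]]] :=
    @tile_split (fun z => z.2) m org.2 L1 (c1 * Z.to_nat 2285)%N hm u1.
- by move=> z /s1/inL[].
- by rewrite mulnCA.
have m_gt0 : 0 < m by lia.
have [z0 z0L] : exists z : Z * Z, z \in L2.
  case: (L2) k2 => [|z l] h; last by exists z; rewrite mem_head.
  by move: h; rewrite /= leqn0 !muln_eq0 !eqn0Ngt c1_gt0 c2_gt0.
have foldK : {in L2 &, injective (fold_cell m')}.
  move=> z w zL wL /(congr1 (@corner m')); rewrite !corner_fold => -[h1 h2].
  have e1 := fold_inj_tile m_gt0 (t1 _ _ (s2 _ zL) (s2 _ wL)) h1.
  have e2 := fold_inj_tile m_gt0 (t2 _ _ zL wL) h2.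
  by rewrite (surjective_pairing z) (surjective_pairing w) e1 e2.
exists (fold_cell m' z0), [set b in [seq fold_cell m' z | z <- L2]]%SET.
have cornerE := corner_fold m' z0.
split.
- move=> b; rewrite inE => /mapP[z zL ->]; apply: near_fold.
  exact: (window_near (inL z0 (s1 _ (s2 _ z0L))) (inL z (s1 _ (s2 _ zL)))).
- by move=> b; rewrite inE => /mapP[z /s2/s1/nf fz ->].
- rewrite finset.cardsE (card_uniqP _) ?map_inj_in_uniq // size_map.
  have -> : Z.of_nat (fold_cell m' z0).1 = fold m z0.1 by move: cornerE => -[].
  have -> : Z.of_nat (fold_cell m' z0).2 = fold m z0.2 by move: cornerE => -[].
  apply: leq_trans k2; rewrite [leqRHS]mulnCA.
  exact: (leq_mul (w1 _ (s2 _ z0L)) (leq_mul (w2 _ z0L) (leqnn _))).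
Qed.
End Irregular.

Lemma near_degree (D : Z) : exists W : nat, forall (m' : nat) (b : 'I_m'.+1 * 'I_m'.+1),
  (#|[set c : 'I_m'.+1 * 'I_m'.+1 | `[< near D (corner b) (corner c) >] ]%SET| <= W)%N.
Proof.
pose K := Z.to_nat (2 * D + 1)%Z.
exists #|{: 'I_K.+1 * 'I_K.+1}| => m' b.
pose g (i j : 'I_m'.+1) : 'I_K.+1 := inord (Z.to_nat (Z.sub (Z.add (Z.of_nat i) D) (Z.of_nat j))).
have g_inj (j i i' : 'I_m'.+1) :
    Z.le (Z.abs (Z.sub (Z.of_nat j) (Z.of_nat i))) D ->
    Z.le (Z.abs (Z.sub (Z.of_nat j) (Z.of_nat i'))) D -> g i j = g i' j -> i = i'.
  move=> h h' /(congr1 val); rewrite /g /= !inordK ?ltnS; try by rewrite /K; lia.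
  by move=> e; apply: val_inj; rewrite /=; lia.
rewrite -(@card_in_imset _ _ (fun c => (g c.1 b.1, g c.2 b.2))); first exact: max_card.
move=> c c'; rewrite !inE => -[h1 h2] [k1 k2] e.
have e1 := congr1 fst e; have e2 := congr1 snd e.
have := g_inj _ _ _ h1 k1 e1; have := g_inj _ _ _ h2 k2 e2.
by case: (c) (c') => [? ?] [? ?] /= -> ->.
Qed.

Lemma edge_card : exists K : nat, forall m' : nat,
  (#|[set i : 'I_m'.+1 | edge (Z.of_nat m'.+1) (Z.of_nat i)]%SET| <= K)%N.
Proof.
pose T := Z.to_nat 101000; exists #|{: bool * 'I_T.+1}| => m'.
pose f (i : 'I_m'.+1) : bool * 'I_T.+1 :=
  ((i < T)%N, inord (if (i < T)%N then i : nat else (m' - i)%N)).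
rewrite -(@card_in_imset _ _ f); first exact: max_card.
have edgeP (i : 'I_m'.+1) : edge (Z.of_nat m'.+1) (Z.of_nat i) -> (T <= i)%N ->
    (m' - i < T.+1)%N.
  rewrite /edge /T => /orP[/Z.ltb_lt|/Z.leb_le]; lia.
move=> i j; rewrite !inE => /edgeP ei /edgeP ej [e1 /(congr1 val)].
apply: contra_eq => /= ij.
have := ltn_ord i; have := ltn_ord j; rewrite -e1.
case: ltnP e1 => iT /esym; [move=> jT | move/negbT; rewrite -leqNgt => jT] => hj hi.
  by rewrite !inordK // ltnS ltnW.
rewrite !inordK ?ei ?ej //; apply: contra ij => /eqP e.
by apply/eqP/val_inj => /=; lia.
Qed.

Section Bad.
Local Open Scope set_scope.
Context (R : realType) d (Omega : measurableType d) (P : probability Omega R).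
Variables (m' : nat) (s : R) (X : Omega -> {fset R * R}) (M : nat).
Hypothesis s_gt0 : 0 < s.
Hypothesis hX : poisson_process P 1 (square (m'.+1%:R * s)) X.
Hypothesis hm : Z.le 101000 (Z.of_nat m'.+1).

Let q : R := \sum_(k < M) poisson_weight (s ^+ 2) k.
Let few (w : Omega) (b : 'I_m'.+1 * 'I_m'.+1) : bool :=
  (npoints (X w) (cell_set s b) < M)%N.
Let N' : nat := Z.to_nat 2285.
Let eb (i : 'I_m'.+1) : bool := edge (Z.of_nat m'.+1) (Z.of_nat i).
Let th (c : 'I_m'.+1 * 'I_m'.+1) : nat :=
  (edge_weight (Z.of_nat m'.+1) (Z.of_nat c.1) *
   (edge_weight (Z.of_nat m'.+1) (Z.of_nat c.2) * N'))%N.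

Hypothesis q_le1 : q <= 1.

Let q_ge0 : 0 <= q.
Proof. by apply: sumr_ge0 => k _; apply: poisson_weight_ge0; rewrite sqr_ge0. Qed.

(** Inner positions have exponent [4 * N'], those at one side [2 * N'], those at a corner [N'].
    Adding the terms, instead of distinguishing cases, lets each be summed over the board
    separately. *)
Lemma pow_th (c : 'I_m'.+1 * 'I_m'.+1) : q ^+ th c <=
  q ^+ (4 * N') + (if eb c.1 then q ^+ (2 * N') else 0)
  + (if eb c.2 then q ^+ (2 * N') else 0) + (if eb c.1 && eb c.2 then q ^+ N' else 0).
Proof.
rewrite /th /edge_weight -/(eb c.1) -/(eb c.2).
have h n : 0 <= q ^+ n by exact: exprn_ge0.
have hif (x : bool) n : 0 <= if x then q ^+ n else 0 by case: x.
case: (eb c.1) (eb c.2) => -[] /=.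
- by rewrite !mul1n lerDr !addr_ge0.
- by rewrite mul1n addr0 addr0 lerDr.
- by rewrite mul1n addr0 addr0 lerDr.
- by rewrite !addr0 mulnA.
Qed.

(** A union bound over a position and a subset of the ball around it, at most [2 ^ W] subsets for
    each. With [m = m'.+1] there are [m ^ 2] positions, at most [2 * K * m] of them at sides and
    [K ^ 2] at corners. As the inner exponent is twice that of a side, it suffices to control
    [m * q ^ (2 * N')] and [q ^ N']. *)
Lemma pr_bad (W K : nat) :
  (forall b : 'I_m'.+1 * 'I_m'.+1, (#|[set c : 'I_m'.+1 * 'I_m'.+1 |
     `[< near 101000 (corner b) (corner c) >] ]%SET| <= W)%N) ->
  (#|[set i : 'I_m'.+1 | eb i]%SET| <= K)%N ->
  exists Bad : set Omega, [/\ measurable Bad,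
    forall w, ~ regular (fun z => (M <= npoints (X w) (cell_set s (fold_cell m' z)))%N) ->
      Bad w &
    pr P Bad <= (2 ^ W)%:R * ((m'.+1%:R * q ^+ (2 * N')) ^+ 2
      + 2%:R * K%:R * (m'.+1%:R * q ^+ (2 * N')) + K%:R ^+ 2 * q ^+ N')].
Proof.
move=> ballW edgeK.
pose board : finType := ('I_m'.+1 * 'I_m'.+1)%type.
pose ball (b : board) : {set board} := [set c | `[< near 101000 (corner b) (corner c) >] ].
pose ok (i : board * {set board}) := (i.2 \subset ball i.1) && (th i.1 <= #|i.2|)%N.
pose F (i : board * {set board}) := [set w | forall b, b \in i.2 -> few w b]%classic.
have FP (i : board * {set board}) := @pr_few R d Omega P m' s X s_gt0 hX i.2 M.
have [mB leB] := @pr_bigcup_le _ _ _ P _ [seq i <- index_enum _ | ok i] F (fun i _ => (FP i).1).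
eexists; split; first exact: mB.
  move=> w; rewrite (_ : (fun z => _) = fun z => ~~ few w (fold_cell m' z)); last first.
    by apply/funext => z; rewrite /few -leqNgt.
  move=> /(irregular_bad hm)[c0 [A [nearA fewA bigA]]].
  exists (c0, A) => //; rewrite mem_filter mem_index_enum andbT /ok /= bigA andbT.
  by apply/fintype.subsetP => b bA; rewrite !finset.in_set; apply/asboolP; exact: nearA.
apply: le_trans leB _; rewrite big_filter.
apply: (@le_trans _ _ (\sum_(i : board * {set board} | ok i) q ^+ th i.1)).
  apply: ler_sum => i /andP[_ hi]; apply: le_trans (FP i).2 _.
  exact: ler_wiXn2l.
rewrite (eq_bigl (fun i : board * {set board} => ok (i.1, i.2))); last by case.
rewrite -(pair_big_dep xpredT (fun c A => ok (c, A)) (fun c A => q ^+ th c)) /=.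
apply: (@le_trans _ _ (\sum_(c : board) (2 ^ W)%:R * q ^+ th c)).
  apply: ler_sum => c _; rewrite sumr_const -[leLHS]mulr_natl ler_wpM2r ?exprn_ge0 //.
  rewrite ler_nat; apply: (@leq_trans #|powerset (ball c)|).
    by apply: subset_leq_card; apply/fintype.subsetP => A; rewrite inE => /andP[].
  by rewrite finset.card_powerset leq_exp2l //; exact: ballW.
rewrite -mulr_sumr ler_wpM2l //.
apply: le_trans (ler_sum _ (fun c _ => pow_th c)) _.
have sum4 (f1 f2 f3 f4 : board -> R) : \sum_c (f1 c + f2 c + f3 c + f4 c)
    = \sum_c f1 c + \sum_c f2 c + \sum_c f3 c + \sum_c f4 c by rewrite !big_split.
have sum_if (p : pred board) (x : R) : \sum_c (if p c then x else 0) = x *+ #|p|.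
  by rewrite -big_mkcond sumr_const.
rewrite sum4 sumr_const.
rewrite (sum_if [pred c | eb c.1]) (sum_if [pred c | eb c.2]).
rewrite (sum_if [pred c | eb c.1 && eb c.2]).
have cT : #|[set: 'I_m'.+1]%SET| = m'.+1 by rewrite finset.cardsT card_ord.
have c1 : (#|[pred c : board | eb c.1]| <= K * m'.+1)%N.
  rewrite -[X in (_ <= _ * X)%N]cT.
  apply: leq_trans (leq_mul edgeK (leqnn _)); rewrite -finset.cardsX.
  by apply: subset_leq_card; apply/fintype.subsetP => -[i j]; rewrite !inE /= => ->.
have c2 : (#|[pred c : board | eb c.2]| <= m'.+1 * K)%N.
  rewrite -[X in (_ <= X * _)%N]cT.
  apply: leq_trans (leq_mul (leqnn _) edgeK); rewrite -finset.cardsX.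
  by apply: subset_leq_card; apply/fintype.subsetP => -[i j]; rewrite !inE /= => ->.
have c3 : (#|[pred c : board | eb c.1 && eb c.2]| <= K * K)%N.
  apply: leq_trans (leq_mul edgeK edgeK); rewrite -finset.cardsX.
  by apply: subset_leq_card; apply/fintype.subsetP => -[i j]; rewrite !inE.
have c0 : #|board| = (m'.+1 * m'.+1)%N by rewrite card_prod !card_ord.
have up (x : R) (a b : nat) : 0 <= x -> (a <= b)%N -> x *+ a <= b%:R * x.
  by move=> x0 ab; rewrite -[leLHS]mulr_natl ler_wpM2r // ler_nat.
have h n : 0 <= q ^+ n by exact: exprn_ge0.
have u0 := up _ _ _ (h (4 * N')%N) (eq_leq c0).
have u1 := up _ _ _ (h (2 * N')%N) c1; have u2 := up _ _ _ (h (2 * N')%N) c2.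
have u3 := up _ _ _ (h N') c3.
apply: le_trans (lerD (lerD (lerD u0 u1) u2) u3) _.
rewrite !natrM (_ : (4 * N' = 2 * N' + 2 * N')%N); last by rewrite -mulnDl.
rewrite exprD le_eqVlt; apply/orP; left; apply/eqP; ring.
Qed.
End Bad.

(** * Isolated points *)

Section Isolated.
Local Open Scope Z_scope.
#[local] Arguments Z.mul : simpl never.
#[local] Arguments Z.add : simpl never.
#[local] Arguments Z.sub : simpl never.

(* Holds if some point of the cell [p] is closer than 50 to some point of the cell [(0, 0)]. *)
Definition reach (p : Z * Z) : bool :=
  Z.max (Z.abs p.1 - 1) 0 ^ 2 + Z.max (Z.abs p.2 - 1) 0 ^ 2 <? 2500.

Lemma reachP (p : Z * Z) : reflect (Z.max (Z.abs p.1 - 1) 0 * Z.max (Z.abs p.1 - 1) 0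
  + Z.max (Z.abs p.2 - 1) 0 * Z.max (Z.abs p.2 - 1) 0 < 2500) (reach p).
Proof. by rewrite /reach !Z.pow_2_r; exact: Z.ltb_spec0. Qed.

Lemma reach_near (p : Z * Z) : reach p -> Z.abs p.1 <= 51 /\ Z.abs p.2 <= 51.
Proof. by move/reachP => h; split; nia. Qed.

Lemma reach_list : exists L : seq (Z * Z), Z.of_nat (size L) <= 8253 /\
  forall p : Z * Z, reach p -> p \in L.
Proof.
exists [seq p <- zrect (-51) 103 (-51) 103 | reach p]; split.
  by apply/Z.leb_le; vm_compute.
move=> [i j] rp; rewrite mem_filter rp andTb.
have [/= h1 h2] := reach_near rp.
have mem k : Z.abs k <= 51 -> k \in zrange (-51) 103.
  move=> hk; apply/mapP; exists (Z.to_nat (k + 51)); last lia.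
  by rewrite mem_iota; lia.
by apply/allpairsP; exists (i, j); split=> //; exact: mem.
Qed.

Variables (m' kap : nat).
Hypothesis kap_m : (103 * kap <= m'.+1)%N.

(** The spacing is [103 = 2 * 51 + 1], which makes the boxes of reach 51 disjoint. *)
Definition centre (u : 'I_kap * 'I_kap) : 'I_m'.+1 * 'I_m'.+1 :=
  (inord (103 * u.1 + 51), inord (103 * u.2 + 51)).

Definition box (u : 'I_kap * 'I_kap) : {set 'I_m'.+1 * 'I_m'.+1} :=
  [set b | reach ((corner b).1 - (corner (centre u)).1,
                 (corner b).2 - (corner (centre u)).2)]%SET.

Lemma corner_centre (u : 'I_kap * 'I_kap) :
  corner (centre u) = (103 * Z.of_nat u.1 + 51, 103 * Z.of_nat u.2 + 51).
Proof.
have h (i : 'I_kap) : Z.of_nat (inord (103 * i + 51) : 'I_m'.+1) = 103 * Z.of_nat i + 51.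
  by have hi := ltn_ord i; rewrite inordK; lia.
by rewrite /corner /centre /= !h.
Qed.

Lemma centre_box (u : 'I_kap * 'I_kap) : centre u \in box u.
Proof. by rewrite inE; apply/reachP => /=; lia. Qed.

Lemma box_disjoint (u v : 'I_kap * 'I_kap) : u != v -> [disjoint box u & box v]%B.
Proof.
move=> uv; rewrite -finset.setI_eq0; apply/eqP/finset.setP => b; rewrite !inE.
apply/negP => /andP[/reach_near[]]; rewrite !corner_centre /= => h1 h2 /reach_near[/= h3 h4].
case/eqP: uv; case: u v h1 h2 h3 h4 => [i j] [i' j'] /= h1 h2 h3 h4.
by congr (_, _); apply: val_inj => /=; lia.
Qed.

Lemma card_box (u : 'I_kap * 'I_kap) : Z.of_nat #|box u| <= 8253.
Proof.
have [L [sL LP]] := reach_list.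
suff : (#|box u| <= size L)%N by lia.
pose f (b : 'I_m'.+1 * 'I_m'.+1) : Z * Z := ((corner b).1 - (corner (centre u)).1,
                 (corner b).2 - (corner (centre u)).2).
rewrite cardE -(size_map f); apply: uniq_leq_size.
  rewrite map_inj_uniq ?enum_uniq // => -[i j] [i' j']; rewrite /f /corner /= => -[h1 h2].
  by congr (_, _); apply: val_inj => /=; lia.
by move=> p /mapP[b]; rewrite mem_enum inE => rb ->; exact: LP.
Qed.
End Isolated.

Lemma grid_apart_sqr (R : realType) (m' : nat) (s a b : R) (k : nat) : 0 < s ->
  0 <= a <= m'.+1%:R * s -> 0 <= b <= m'.+1%:R * s ->
  Z.of_nat k = Z.max (Z.sub (Z.abs (Z.sub (Z.of_nat (grid m' s b))
    (Z.of_nat (grid m' s a)))) 1) 0 ->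
  k%:R ^+ 2 * s ^+ 2 <= (a - b) ^+ 2.
Proof.
move=> s_gt0 ha hb; case: k => [|k] hk; first by rewrite expr0n mul0r sqr_ge0.
have gap : Z.lt (Z.of_nat k.+1)
    (Z.abs (Z.sub (Z.of_nat (grid m' s a)) (Z.of_nat (grid m' s b)))).
  by move: (nat_of_ord (grid m' s a)) (nat_of_ord (grid m' s b)) hk => i j; clear; lia.
rewrite -exprMn -[leRHS]real_normK ?num_real //.
apply: lerXn2r; rewrite ?nnegrE ?normr_ge0 //; first by rewrite mulr_ge0 // ltW.
exact: (grid_apart s_gt0 ha hb gap).
Qed.

Lemma sum_sqr_nat (k1 k2 : Z) : Z.le 0 k1 -> Z.le 0 k2 ->
  ~ Z.lt (Z.add (Z.mul k1 k1) (Z.mul k2 k2)) 2500 ->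
  (50 ^ 2 <= Z.to_nat k1 ^ 2 + Z.to_nat k2 ^ 2)%N.
Proof. by move=> h1 h2 h; nia. Qed.

Lemma reach_apart (R : realType) (m' : nat) (s : R) (x y : R * R) : 0 < s ->
  square (m'.+1%:R * s) x -> square (m'.+1%:R * s) y ->
  ~~ reach (Z.sub (corner (grid_cell m' s y)).1 (corner (grid_cell m' s x)).1,
           Z.sub (corner (grid_cell m' s y)).2 (corner (grid_cell m' s x)).2) ->
  50%:R * s <= euclidean_dist x y.
Proof.
move=> s_gt0 /squareP[x1 x2] /squareP[y1 y2].
have s50 : 0 <= 50%:R * s by rewrite mulr_ge0 // ltW.
rewrite -[leLHS]ger0_norm // -sqrtr_sqr => far; rewrite ler_wsqrtr // exprMn.
move: far => /reachP /=.
set k1 := Z.max _ _; set k2 := Z.max _ _ => reach_xy.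
have k10 : Z.le 0 k1 := Z.le_max_r _ _.
have k20 : Z.le 0 k2 := Z.le_max_r _ _.
have h1 := grid_apart_sqr s_gt0 x1 y1 (Z2Nat.id _ k10).
have h2 := grid_apart_sqr s_gt0 x2 y2 (Z2Nat.id _ k20).
apply: le_trans (lerD h1 h2); rewrite -mulrDl ler_wpM2r ?sqr_ge0 //.
rewrite -!natrX -natrD ler_nat.
exact: (sum_sqr_nat k10 k20 reach_xy).
Qed.

Section IsolatedProbability.
Context (R : realType) d (Omega : measurableType d) (P : probability Omega R).
Variables (m' kap : nat) (s : R) (X : Omega -> {fset R * R}).
Hypothesis s_gt0 : 0 < s.
Hypothesis hX : poisson_process P 1 (square (m'.+1%:R * s)) X.
Hypothesis kap_m : (103 * kap <= m'.+1)%N.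

Let count_in (b : 'I_m'.+1 * 'I_m'.+1) (w : Omega) : nat := npoints (X w) (cell_set s b).

Lemma isolated_disconnected (w : Omega) (u : 'I_kap * 'I_kap) (r : R) :
  (forall b, b \in box m' u -> count_in b w = (b == centre m' u)) ->
  r < 50%:R * s -> ~ k_connected 2 (gilbert (X w) r).
Proof.
move=> hE hr [V3 conn].
have XS (v : X w) : square (m'.+1%:R * s) (val v).
  by case: hX => XS _ _ _; apply: (XS w); exact: (valP v).
have countE b : count_in b w = #|[pred v : X w | grid_cell m' s (val v) == b]|.
  symmetry; apply: npoints_card => v /=; apply/idP/idP => [/eqP gv|].
    by apply: mem_set; split; [exact: XS | exact: gv].
  by rewrite inE => -[_ ->].
have /card_le1_eqP one : (#|[pred v : X w | grid_cell m' s (val v) == centre m' u]| <= 1)%N.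
  by rewrite -countE hE ?centre_box // eqxx.
have [x xc] : exists x : X w, grid_cell m' s (val x) = centre m' u.
  have : (0 < #|[pred v : X w | grid_cell m' s (val v) == centre m' u]|)%N.
    by rewrite -countE hE ?centre_box // eqxx.
  by case/card_gt0P => x /eqP xc; exists x.
have far (y : X w) : y != x -> 50%:R * s <= euclidean_dist (val x) (val y).
  move=> yx; have [yb|yb] := boolP (grid_cell m' s (val y) \in box m' u).
    have := hE _ yb; rewrite countE.
    have [yc|yc] := eqVneq (grid_cell m' s (val y)) (centre m' u).
      by case/eqP: yx; apply: one; rewrite inE /= ?yc ?xc.
    move=> /card0_eq/(_ y); by rewrite !inE eqxx.
  apply: (reach_apart s_gt0 (XS x) (XS y)).
  by move: yb; rewrite inE -xc.
have [y yx] : exists y, y != x.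
  have := leq_trans (isT : (1 < 3)%N) V3; case/card_gt1P => y [z [_ _ yz]].
  by have [yx|yx] := eqVneq y x; [exists z; rewrite -yx eq_sym | exists y].
(* Nothing needs to be deleted: a path from [x] to [y] would begin with an edge of length at least
   [50 s]. *)
have := conn finset.set0 ltac:(by rewrite cards0) x y ltac:(by rewrite inE) ltac:(by rewrite inE).
case/connectP => -[|z p] /=; first by move=> _ xy; rewrite xy eqxx in yx.
move=> /andP[/and3P[_ _ /andP[xz exz]] _] _.
have := far z ltac:(by rewrite eq_sym); rewrite leNgt => /negP; apply.
exact: le_lt_trans exz hr.
Qed.

(** One prescription of counts for all boxes together, so that the events of several boxes combine
    to a single event of the form treated in [pr_counts_set]. *)
Let kk (b : 'I_m'.+1 * 'I_m'.+1) : nat := [exists u : 'I_kap * 'I_kap, b == centre m' u].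
Let w_ (k : nat) : R := poisson_weight (s ^+ 2) k.
Let E (u : 'I_kap * 'I_kap) : set Omega :=
  [set w | forall b, b \in box m' u -> count_in b w = kk b].

Lemma kk_box (u : 'I_kap * 'I_kap) (b : 'I_m'.+1 * 'I_m'.+1) :
  b \in box m' u -> kk b = (b == centre m' u).
Proof.
move=> bu; congr nat_of_bool; apply/existsP/eqP => [[v /eqP bv]|->]; last by exists u.
have [-> //|uv] := eqVneq u v.
have := box_disjoint kap_m uv; rewrite -finset.setI_eq0 => /eqP/finset.setP/(_ b).
rewrite finset.in_setI finset.in_set0 bu andTb => /negbT/negP[].
by rewrite bv; exact: (centre_box kap_m v).
Qed.

Lemma box_weight (u : 'I_kap * 'I_kap) :
  s ^+ 2 * expR (- ((Z.to_nat 8253)%:R * s ^+ 2)) <= \prod_(b in box m' u) w_ (kk b).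
Proof.
have cu := centre_box kap_m u.
rewrite (bigD1 (centre m' u)) // (kk_box cu) eqxx.
rewrite (eq_bigr (fun=> expR (- s ^+ 2))); last first.
  move=> b /andP[bu bc]; rewrite (kk_box bu) (negPf bc).
  by rewrite /w_ /poisson_weight expr0 fact0 divr1 mulr1.
have w1 : w_ 1 = s ^+ 2 * expR (- s ^+ 2).
  by rewrite /w_ /poisson_weight expr1 factS fact0 muln1 divr1 mulrC.
rewrite prodr_const (w1 : w_ true = _) -[leRHS]mulrA -exprS.
rewrite ler_wpM2l ?sqr_ge0 // -mulrN expRM_natl.
apply: ler_wiXn2l; rewrite ?expR_ge0 //.
  by rewrite -expR0 ler_expR oppr_le0 sqr_ge0.
apply: (@leq_trans #|box m' u|).
  apply: proper_card; apply/fintype.properP; split.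
    by apply/fintype.subsetP => b; rewrite unfold_in => /andP[].
  by exists (centre m' u) => //; rewrite unfold_in eqxx andbF.
by have := @card_box m' kap kap_m u; move: #|_| => n; clear; lia.
Qed.

(** The boxes are disjoint, so the events [E u] are independent, and [1 - p <= exp (- p)] turns the
    product over the [kap ^ 2] boxes into an exponential. *)
Lemma pr_no_isolated : exists G : set Omega, [/\ measurable G,
  forall w r, ~ G w -> r < 50%:R * s -> ~ k_connected 2 (gilbert (X w) r) &
  pr P G <= expR (- ((kap ^ 2)%:R
    * (s ^+ 2 * expR (- ((Z.to_nat 8253)%:R * s ^+ 2))))) ].
Proof.
have EP (Z : {set 'I_m'.+1 * 'I_m'.+1}) := pr_counts_set s_gt0 hX Z kk.
have mE u : measurable (E u) := (EP (box m' u)).1.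
pose p (u : 'I_kap * 'I_kap) := \prod_(b in box m' u) w_ (kk b).
have ind (J : {set 'I_kap * 'I_kap}) :
    pr P [set w | forall u, u \in J -> E u w] = \prod_(u in J) p u.
  pose FJ (u : 'I_kap * 'I_kap) := if u \in J then box m' u else finset.set0.
  have -> : [set w | forall u, u \in J -> E u w] =
      [set w | forall b, b \in (\bigcup_u FJ u)%SET -> count_in b w = kk b].
    apply/seteqP; split=> w /= h.
      by move=> b /finset.bigcupP[u _]; rewrite /FJ; case: ifP => [uJ|]; [exact: h | rewrite inE].
    move=> u uJ b bu; apply: h; apply/finset.bigcupP; exists u => //.
    by rewrite /FJ uJ.
  rewrite (EP _).2 partition_disjoint_bigcup /=; last first.
    move=> u v uv; rewrite -finset.setI_eq0 /FJ.
    case: ifP; rewrite ?finset.set0I // => _; case: ifP; rewrite ?finset.setI0 // => _.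
    by rewrite finset.setI_eq0; exact: box_disjoint.
  rewrite [RHS]big_mkcond; apply: eq_bigr => u _; rewrite /FJ.
  by case: ifP => // _; rewrite big_pred0 // => b; rewrite inE.
exists [set w | forall u, ~ E u w]; split.
- rewrite (_ : [set w | _] = \bigcap_(u in setT) ~` E u).
    by apply: fin_bigcap_measurable => // u _; exact: measurableC.
  by apply/seteqP; split=> w h u; [move=> _; exact: h | exact: h].
- move=> w r /existsNP[u /contrapT Eu]; apply: (@isolated_disconnected w u).
  by move=> b bu; rewrite Eu // (kk_box bu).
- rewrite (pr_compl_indep mE ind).
  set p0 := s ^+ 2 * _.
  have p0P u : p0 <= p u by exact: box_weight.
  have pE u : p u = pr P (E u) by rewrite (EP _).2.
  have p_le1 u : p u <= 1 by rewrite pE -(prT P) pr_le.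
  apply: (@le_trans _ _ (\prod_(u : 'I_kap * 'I_kap) expR (- p0))).
    apply: ler_prod => u _; rewrite subr_ge0 p_le1 /=.
    by apply: le_trans (expR_ge1Dx _); rewrite lerD2l lerN2.
  by rewrite prodr_const card_prod !card_ord mulnn -expRM_natl mulrN.
Qed.
End IsolatedProbability.

(** * The two hitting radii *)

Section HamiltonianConnected.
Local Open Scope set_scope.
Local Open Scope nat_scope.

Lemma path_connect_off (T : finType) (e : rel T) (W : {set T}) (a : T) (p : seq T) :
  symmetric e -> path e a p -> (forall x, x \in a :: p -> x \notin W) ->
  forall x y, x \in a :: p -> y \in a :: p ->
  connect [rel u v | [&& u \notin W, v \notin W & e u v]] x y.
Proof.
move=> es pp nW.
set r := [rel u v | _].
have rs : connect_sym r.
  by apply: sym_connect_sym => u v; rewrite /r /= es andbCA.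
suff from_a x : x \in a :: p -> connect r a x.
  by move=> x y /from_a ax /from_a ay; apply: connect_trans ay; rewrite rs.
have pr : path r a p.
  elim: p a pp nW => //= b p IH a /andP[ab pp] nW.
  rewrite /r /= ab !nW ?inE ?eqxx ?orbT //=; apply: IH => // z zp.
  by apply: nW; rewrite inE zp orbT.
rewrite inE => /orP[/eqP -> //|].
move=> xp; case/splitPr: xp pr => p1 p2; rewrite cat_path => /andP[p1r /= /andP[lx _]].
by apply: (connect_trans _ (@connect1 _ r _ _ lx)); apply/connectP; exists p1.
Qed.

(** A cycle with one vertex deleted is a path through all the others. *)
Lemma hamiltonian_2connected (T : finType) (e : rel T) :
  symmetric e -> hamiltonian e -> k_connected 2 e.
Proof.
move=> es [c [/andP[cyc uc] sc memc]].
split.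
  by apply: leq_trans sc _; rewrite -(card_uniqP uc) max_card.
move=> W W2 x y xW yW.
have [W0|/finset.set0Pn[w wW]] := eqVneq W finset.set0.
  case: c cyc uc sc memc => // a p /=; rewrite rcons_path => /andP[pp _] _ _ memc.
  by apply: path_connect_off es pp _ _ _ (memc x) (memc y) => z _; rewrite W0 inE.
have W1 z : z \in W -> z = w.
  by move=> zW; apply: (card_le1_eqP (_ : #|W| <= 1)) => //; rewrite -ltnS.
have [i p' rc] := rot_to (memc w).
have memr z : (z \in w :: p') by rewrite -rc mem_rot memc.
have ur : uniq (w :: p') by rewrite -rc rot_uniq.
have : cycle e (w :: p') by rewrite -rc rot_cycle.
have ne z : z \notin W -> z != w by apply: contra => /eqP ->.
case: p' rc memr ur => [|a p] rc memr ur.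
  by have := memr x; rewrite !inE => /eqP xw; have := ne _ xW; rewrite xw eqxx.
rewrite /= rcons_path => /and3P[_ pp _].
have inp z : z \notin W -> z \in a :: p.
  by move=> /ne zw; have := memr z; rewrite inE (negPf zw).
apply: path_connect_off es pp _ _ _ (inp x xW) (inp y yW) => z zp.
apply/negP => /W1 zw; move: ur; rewrite -zw => /andP[/negP zp' _]; exact: zp'.
Qed.
End HamiltonianConnected.

Lemma hitting_radius_eq (R : realType) (m' : nat) (s : R) (A : {fset R * R}) (D M : nat) :
  0 < s -> [set` A] `<=` square (m'.+1%:R * s) ->
  (forall b : 'I_m'.+1 * 'I_m'.+1,
    (#|[set c : 'I_m'.+1 * 'I_m'.+1 | link (corner b) (corner c)]%SET| <= D)%N) ->
  (2 * D + 5 < M)%N ->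
  regular (fun z => (M <= npoints A (cell_set s (fold_cell m' z)))%N) ->
  (forall r, r < 50%:R * s -> ~ k_connected 2 (gilbert A r)) ->
  hitting_radius (k_connected 2) A = hitting_radius hamiltonian A.
Proof.
move=> s0 AS lkD MD reg iso; congr ereal_inf; congr image.
apply/seteqP; split=> r /= [r0 h]; split=> //.
  have rs : 50%:R * s <= r by rewrite leNgt; apply/negP => /iso.
  exact: (gilbert_hamiltonian s0 AS rs lkD MD reg h).
exact: (hamiltonian_2connected (@gilbert_sym _ A r) h).
Qed.

(** * The mesh and the exponents *)

Section Asymptotics.
Variable R : realType.

Lemma pow_fact_le (x : R) (k : nat) : 0 <= x -> x ^+ k / k`!%:R <= expR x.
Proof.
move=> x0; case: k => [|k]; first by rewrite expr0 fact0 divr1 -expR0 ler_expR.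
by apply: le_trans (expR_ge1Dxn k x0); rewrite lerDr.
Qed.

(** Since [t ^ k / k! <= 100 ^ k * exp (t / 100)], the polynomial factor costs only one per cent of
    the exponent. *)
Lemma poisson_few (M : nat) : exists2 A : R, 0 <= A & forall t : R, 0 <= t ->
  \sum_(k < M) poisson_weight t k <= A * expR (- (99%:R / 100%:R * t)).
Proof.
exists (\sum_(k < M) 100%:R ^+ k); first by apply: sumr_ge0 => k _; exact: exprn_ge0.
move=> t t0; rewrite mulr_suml; apply: ler_sum => k _.
have -> : expR (- (99%:R / 100%:R * t)) = expR (- t) * expR (t / 100%:R).
  by rewrite -expRD; congr expR; field.
rewrite /poisson_weight -[leLHS]mulrA [leRHS]mulrCA ler_wpM2l ?expR_ge0 //.
have -> : t ^+ k / k`!%:R = 100%:R ^+ k * ((t / 100%:R) ^+ k / k`!%:R).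
  by rewrite mulrA -exprMn mulrCA divff ?mulr1 // pnatr_eq0.
by rewrite ler_wpM2l ?exprn_ge0 // pow_fact_le // divr_ge0.
Qed.

Lemma half_sqr_le_expR (x : R) : 0 <= x -> x ^+ 2 / 2%:R <= expR x.
Proof. by move=> x0; have := pow_fact_le 2 x0; rewrite (_ : 2`! = 2%N). Qed.

(* The cells have area s ^+ 2 close to ln n / 8700, where 8700 lies between the bound 8253
   of reach_list and the bound 9140 of regular. *)
Lemma mesh_choice (T : nat) (l : R) : 1 <= l -> 200%:R <= T%:R :> R ->
  2%:R * (T%:R + 1) ^+ 2 <= l -> exists m' : nat,
  [/\ (T <= m'.+1)%N,
      m'.+1%:R <= 8700%:R * expR (l / 2%:R) :> R &
      l / 8700%:R <= expR l / m'.+1%:R ^+ 2 <= 102%:R / 100%:R * (l / 8700%:R)].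
Proof.
move=> l1 T2 hl; have l0 : 0 < l by exact: lt_le_trans l1.
have e0 := expR_gt0 l.
(* The area [expR l / m ^ 2] equals [l / 8700] for [m ^ 2 = y]; the mesh takes for [m] the integer
   part of the root. *)
set y := 8700%:R * expR l / l.
have y0 : 0 <= y by rewrite /y divr_ge0 ?mulr_ge0 // ltW.
set x := Num.sqrt y.
have x0 : 0 <= x by exact: sqrtr_ge0.
have x2 : x ^+ 2 = y by rewrite sqr_sqrtr.
have /andP[lo hi] := truncn_itv x0.
have Tx : T%:R + 1 <= x.
  rewrite -(ger0_norm (_ : 0 <= T%:R + 1)) ?addr_ge0 // -sqrtr_sqr ler_wsqrtr //.
  rewrite /y ler_pdivlMr //; have := half_sqr_le_expR (ltW l0).
  have : (T%:R + 1) ^+ 2 * l <= l ^+ 2 / 2%:R.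
    by have := ler_wpM2r (ltW l0) hl; lra.
  by move=> h1 h2; lra.
have Tm : (T < Num.truncn x)%N.
  by rewrite -(ltr_nat R); rewrite -natr1 in hi; lra.
case: (Num.truncn x) lo hi Tm => [//|m'] lo hi Tm.
exists m'; have m0 : 0 < m'.+1%:R :> R by rewrite ltr0n.
have Tm' : T%:R <= m'.+1%:R :> R by rewrite ler_nat ltnW.
have m2 : m'.+1%:R ^+ 2 <= y by rewrite -x2 lerXn2r // nnegrE // ltW.
split; first exact: ltnW.
- rewrite -(@ler_pXn2r _ 2) ?nnegrE ?mulr_ge0 ?expR_ge0 ?ler0n // exprMn -expRM_natl.
  have -> : 2%:R * (l / 2%:R) = l by field.
  apply: (le_trans m2); rewrite /y ler_pdivrMr //.
  have : expR l <= expR l * l by rewrite ler_peMr // ltW.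
  by move: (expR l) e0 => E E0 h; lra.
- have ye : y * (l / 8700%:R) = expR l by rewrite /y; field; rewrite gt_eqF.
  apply/andP; split.
    by rewrite ler_pdivlMr ?exprn_gt0 // -ye mulrC ler_wpM2r // divr_ge0 // ltW.
  rewrite ler_pdivrMr ?exprn_gt0 // -ye [leRHS]mulrAC ler_wpM2r ?divr_ge0 ?(ltW l0) //.
  (* Because [m'.+1] is at least 200, rounding changes [x] by a factor of at most [201 / 200], whose
     square is below 1.02. *)
  rewrite -x2; have xm : x <= 201%:R / 200%:R * m'.+1%:R.
    by rewrite -natr1 in hi; lra.
  have := @lerXn2r _ 2 x (201%:R / 200%:R * m'.+1%:R); rewrite !nnegrE => /(_ x0) h.
  apply: (le_trans (h _ xm)); first by rewrite mulr_ge0 // ltW.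
  by rewrite exprMn; apply: ler_wpM2r; [rewrite exprn_ge0 // ltW | lra].
Qed.
End Asymptotics.

Section Good.
Variable R : realType.

(** This works since [0.99 * 4570 / 8700] exceeds [0.52 = 1/2 + 1/50]; the half compensates the
    growth of [m]. *)
Lemma few_power_bound (A q m t l : R) (k : nat) : 0 <= A -> 0 <= q -> 0 <= m ->
  q <= A * expR (- (99%:R / 100%:R * t)) -> l / 8700%:R <= t ->
  m <= 8700%:R * expR (l / 2%:R) -> 0 <= l -> 4570%:R <= k%:R :> R ->
  m * q ^+ k <= 8700%:R * A ^+ k * expR (- (l / 50%:R)).
Proof.
move=> A0 q0 m0 hq ht hm l0 hk.
have hqk : q ^+ k <= A ^+ k * expR (- (99%:R / 100%:R * t)) ^+ k.
  by rewrite -exprMn; apply: lerXn2r; rewrite // nnegrE // mulr_ge0 // expR_ge0.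
have mq := ler_pM m0 (exprn_ge0 k q0) hm hqk.
apply: (le_trans mq); rewrite mulrACA -expRM_natl -expRD.
apply: ler_wpM2l; first by rewrite mulr_ge0 ?ler0n ?exprn_ge0.
rewrite ler_expR; have h1 : 4570%:R * t <= k%:R * t.
  by rewrite ler_wpM2r //; apply: le_trans ht; rewrite divr_ge0.
by move: h1 ht l0; clear; move=> h1 ht l0; lra.
Qed.

(** Since [8253 * 1.02 / 8700] is below 0.97, a factor [exp (0.03 l)] remains from the number of
    boxes. It is at least [1 + 0.03 l], which covers the constant [206 ^ 2], where [206 = 2 * 103]
    bounds [m / c]. *)
Lemma isolated_exponent (s2 m l c K : R) : 0 <= l -> 0 < m -> 0 < s2 -> 0 <= c ->
  m ^+ 2 * s2 = expR l -> s2 <= 102%:R / 100%:R * (l / 8700%:R) ->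
  m <= 206%:R * c -> K = 8253%:R ->
  l / 10000%:R ^+ 2 <= c ^+ 2 * (s2 * expR (- (K * s2))).
Proof.
move=> l0 m0 s0 c0 ms hs mc ->.
have e1 : expR (- (97%:R / 100%:R * l)) <= expR (- (8253%:R * s2)).
  by rewrite ler_expR; move: hs l0; clear; move=> hs l0; lra.
have e2 : expR l * expR (- (97%:R / 100%:R * l)) = expR (3%:R / 100%:R * l).
  by rewrite -expRD; congr expR; field.
have e3 := expR_ge1Dx (3%:R / 100%:R * l).
have c2 : m ^+ 2 <= 206%:R ^+ 2 * c ^+ 2.
  by rewrite -exprMn; apply: lerXn2r; rewrite ?nnegrE ?mulr_ge0 ?ler0n // ltW.
have h1 : expR l <= 206%:R ^+ 2 * (c ^+ 2 * s2).
  by rewrite -ms mulrA ler_wpM2r // ltW.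
have h2 : expR l * expR (- (97%:R / 100%:R * l))
    <= 206%:R ^+ 2 * (c ^+ 2 * s2) * expR (- (8253%:R * s2)).
  by apply: ler_pM => //; rewrite expR_ge0.
have h3 : expR (3%:R / 100%:R * l)
    <= 206%:R ^+ 2 * (c ^+ 2 * (s2 * expR (- (8253%:R * s2)))).
  by rewrite -e2 (le_trans h2) // !mulrA.
move: h3 e3 l0; move: (c ^+ 2 * _) (expR _) => z e.
clear; move=> h3 e3 l0; lra.
Qed.

Lemma div103_ge (m' : nat) : (Z.to_nat 101000 <= m'.+1)%N ->
  (m'.+1 <= 206 * (m'.+1 %/ 103))%N.
Proof. by move=> h; lia. Qed.

Lemma bad_sum_le (x y c a e k : R) : 0 <= x -> x <= c * e -> y <= a * e ->
  0 <= c -> 0 <= e -> e <= 1 -> 0 <= k ->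
  x ^+ 2 + 2%:R * k * x + k ^+ 2 * y <= (c ^+ 2 + 2%:R * k * c + k ^+ 2 * a) * e.
Proof.
move=> x0 xe ye c0 e0 e1 k0.
have -> : (c ^+ 2 + 2%:R * k * c + k ^+ 2 * a) * e
    = c ^+ 2 * e + 2%:R * k * (c * e) + k ^+ 2 * (a * e) by ring.
apply: lerD; first apply: lerD.
- have h := @lerXn2r _ 2 _ _ x0 (mulr_ge0 c0 e0) xe; apply: (le_trans h).
  by rewrite exprMn; apply: (ler_wpM2l (sqr_ge0 _)); rewrite expr2; exact: (ler_piMl e0 e1).
- by apply: ler_wpM2l xe; apply: mulr_ge0.
- by apply: ler_wpM2l ye; exact: sqr_ge0.
Qed.

Lemma div_sqr_le (l c : R) : 0 <= l -> 1 <= c -> l * (c ^+ 2)^-1 <= l / c.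
Proof.
move=> l0 c1; have c0 : 0 < c by exact: lt_le_trans c1.
by rewrite ler_wpM2l // lef_pV2 ?posrE ?exprn_gt0 // expr2 ler_peMl // ltW.
Qed.

Lemma bad_event_bound : exists C g L0 : R, 0 < g /\ forall n d (Omega : measurableType d)
  (P : probability Omega R) (X : Omega -> {fset R * R}),
  poisson_process P 1 (square (Num.sqrt n%:R)) X -> L0 <= ln (n%:R : R) ->
  exists G : set Omega, [/\ measurable G, pr P G <= C * expR (- (ln n%:R * g)) &
    forall w, ~ G w ->
      hitting_radius (k_connected 2) (X w) = hitting_radius hamiltonian (X w)].
Proof.
have [D lkD] := link_degree; have [W ballW] := near_degree 101000.
have [K edgeK] := edge_card; pose M := (2 * D + 6)%N.
have [A A0 fewA] := poisson_few R M.
pose T := Z.to_nat 101000; pose N := Z.to_nat 2285.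
pose C1 := 8700%:R * A ^+ (2 * N).
pose g : R := (10000%:R ^+ 2)^-1.
have C10 : 0 <= C1 by rewrite mulr_ge0 ?ler0n ?exprn_ge0.
(* The last summand 1 of the constant is for the absence of isolated points, the rest for irregular
   windows. In the threshold, the terms provide in turn [1 <= l], the assumption of [mesh_choice],
   and [A <= l / 10000]. *)
exists ((2 ^ W)%:R * (C1 ^+ 2 + 2%:R * K%:R * C1 + K%:R ^+ 2 * A) + 1), g,
  (1 + 2%:R * (T%:R + 1) ^+ 2 + 10000%:R * A).
have K8253 : (Z.to_nat 8253)%:R = 8253%:R :> R by congr (_%:R); vm_compute.
have N4570 : 4570%:R <= (2 * N)%:R :> R by rewrite ler_nat /N; clear; lia.
have N0 : (0 < N)%N by rewrite /N; clear; lia.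
have g0 : 0 < g by rewrite invr_gt0; apply: exprn_gt0; rewrite ltr0n.
split=> // n d Omega P X hX.
set l : R := ln n%:R => hl.
have T0 : 0 <= 2%:R * (T%:R + 1) ^+ 2 :> R by rewrite mulr_ge0 // sqr_ge0.
have l1 : 1 <= l by move: hl A0 T0; clear; lra.
have l0 : 0 <= l by exact: le_trans l1.
have hT : 2%:R * (T%:R + 1) ^+ 2 <= l by move: hl A0; clear; lra.
have hA : A <= l / 10000%:R by move: hl A0 T0; clear; lra.
have T200 : 200%:R <= T%:R :> R by rewrite ler_nat /T; clear; lia.
have nE : expR l = n%:R.
  rewrite lnK // posrE ltr0n lt0n; apply: contraTneq l1 => n0.
  by rewrite /l n0 ln0 // -ltNge ltr01.
have [m' [Tm mle /andP[slo shi]]] := mesh_choice l1 T200 hT.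
have m0 : 0 < m'.+1%:R :> R by rewrite ltr0n.
pose s : R := Num.sqrt n%:R / m'.+1%:R.
have s0 : 0 < s by rewrite divr_gt0 // sqrtr_gt0 -nE expR_gt0.
have sm : m'.+1%:R * s = Num.sqrt n%:R by rewrite mulrC divfK // gt_eqF.
have s2 : s ^+ 2 = expR l / m'.+1%:R ^+ 2 by rewrite expr_div_n sqr_sqrtr ?nE.
rewrite -s2 in slo shi; rewrite -sm in hX.
have s20 : 0 < s ^+ 2 by rewrite exprn_gt0.
set q := \sum_(k < M) poisson_weight (s ^+ 2) k.
have q0 : 0 <= q by apply: sumr_ge0 => k _; apply: poisson_weight_ge0; exact: ltW.
have qA : q <= A * expR (- (99%:R / 100%:R * s ^+ 2)) by apply: fewA; exact: ltW.
pose e := expR (- (l * g)).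
have e0 : 0 <= e by exact: expR_ge0.
have e1 : e <= 1 by rewrite expR_le1 oppr_le0 mulr_ge0 // ltW.
have lg : l * g <= l / 10000%:R.
  by apply: (div_sqr_le l0); rewrite ler1n.
have eE : expR (- (99%:R / 100%:R * s ^+ 2)) <= expR (- (l / 10000%:R)).
  by rewrite ler_expR; move: slo l0; clear; move=> slo l0; lra.
have he : expR (- (l / 10000%:R)) <= e by rewrite ler_expR lerN2; exact: lg.
have qe : q <= A * e := le_trans qA (ler_wpM2l A0 (le_trans eE he)).
(* Here [A <= l / 10000 <= exp (l / 10000)] absorbs the constant of [poisson_few]. *)
have q1 : q <= 1.
  apply: (le_trans qA); apply: (le_trans (ler_wpM2l A0 eE)).
  rewrite expRN ler_pdivrMr; last exact: expR_gt0.
  rewrite mul1r; apply: (le_trans _ (expR_ge1Dx _)).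
  by move: hA; clear; lra.
have hm : Z.le 101000 (Z.of_nat m'.+1) by move: Tm; rewrite /T; clear; lia.
have [Bad [mBad BadP prBad]] := pr_bad s0 hX hm q1 (ballW m') (edgeK m').
pose kap := (m'.+1 %/ 103)%N.
have kap_m : (103 * kap <= m'.+1)%N by rewrite mulnC leq_trunc_div.
have [No [mNo NoP prNo]] := pr_no_isolated s0 hX kap_m.
exists (Bad `|` No); split; first exact: measurableU.
  have noE : pr P No <= e.
    apply: (le_trans prNo); rewrite ler_expR lerN2 natrX.
    apply: (isolated_exponent l0 m0 s20 (ler0n _ kap) _ shi _ K8253).
      by rewrite s2 mulrC divfK //; apply: lt0r_neq0; exact: exprn_gt0.
    by rewrite -natrM ler_nat; exact: div103_ge.
  have xe : m'.+1%:R * q ^+ (2 * N) <= C1 * e.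
    apply: (le_trans (few_power_bound A0 q0 (ltW m0) qA slo mle l0 N4570)).
    apply: (ler_wpM2l C10); rewrite ler_expR lerN2; apply: (le_trans lg).
    by move: l0; clear; move=> l0; lra.
  have x0 : 0 <= m'.+1%:R * q ^+ (2 * N).
    by apply: mulr_ge0; [exact: ltW | exact: exprn_ge0].
  have ye : q ^+ N <= A * e by apply: (le_trans _ qe); exact: (ler_iXnr N0 q0 q1).
  apply: (le_trans (prU_le P mBad mNo)); rewrite mulrDl mul1r; apply: (lerD _ noE).
  rewrite -[leRHS]mulrA; apply: (le_trans prBad (ler_wpM2l (ler0n _ _) _)).
  exact: (bad_sum_le x0 xe ye C10 e0 e1 (ler0n _ K)).
move=> w /not_orP[nBad nNo].
have [XS _ _ _] := hX.
apply: (hitting_radius_eq s0 (XS w) (lkD m') (_ : 2 * D + 5 < M)%N).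
- by rewrite /M; clear; lia.
- by apply: contrapT => h; apply: nBad; exact: BadP.
- by move=> r; exact: NoP.
Qed.
End Good.

(** * Measurability *)

Lemma hamiltonian_iso (T T' : finType) (e : rel T) (e' : rel T') (f : T -> T') (g : T' -> T) :
  cancel f g -> cancel g f -> (forall x y, e' (f x) (f y) = e x y) ->
  hamiltonian e -> hamiltonian e'.
Proof.
move=> fK gK ef [c [/andP[cyc uc] sc memc]]; exists (map f c); split.
- apply/andP; split; last by rewrite map_inj_uniq //; exact: can_inj fK.
  by case: c cyc {uc sc memc} => //= x p; rewrite -map_rcons path_map;
    apply: sub_path => u v /=; rewrite ef.
- by rewrite size_map.
- by move=> x; rewrite -(gK x) mem_map //; exact: can_inj fK.
Qed.

Lemma k_connected_iso (k : nat) (T T' : finType) (e : rel T) (e' : rel T') (f : T -> T')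
    (g : T' -> T) :
  cancel f g -> cancel g f -> (forall x y, e' (f x) (f y) = e x y) ->
  k_connected k e -> k_connected k e'.
Proof.
move=> fK gK ef [kT conn]; split.
  by rewrite -(bij_eq_card (Bijective fK gK)).
move=> W' W'k x y xW yW.
pose W := (f @^-1: W')%SET.
have WE z : (z \in W) = (f z \in W') by rewrite inE.
have Wk : (#|W| < k)%N.
  apply: leq_ltn_trans W'k; rewrite -(card_imset W (can_inj fK)).
  by apply: subset_leq_card; apply/fintype.subsetP => _ /imsetP[z zW ->]; rewrite -WE.
have gW z : z \notin W' -> g z \notin W by rewrite WE gK.
have /connectP[p pp yp] := conn W Wk (g x) (g y) (gW _ xW) (gW _ yW).
apply/connectP; exists (map f p); last by rewrite -{1}(gK x) last_map -yp gK.
rewrite -{1}(gK x) path_map; apply: sub_path pp => u v /=.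
by rewrite !WE ef.
Qed.

Section Measurability.
Variable R : realType.

Lemma finite_gap (I : finType) (f : I -> R) (r : R) :
  exists2 c : R, 0 < c & forall i, f i <= r + c -> f i <= r.
Proof.
suff gen (s : seq I) : exists2 c : R, 0 < c & forall i, i \in s -> f i <= r + c -> f i <= r.
  have [c c0 h] := gen (enum I); exists c => // i; apply: h; exact: mem_enum.
elim: s => [|i s [c c0 h]]; first by exists 1.
have [fi|fi] := lerP (f i) r.
  by exists c => // j; rewrite inE => /orP[/eqP -> //|]; exact: h.
exists (Num.min c ((f i - r) / 2%:R)).
  by rewrite lt_min c0 divr_gt0 // subr_gt0.
move=> j; rewrite inE => /orP[/eqP ->|js] hj.
  have : f i <= r + (f i - r) / 2%:R.
    by apply: (le_trans hj); rewrite lerD2l ge_min lexx orbT.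
  by move: fi; clear; move=> ? ?; lra.
by apply: h => //; apply: (le_trans hj); rewrite lerD2l ge_min lexx.
Qed.

Lemma gilbert_right_constant (A : {fset R * R}) (r : R) : exists2 c : R, 0 < c &
  forall r', r <= r' <= r + c -> gilbert A r' = gilbert A r.
Proof.
have [c c0 h] := finite_gap (fun i : A * A => euclidean_dist (val i.1) (val i.2)) r.
exists c => // r' /andP[rr' r'c]; apply/funext => x; apply/funext => y.
rewrite /gilbert /=; congr (_ && _); apply/idP/idP => d.
  by apply: (h (x, y)); exact: le_trans r'c.
exact: le_trans rr'.
Qed.

Lemma gilbert_mono (A : {fset R * R}) (r r' : R) (x y : A) :
  r <= r' -> gilbert A r x y -> gilbert A r' x y.
Proof. by move=> rr' /andP[xy d]; rewrite /gilbert /= xy (le_trans d). Qed.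

Lemma hamiltonian_mono (T : finType) (e e' : rel T) :
  subrel e e' -> hamiltonian e -> hamiltonian e'.
Proof.
move=> ee' [c [/andP[cyc uc] sc memc]]; exists c; split=> //.
by apply/andP; split=> //; apply: sub_cycle cyc.
Qed.

(** This reduces the event to countably many radii. The graph does not change on a short interval to
    the right of any radius, so a radius separating the properties can be moved to a rational one;
    for the same reason a rational separating radius separates the infima. *)
Lemma hitting_radius_neq (A : {fset R * R}) :
  hitting_radius (k_connected 2) A <> hitting_radius hamiltonian A <->
  exists2 q : rat, 0 <= ratr q :> R &
    k_connected 2 (gilbert A (ratr q)) /\ ~ hamiltonian (gilbert A (ratr q)).
Proof.
split.
  move=> neq; apply: contrapT => no; apply: neq; congr ereal_inf; congr image.
  apply/seteqP; split=> r /= [r0 h]; split=> //; last first.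
    exact: (hamiltonian_2connected (@gilbert_sym _ A r) h).
  apply: contrapT => nh; apply: no.
  have [c c0 hc] := gilbert_right_constant A r.
  have rc : r < r + c by rewrite ltrDl.
  have [q] := rat_in_itvoo rc; rewrite in_itv /= => /andP[rq qc].
  have qE : gilbert A (ratr q) = gilbert A r by apply: hc; rewrite !ltW.
  by exists q; [exact: ltW (le_lt_trans r0 rq) | rewrite qE].
move=> [q q0 [h2 nh]] eq.
have le2 : (hitting_radius (k_connected 2) A <= (ratr q)%:E)%E.
  by apply: ereal_inf_lbound; exists (ratr q).
rewrite eq in le2.
have [c c0 hc] := gilbert_right_constant A (ratr q).
have lt2 : (hitting_radius hamiltonian A < (ratr q + c)%:E)%E.
  by apply: (le_lt_trans le2); rewrite lte_fin ltrDl.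
have [_ [r [r0 hr] <-]] := ereal_inf_lt lt2; rewrite lte_fin => rc.
apply: nh; have [rq|qr] := lerP r (ratr q).
  by apply: hamiltonian_mono hr => x y; exact: gilbert_mono.
by rewrite -(hc r) // !ltW.
Qed.
End Measurability.

(** * Approximation by occupied cells *)

Section Discretisation.
Variables (R : realType) (a q : R).
Hypothesis a_gt0 : 0 < a.
Hypothesis q_ge0 : 0 <= q.

Definition mesh (k : nat) : R := a / k.+1%:R.

Lemma mesh_gt0 (k : nat) : 0 < mesh k. Proof. by rewrite divr_gt0. Qed.

Lemma mesh_total (k : nat) : k.+1%:R * mesh k = a.
Proof. by rewrite mulrC divfK // pnatr_eq0. Qed.

(** Adjacency of any points in the two cells is overestimated; this becomes exact on a fixed finite
    point set once the cells are small. *)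
Definition cell_adj (k : nat) (b c : 'I_k.+1 * 'I_k.+1) : bool :=
  `[< exists x y, [/\ square a x, square a y, grid_cell k (mesh k) x = b,
     grid_cell k (mesh k) y = c & euclidean_dist x y <= q] >].

Definition occupied (k : nat) (A : {fset R * R}) : {set 'I_k.+1 * 'I_k.+1} :=
  [set b | (0 < npoints A (cell_set (mesh k) b))%N]%SET.

Definition cell_graph (k : nat) (O : {set 'I_k.+1 * 'I_k.+1}) : rel {b | b \in O} :=
  [rel u v | (u != v) && cell_adj (val u) (val v)].

Let sqr_dist (x y : R * R) : R := (x.1 - y.1) ^+ 2 + (x.2 - y.2) ^+ 2.

Lemma grid_same (k : nat) (x y : R) : 0 <= x <= a -> 0 <= y <= a ->
  grid k (mesh k) x = grid k (mesh k) y -> `|x - y| <= mesh k.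
Proof.
rewrite -(mesh_total k) => hx hy xy.
have := grid_close (mesh_gt0 k) hx hy (k := 0); rewrite xy Z.sub_diag mul1r.
by apply; exact: Z.le_refl.
Qed.

Lemma sqr_close (s x y x' y' : R) : 0 <= x <= a -> 0 <= y <= a -> 0 <= x' <= a ->
  0 <= y' <= a -> `|x - x'| <= s -> `|y - y'| <= s ->
  (x - y) ^+ 2 <= (x' - y') ^+ 2 + 4%:R * a * s.
Proof.
move=> /andP[x0 xa] /andP[y0 ya] /andP[x0' xa'] /andP[y0' ya'].
rewrite !ler_norml => /andP[h1 h2] /andP[h3 h4].
have e : (x - y) ^+ 2 - (x' - y') ^+ 2 = ((x - x') - (y - y')) * ((x - y) + (x' - y')).
  by ring.
have n1 : `|(x - x') - (y - y')| <= 2%:R * s by rewrite ler_norml; apply/andP; split; lra.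
have n2 : `|(x - y) + (x' - y')| <= 2%:R * a by rewrite ler_norml; apply/andP; split; lra.
have := ler_pM (normr_ge0 _) (normr_ge0 _) n1 n2; rewrite -normrM -e => h.
have := le_trans (ler_norm _) h => h'.
rewrite -lerBlDl; apply: (le_trans h'); rewrite le_eqVlt; apply/orP; left.
by apply/eqP; ring.
Qed.

(** The finitely many squared distances leave a gap above 0 and a gap above [q ^ 2]. When the mesh
    is fine compared with these gaps, distinct points occupy distinct cells and [cell_adj] joins no
    pair at distance greater than [q]. *)
Lemma discretisation (A : {fset R * R}) : [set` A] `<=` square a ->
  exists k0, forall k, (k0 <= k)%N -> exists (f : A -> {b | b \in occupied k A})
    (g : {b | b \in occupied k A} -> A),
    [/\ cancel f g, cancel g f &
        forall x y, @cell_graph k (occupied k A) (f x) (f y) = gilbert A q x y].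
Proof.
move=> AS.
have inS (v : A) : square a (val v) by apply: AS; exact: (valP v).
have [c1 c10 sep] := finite_gap (fun i : A * A => sqr_dist (val i.1) (val i.2)) 0.
have [c2 c20 adj] := finite_gap (fun i : A * A => sqr_dist (val i.1) (val i.2)) (q ^+ 2).
pose c := Num.min c1 c2.
have c0 : 0 < c by rewrite lt_min c10.
exists (Num.truncn (10%:R * a ^+ 2 / c)) => k hk.
(* Two points of one cell have squared distance at most [2 * a * mesh k], and moving both points of
   a pair within their cells changes it by at most [8 * a * mesh k]; the factor 10 covers both. *)
have ms : 10%:R * a * mesh k <= c.
  have : 10%:R * a ^+ 2 / c < k.+1%:R.
    by apply: (lt_le_trans (truncnS_gt _)); rewrite ler_nat ltnS.
  rewrite ltr_pdivrMr // => /ltW h.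
  rewrite /mesh mulrA ler_pdivrMr // mulrC [c * _]mulrC.
  by apply: (le_trans _ h); rewrite le_eqVlt; apply/orP; left; apply/eqP; ring.
have [m1 m2] : 10%:R * a * mesh k <= c1 /\ 10%:R * a * mesh k <= c2.
  by move: ms; rewrite le_min => /andP[].
have s0 := mesh_gt0 k.
have sa : mesh k <= a.
  by rewrite -[leRHS](mesh_total k) ler_peMl ?ler1n // ltW.
have as0 : 0 <= a * mesh k by rewrite mulr_ge0 // ltW.
have cell_in (v : A) : grid_cell k (mesh k) (val v) \in occupied k A.
  rewrite finset.in_set -(npoints_card (P := [pred u : A | grid_cell k (mesh k) (val u)
    == grid_cell k (mesh k) (val v)])); first by apply/card_gt0P; exists v; rewrite inE /=.
  move=> u /=; apply/idP/idP => [/eqP gu|]; last by rewrite inE => -[_ ->].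
  by apply: mem_set; split; [rewrite mesh_total; exact: inS | exact: gu].
pose f (v : A) : {b | b \in occupied k A} := exist _ (grid_cell k (mesh k) (val v)) (cell_in v).
have f_surj u : exists v, f v = u.
  case: u => b bO; have := bO; rewrite finset.in_set.
  rewrite -(npoints_card (P := [pred u : A | grid_cell k (mesh k) (val u) == b])).
    by case/card_gt0P => v /eqP vb; exists v; apply: val_inj.
  move=> u /=; apply/idP/idP => [/eqP gu|]; last by rewrite inE => -[_ ->].
  by apply: mem_set; split; [rewrite mesh_total; exact: inS | exact: gu].
have close (u v : A) : f u = f v ->
    `|(val u).1 - (val v).1| <= mesh k /\ `|(val u).2 - (val v).2| <= mesh k.
  move=> /(congr1 val) [e1 e2]; have [u1 u2] := squareP (inS u).
  by have [v1 v2] := squareP (inS v); split; apply: grid_same.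
have f_inj : injective f.
  move=> u v fuv; have [h1 h2] := close u v fuv.
  have : sqr_dist (val u) (val v) <= 0.
    apply: (sep (u, v)); rewrite add0r; apply: le_trans m1.
    have sq (t : R) : `|t| <= mesh k -> t ^+ 2 <= a * mesh k.
      move=> ht; rewrite -real_normK ?num_real // expr2.
      by apply: ler_pM => //; exact: le_trans sa.
    have := lerD (sq _ h1) (sq _ h2); rewrite -/(sqr_dist _ _) -mulrA.
    by move: (sqr_dist _ _) (a * mesh k) as0 => z y; clear; move=> ? ?; lra.
  rewrite /sqr_dist => le0; apply: val_inj.
  have z1 : ((val u).1 - (val v).1) ^+ 2 = 0.
    by apply/eqP; rewrite eq_le sqr_ge0 andbT (le_trans _ le0) // lerDl sqr_ge0.
  have z2 : ((val u).2 - (val v).2) ^+ 2 = 0.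
    by apply/eqP; rewrite eq_le sqr_ge0 andbT (le_trans _ le0) // lerDr sqr_ge0.
  move: z1 z2 => /eqP + /eqP; rewrite !sqrf_eq0 !subr_eq0 => /eqP e1 /eqP e2.
  by rewrite (surjective_pairing (val u)) e1 e2 -surjective_pairing.
have [g gK] := choice f_surj.
exists f, g; split=> //; first by move=> v; apply: f_inj; rewrite gK.
move=> u v; rewrite /cell_graph /gilbert /= (inj_eq f_inj); congr (_ && _).
apply/asboolP/idP => [[x [y [xS yS xu yv d]]]|d]; last first.
  by exists (val u), (val v).
rewrite euclidean_dist_le // in d; rewrite euclidean_dist_le //.
apply: (adj (u, v)) => /=; rewrite /sqr_dist /=.
have [x1 x2] := squareP xS; have [y1 y2] := squareP yS.
have [u1 u2] := squareP (inS u); have [v1 v2] := squareP (inS v).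
have [eu1 eu2] := (congr1 fst xu, congr1 snd xu).
have [ev1 ev2] := (congr1 fst yv, congr1 snd yv).
have k1 := sqr_close u1 v1 x1 y1 (grid_same u1 x1 (esym eu1)) (grid_same v1 y1 (esym ev1)).
have k2 := sqr_close u2 v2 x2 y2 (grid_same u2 x2 (esym eu2)) (grid_same v2 y2 (esym ev2)).
apply: (le_trans (lerD k1 k2)); move: d m2 as0; rewrite -!mulrA.
move: ((x.1 - y.1) ^+ 2) ((x.2 - y.2) ^+ 2) (q ^+ 2) (a * mesh k) => t1 t2 q2 p.
by clear; move=> ? ? ?; lra.
Qed.

(** Measurability is given only for counts in Borel sets. The event is therefore the lower limit of
    events that depend on the set of occupied cells alone, the properties being invariant under
    isomorphism. *)
Lemma measurable_graph_event d (Omega : measurableType d) (P : probability Omega R)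
    (X : Omega -> {fset R * R}) : poisson_process P 1 (square a) X ->
  measurable [set w | k_connected 2 (gilbert (X w) q) /\ ~ hamiltonian (gilbert (X w) q)].
Proof.
move=> hX; pose prop (T : finType) (e : rel T) := k_connected 2 e /\ ~ hamiltonian e.
have iso (T T' : finType) (e : rel T) (e' : rel T') (f : T -> T') (g : T' -> T) :
    cancel f g -> cancel g f -> (forall x y, e' (f x) (f y) = e x y) ->
    prop T e <-> prop T' e'.
  move=> fK gK ef; have eg x y : e (g x) (g y) = e' x y by rewrite -ef !gK.
  split=> -[h2 nh]; split.
  - exact: (k_connected_iso fK gK ef h2).
  - by move=> h; apply: nh; exact: (hamiltonian_iso gK fK eg h).
  - exact: (k_connected_iso gK fK eg h2).
  - by move=> h; apply: nh; exact: (hamiltonian_iso fK gK ef h).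
pose F k := [set w | prop _ (@cell_graph k (occupied k (X w)))].
have mF k : measurable (F k).
  have hXk : poisson_process P 1 (square (k.+1%:R * mesh k)) X by rewrite mesh_total.
  have mO (O : {set 'I_k.+1 * 'I_k.+1}) : measurable [set w | occupied k (X w) = O].
    pose B (b : 'I_k.+1 * 'I_k.+1) : set Omega :=
      if b \in O then ~` [set w | npoints (X w) (cell_set (mesh k) b) = 0%N]
      else [set w | npoints (X w) (cell_set (mesh k) b) = 0%N].
    have mB b : measurable (B b).
      have m0 := measurable_count (mesh_gt0 k) hXk b 0.
      by rewrite /B; case: ifP => _ //; exact: measurableC.
    rewrite (_ : [set w | _] = \bigcap_(b in setT) B b).
      by apply: fin_bigcap_measurable => // b _; exact: mB.
    apply/seteqP; split=> w /=.
      move=> E b _; rewrite /B -E; case: ifP; rewrite finset.in_set lt0n.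
        by move/eqP.
      by move/negbFE/eqP.
    move=> h; apply/finset.setP => b; have := h b I; rewrite /B finset.in_set lt0n.
    by case: ifP => _ /= /eqP; [move/negPf => -> | move=> ->].
  rewrite (_ : F k = \bigcup_(O in [set O | prop _ (@cell_graph k O)])
      [set w | occupied k (X w) = O]).
    by apply: fin_bigcup_measurable => // O _; exact: mO.
  apply/seteqP; split=> w /= => [h|[U h eqU]].
    by exists (occupied k (X w)).
  by rewrite /F /= eqU.
rewrite (_ : [set w | _] = \bigcup_k0 \bigcap_(k in [set k | (k0 <= k)%N]) F k).
  by apply: bigcupT_measurable => k0; apply: bigcap_measurable => //; exists k0 => /=.
have XS w : [set` X w] `<=` square a by case: hX.
apply/seteqP; split=> w /=.
  have [k0 hk0] := discretisation (XS w).
  move=> h; exists k0 => // k /= kk; have [f [g [fK gK ef]]] := hk0 k kk.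
  by apply/(iso _ _ _ _ f g fK gK ef).
move=> [k1 _ h]; have [k0 hk0] := discretisation (XS w).
have [f [g [fK gK ef]]] := hk0 (maxn k0 k1) (leq_maxl _ _).
by apply/(iso _ _ _ _ f g fK gK ef); apply: h; rewrite /= leq_maxr.
Qed.
End Discretisation.

Lemma measurable_hitting_eq (R : realType) (a : R) d (Omega : measurableType d)
    (P : probability Omega R) (X : Omega -> {fset R * R}) : 0 < a ->
  poisson_process P 1 (square a) X ->
  measurable [set w | hitting_radius (k_connected 2) (X w)
                      = hitting_radius hamiltonian (X w)].
Proof.
move=> a0 hX.
pose F (q : rat) : set Omega := if (0 <= q) then [set w |
  k_connected 2 (gilbert (X w) (ratr q)) /\ ~ hamiltonian (gilbert (X w) (ratr q))]
  else set0.
rewrite (_ : [set w | _] = ~` (\bigcup_q F q)).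
  apply: measurableC; apply: bigcupT_measurable_rat => q; rewrite /F.
  case: ifP => // q0; apply: (measurable_graph_event a0 _ hX).
  by rewrite ler0q.
apply/seteqP; split=> w /=.
  move=> eq [q _]; rewrite /F; case: ifP => // q0 h.
  by apply: (hitting_radius_neq (X w)).2 eq; exists q => //; rewrite ler0q.
move=> no; apply: contrapT => /(hitting_radius_neq (X w)).1[q q0 h].
by apply: no; exists q => //; rewrite /F; rewrite ler0q in q0; rewrite q0.
Qed.

Lemma hitting_radius_small (R : realType) (A : {fset R * R}) : (#|` A| <= 1)%N ->
  hitting_radius (k_connected 2) A = hitting_radius hamiltonian A.
Proof.
rewrite cardfE => A1.
have no (e : rel A) : ~ k_connected 2 e.
  by case; rewrite ltnNge (leq_trans A1).
congr ereal_inf; congr image; apply/seteqP; split=> r [r0 h]; first by case: (no _ h).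
by case: (no _ (hamiltonian_2connected (@gilbert_sym _ A r) h)).
Qed.

Theorem theorem1 (R : realType) (d : nat -> measure_display)
    (Omega : forall n : nat, measurableType (d n))
    (P : forall n : nat, probability (Omega n) R)
    (X : forall n : nat, Omega n -> {fset R * R})
    (hX : forall n : nat,
      poisson_process (P n) 1 (square (Num.sqrt (n%:R : R))) (X n)) :
  whp P (fun n : nat =>
    [set w : Omega n | hitting_radius (k_connected 2) (X n w)
                       = hitting_radius hamiltonian (X n w)]).
Proof.
set E := fun n : nat => _.
have mE n : measurable (E n).
  (* For [n = 0] the square is a single point and has no mesh; with at most one vertex neither
     property ever holds. *)
  case: n => [|n]; last first.
    by apply: (measurable_hitting_eq _ (hX n.+1)); rewrite sqrtr_gt0 ltr0Sn.
  rewrite (_ : E 0%N = setT); first exact: measurableT.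
  apply/seteqP; split=> // w _ /=; apply: hitting_radius_small.
  have [X0 _ _ _] := hX 0%N.
  have X1 x : x \in X 0%N w -> x = (0, 0).
    move=> /(X0 w); rewrite sqrtr0 => -[] /=.
    rewrite !in_itv /= -!eq_le; case: x => u v /= /eqP <- /eqP <- //.
  rewrite -(cardfs1 ((0, 0) : R * R)).
  by apply: fsubset_leq_card; apply/fsubsetP=> x /X1 ->; rewrite inE.
split=> //.
have [C [g [L0 [g0 bound]]]] := bad_event_bound R.
have low n : L0 <= ln (n%:R : R) -> 1 - C * expR (- (ln n%:R * g)) <= pr (P n) (E n).
  move=> /(bound n _ _ (P n) (X n) (hX n)) [G [mG Gle Gsub]].
  apply: (@le_trans _ _ (pr (P n) (~` G))); first by rewrite pr_setC // lerB.
  by apply: pr_le; [exact: measurableC | exact: mE | move=> w /Gsub].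
apply: cvg_EFin; first by apply: nearW => n; exact: fin_num_measure.
rewrite -[_ \o _]/(fun n => pr (P n) (E n)).
have lnoo (A : R) : \forall n \near \oo, A <= ln (n%:R : R).
  near=> n; rewrite -[A]expRK ler_ln ?posrE ?expR_gt0 //.
    by near: n; exact: nbhs_infty_ger.
  by rewrite ltr0n; near: n; exact: nbhs_infty_gt.
have lim : (1 - C * expR (- (ln (n%:R : R) * g))) @[n --> \oo] --> (1 : R).
  have h : (ln (n%:R : R) * g) @[n --> \oo] --> +oo.
    apply/cvgryPge => A; near=> n; rewrite -ler_pdivrMr //.
    by near: n; exact: lnoo.
  have h2 := cvg_comp _ _ h (@cvgr_expR R).
  rewrite -[X in _ --> X]subr0 -[X in _ - X](mulr0 C).
  by apply: cvgB; [exact: cvg_cst | apply: cvgM => //; exact: cvg_cst].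
apply: (squeeze_cvgr _ lim (cvg_cst (1 : R))).
near=> n; apply/andP; split; first by apply: low; near: n; exact: lnoo.
by rewrite -(prT (P n)); apply: pr_le.
Unshelve. all: by end_near. Qed.
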